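(* Let $n\geq5$. The set of copositive real symmetric $n\times n$ matrices is not a spectrahedral shadow. Moreover, it does not have a positive definition in the relational structure with domain $\mathbb{R}$ whose relations consist of all spectrahedra and the inequality relation $\neq$.
   Context: A real symmetric $n\times n$ matrix $A$ is copositive if $x^{\top}Ax\ge0$ for every vector $x\in\mathbb{R}^n$ with nonnegative entries. The set of real symmetric $n\times n$ matrices is identified with $\mathbb{R}^{n(n+1)/2}$. A set $K\subseteq\mathbb{R}^m$ is a spectrahedron if $K=\{x\in\mathbb{R}^m\mid A_0+x_1A_1+\cdots+x_mA_m\succeq0\}$ for some real symmetric matrices $A_0,\dots,A_m$ of the same size ($\succeq 0$ means positive semidefinite). $K\subseteq\mathbb{R}^m$ is a spectrahedral shadow if there are real symmetric matrices $A_0,\dots,A_m,B_1,\dots,B_l$ of the same size with $K=\{x\in\mathbb{R}^m\mid\exists y\in\mathbb{R}^l:\ A_0+\sum_i x_iA_i+\sum_j y_jB_j\succeq0\}$. A first-order formula is positive if it is built from atomic formulas (including equalities) by existential and universal quantification, conjunction, and disjunction (no negation). A set has a positive definition in a relational structure if it is the set of tuples satisfying some positive formula in the signature of that structure. *)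

(* Defs.v *)
From HB Require Import structures.
From mathcomp Require Import all_boot all_order all_algebra.
From mathcomp Require Import all_classical all_reals.
From mathcomp Require Import zify.

Set Implicit Arguments.
Unset Strict Implicit.
Unset Printing Implicit Defensive.

Import Order.TTheory GRing.Theory Num.Theory.

Local Open Scope classical_set_scope.
Local Open Scope ring_scope.

Section Matrices.
Variable R : realType.

Definition psd n (A : 'M[R]_n) : Prop :=
  A \is symmetricmx /\
  forall x : 'cV[R]_n, 0 <= (x^T *m A *m x) ord0 ord0.

Definition copositive n (A : 'M[R]_n) : Prop :=
  A \is symmetricmx /\
  forall x : 'cV[R]_n, (forall i, 0 <= x i ord0) ->
    0 <= (x^T *m A *m x) ord0 ord0.

Lemma symmetricmxP n (A : 'M[R]_n) : reflect (A^T = A) (A \is symmetricmx).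
Proof.
apply: (iffP idP) => [|AT]; rewrite is_hermitianmxE expr0 scale1r map_mx_id //.
  by move/eqP => {2}->.
by rewrite AT.
Qed.

End Matrices.

Section Spectrahedra.
Variable R : realType.

Definition spectrahedron m (K : set 'rV[R]_m) : Prop :=
  exists (d : nat) (A0 : 'M[R]_d) (A : 'I_m -> 'M[R]_d),
    [/\ A0 \is symmetricmx, forall i, A i \is symmetricmx &
        K = [set x : 'rV[R]_m | psd (A0 + \sum_i x ord0 i *: A i)]].

Definition spectrahedral_shadow m (K : set 'rV[R]_m) : Prop :=
  exists (d l : nat) (A0 : 'M[R]_d) (A : 'I_m -> 'M[R]_d) (B : 'I_l -> 'M[R]_d),
    [/\ A0 \is symmetricmx, forall i, A i \is symmetricmx,
        forall j, B j \is symmetricmx &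
        K = [set x : 'rV[R]_m | exists y : 'rV[R]_l,
          psd (A0 + \sum_i x ord0 i *: A i + \sum_j y ord0 j *: B j)]].

End Spectrahedra.

Definition triangle n : {set 'I_n * 'I_n} :=
  finset (fun p : 'I_n * 'I_n => (p.1 <= p.2)%N).

Lemma card_triangle n : #|triangle n| = (n * n.+1)./2.
Proof.
transitivity (\sum_(j < n) j.+1)%N; last first.
  elim: n => [|n IHn]; first by rewrite big_ord0.
  rewrite big_ord_recr IHn [LHS]/=.
  have -> : (n.+1 * n.+2 = n * n.+1 + n.+1.*2)%N by rewrite -muln2; nia.
  by rewrite halfD odd_double andbF doubleK.
rewrite -sum1_card (eq_bigl (fun p : 'I_n * 'I_n => (p.1 <= p.2)%N)); last first.
  by move=> p; rewrite inE.
rewrite -(pair_big_dep xpredT (fun i j : 'I_n => (i <= j)%N) (fun _ _ => 1%N)) /=.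
rewrite (exchange_big_dep xpredT) //=; apply: eq_bigr => j _.
by rewrite -(big_ord_widen n (fun=> 1%N) (ltn_ord j)) sum1_card card_ord.
Qed.

Section Coordinates.
Variables (R : realType) (n : nat).

(* The identification of symmetric matrices with R^(n(n+1)/2): list the entries
   on and above the diagonal. *)
Definition sym_coord (A : 'M[R]_n) : 'rV[R]_(n * n.+1)./2 :=
  \row_k let p := enum_val (cast_ord (esym (card_triangle n)) k) in A p.1 p.2.

Lemma sym_coord_inj (A B : 'M[R]_n) : A \is symmetricmx -> B \is symmetricmx ->
  sym_coord A = sym_coord B -> A = B.
Proof.
move=> /symmetricmxP AT /symmetricmxP BT AB.
have upper (i j : 'I_n) : (i <= j)%N -> A i j = B i j.
  move=> ij; have ijT : (i, j) \in triangle n by rewrite inE.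
  have /rowP/(_ (cast_ord (card_triangle n) (enum_rank_in ijT (i, j)))) := AB.
  by rewrite !mxE cast_ordK enum_rankK_in.
apply/matrixP => i j; have [/upper //|/ltnW/upper ji] := leqP i j.
by rewrite -AT -BT !mxE.
Qed.

Lemma sym_coord_surj (v : 'rV[R]_(n * n.+1)./2) :
  exists2 A : 'M[R]_n, A \is symmetricmx & sym_coord A = v.
Proof.
pose c (p : 'I_n * 'I_n) : R :=
  if insub (index p (enum (triangle n))) is Some k then v ord0 k else 0.
exists (\matrix_(i, j) if (i <= j)%N then c (i, j) else c (j, i)).
  apply/symmetricmxP/matrixP => i j; rewrite !mxE.
  by case: ltngtP => // ij; rewrite (val_inj ij).
apply/rowP => k; rewrite !mxE /=; set k' := cast_ord _ k.
have := enum_valP k'; rewrite inE mxE => ->; rewrite -surjective_pairing /c.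
have -> : index (enum_val k') (enum (triangle n)) = k.
  rewrite /enum_val index_uniq ?enum_uniq //.
  by rewrite -cardE; apply: ltn_ord.
by rewrite valK.
Qed.

Definition copositive_cone : set 'rV[R]_(n * n.+1)./2 :=
  sym_coord @` [set A : 'M[R]_n | copositive A].

End Coordinates.

Arguments copositive_cone R n : clear implicits.

Record signature := Signature { symbol : Type; arity : symbol -> nat }.

Definition structure (S : signature) (D : Type) : Type :=
  forall s : symbol S, set 'rV[D]_(arity s).

(* [positive_formula S m] are the positive formulas over [S] with free variables indexed
   by 'I_m, in well-scoped de Bruijn style: a quantifier binds variable 0 of its
   body, and variable i of the outer context is variable [lift ord0 i] there. *)
Inductive positive_formula (S : signature) (m : nat) : Type :=
| PRel (s : symbol S) (args : 'I_(arity s) -> 'I_m)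
| PEq (i j : 'I_m)
| PAnd (f g : positive_formula S m)
| POr (f g : positive_formula S m)
| PEx (f : positive_formula S m.+1)
| PAll (f : positive_formula S m.+1).

Definition extend D m (d : D) (x : 'rV[D]_m) : 'rV[D]_m.+1 :=
  row_mx (const_mx d : 'rV_1) x.

Lemma extend0 D m (d : D) (x : 'rV[D]_m) : extend d x ord0 ord0 = d.
Proof. by rewrite mxE; case: split_ordP => // i _; rewrite mxE. Qed.

Lemma extendS D m (d : D) (x : 'rV[D]_m) (i : 'I_m) :
  extend d x ord0 (lift ord0 i) = x ord0 i.
Proof. by have := row_mxEr (const_mx d : 'rV_1) x ord0 i; rewrite rshift1. Qed.

Fixpoint holds (S : signature) (D : Type) (M : structure S D) (m : nat)
    (f : positive_formula S m) : 'rV[D]_m -> Prop :=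
  match f with
  | PRel s args => fun x => M s (\row_k x ord0 (args k))
  | PEq i j => fun x => x ord0 i = x ord0 j
  | PAnd f g => fun x => holds M f x /\ holds M g x
  | POr f g => fun x => holds M f x \/ holds M g x
  | PEx f => fun x => exists d : D, holds M f (extend d x)
  | PAll f => fun x => forall d : D, holds M f (extend d x)
  end.

Definition positively_definable (S : signature) (D : Type) (M : structure S D)
    (m : nat) (K : set 'rV[D]_m) : Prop :=
  exists f : positive_formula S m, K = [set x | holds M f x].

Section SpectrahedralStructure.
Variable R : realType.

Inductive spec_symbol : Type :=
| Spec (m : nat) (K : set 'rV[R]_m) (_ : spectrahedron K)
| Neq.

Definition spec_signature : signature :=
  Signature (fun s => match s with @Spec m _ _ => m | Neq => 2 end).

Definition spec_structure : structure spec_signature R :=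
  fun s => match s with
  | Spec _ K _ => K
  | Neq => [set x : 'rV[R]_2 | x ord0 ord0 <> x ord0 ord_max]
  end.

End SpectrahedralStructure.

Arguments spec_structure R : clear implicits.

(* Main.v *)
Require Import Defs.
From mathcomp Require Import all_boot all_order all_algebra.
From mathcomp Require Import all_classical all_reals.
From HB Require Import structures.
From mathcomp Require Import generic_quotient polyrcf.
From mathcomp Require Import topology normedtype sequences derive realfun exp.
From mathcomp Require Import zify ring lra.

(* Work in an ultrapower S of R and call an element bounded if it is at most a power of
   tau = exp(n^2), negligible if it is below all negative powers of tau. The bounded elements
   have a coefficient field K, by Hensel's lemma. Multiplying each class of S modulo bounded
   ratios by a factor lam yields partial K-linear maps that extend back and forth, hence
   preserve equality and inequality of elements. If the Hankel kernel lam(x y) is positive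
   definite with a bounded inverse, these maps also preserve positive semidefinite matrices:
   write a matrix as Q Q^T and expand the entries of Q over K. By Los's theorem every
   positively definable set is then stable under such maps.

   On the logarithmic scale lam is the moment functional of points near the zeros of the Horn
   form, (1, k + 2, k + 1, w, w) with w = exp(-n^2) and their rotations, plus a small
   perturbation that is negative at the doubled vertices of the simplex. The moments already
   control the vertices, so the kernel stays positive definite; but the image of the Horn
   matrix, conjugated by a diagonal matrix of widely separated entries, has negative Horn sum
   and leaves the copositive cone. Spectrahedral shadows are positively definable. *)

Set Implicit Arguments.
Unset Strict Implicit.
Unset Printing Implicit Defensive.

Import Order.TTheory GRing.Theory Num.Theory.
Import numFieldNormedType.Exports.

Local Open Scope classical_set_scope.
Local Open Scope ring_scope.

(** * Ultrapower of the reals *)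

(** The multiplier cannot be a moment functional of nonnegative points: the Horn sum of such a
    functional averages a copositive form, hence is nonnegative. There is room because the Horn form
    in squared variables is not a sum of squares, but the Hankel kernel has to be definite on every
    finite family of classes, with all real exponents and infinitely many directions besides the
    five of the Horn form. A factor n to the power [sqn x] deals with this: by the parallelogram law
    it makes the kernel, after a diagonal scaling, almost diagonal on separated classes. Then only
    the signs at the doubled vertices are a danger. On each face the zeros of the Horn form satisfy
    just x1 - x2 + x3 = 0, so small moments make adjacent vertex coefficients almost opposite, and
    around a cycle of odd length all of them become small. Three scales are kept apart: powers of n,
    lost in the estimates; e^(-n), the size of the perturbation, whose inverse is bounded; and
    e^(-n^2), by which the moment points miss the zeros and whose inverse is [tau], so that the
    multiplier and its inverse are bounded. *)

Lemma nat_ultrafilter : exists U : set_system nat, UltraFilter U /\ \oo `<=` U.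
Proof. exact: ultraFilterLemma. Qed.

Definition natU : set_system nat := projT1 (cid nat_ultrafilter).

Instance natU_ultra : UltraFilter natU.
Proof. by rewrite /natU; case: cid => U /= []. Qed.

Definition ev (P : nat -> Prop) : Prop := natU [set k | P k].

Lemma ev_oo (P : nat -> Prop) : (\forall k \near \oo, P k) -> ev P.
Proof. by rewrite /ev /natU; case: cid => U /= [_]; apply. Qed.

Lemma evT (P : nat -> Prop) : (forall k, P k) -> ev P.
Proof. by move=> PT; apply: filterS filterT => k _; exact: PT. Qed.

Lemma ev_mono (P Q : nat -> Prop) : (forall k, P k -> Q k) -> ev P -> ev Q.
Proof. by move=> PQ; apply: filterS. Qed.

Lemma ev_and (P Q : nat -> Prop) : ev P -> ev Q -> ev (fun k => P k /\ Q k).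
Proof. by move=> p q; apply: filterI. Qed.

Lemma ev_mono2 (P Q T : nat -> Prop) :
  (forall k, P k -> Q k -> T k) -> ev P -> ev Q -> ev T.
Proof. by move=> PQT p q; apply: ev_mono (ev_and p q) => k []; apply: PQT. Qed.

Lemma ev_ex (P : nat -> Prop) : ev P -> exists k, P k.
Proof. by move=> /filter_ex. Qed.

Lemma ev_not (P : nat -> Prop) : ~ ev P <-> ev (fun k => ~ P k).
Proof.
split=> [nP|nP p]; last by have [k []] := ev_ex (ev_and p nP).
by have [/nP|] := in_ultra_setVsetC [set k | P k] natU_ultra.
Qed.

Lemma ev_or (P Q : nat -> Prop) : ev (fun k => P k \/ Q k) <-> ev P \/ ev Q.
Proof.
split=> [pq|[]]; [|by apply: ev_mono => k; left|by apply: ev_mono => k; right].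
have [|/ev_not nP] := pselect (ev P); [by left|right].
by apply: ev_mono2 pq nP => k [].
Qed.

Lemma ev_fin (I : finType) (P : I -> nat -> Prop) :
  (forall i, ev (P i)) -> ev (fun k => forall i, P i k).
Proof.
move=> evP; suff H (s : seq I) : ev (fun k => forall i, i \in s -> P i k).
  by apply: ev_mono (H (enum I)) => k Hk i; apply: Hk; rewrite mem_enum.
elim: s => [|i s IH]; first exact: evT.
apply: ev_mono2 IH (evP i) => k IH Pi j; rewrite inE => /orP[/eqP -> //|].
exact: IH.
Qed.

Section Hyper.
Local Open Scope quotient_scope.
Variable R : realType.

Definition hyper_eq : rel (nat -> R) := fun f g => `[< ev (fun k => f k = g k) >].

Lemma hyper_eq_refl : reflexive hyper_eq.
Proof. by move=> f; apply/asboolP/evT. Qed.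
Lemma hyper_eq_sym : symmetric hyper_eq.
Proof. by move=> f g; apply/asboolP/asboolP; apply: ev_mono. Qed.
Lemma hyper_eq_trans : transitive hyper_eq.
Proof.
move=> g f h /asboolP fg /asboolP gh; apply/asboolP.
by apply: ev_mono2 fg gh => k ->.
Qed.

Canonical hyper_equiv :=
  EquivRel hyper_eq hyper_eq_refl hyper_eq_sym hyper_eq_trans.

Definition hyper := {eq_quot hyper_equiv}.
HB.instance Definition _ := Choice.on hyper.
HB.instance Definition _ := EqQuotient.on hyper.

Definition cls (f : nat -> R) : hyper := \pi_hyper f.
Definition rp (x : hyper) : nat -> R := repr x.

Lemma clsK f : ev (fun k => rp (cls f) k = f k).
Proof. by have /eqquotP/asboolP := (reprK (cls f)). Qed.

Lemma rpK x : cls (rp x) = x.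
Proof. exact: reprK. Qed.

Lemma clsE f g : cls f = cls g <-> ev (fun k => f k = g k).
Proof. by split=> [/eqquotP/asboolP|H]; last by apply/eqquotP/asboolP. Qed.

Lemma rpE x y : x = y <-> ev (fun k => rp x k = rp y k).
Proof. by rewrite -[in X in X <-> _](rpK x) -[in X in X <-> _](rpK y) clsE. Qed.

Definition hadd x y := cls (fun k => rp x k + rp y k).
Definition hopp x := cls (fun k => - rp x k).
Definition hmul x y := cls (fun k => rp x k * rp y k).
Definition hinv x := cls (fun k => (rp x k)^-1).
Definition hzero := cls (fun _ => 0).
Definition hone := cls (fun _ => 1).

Lemma rp_add x y : ev (fun k => rp (hadd x y) k = rp x k + rp y k).
Proof. exact: clsK. Qed.
Lemma rp_mul x y : ev (fun k => rp (hmul x y) k = rp x k * rp y k).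
Proof. exact: clsK. Qed.

Fact haddA : associative hadd.
Proof.
move=> x y z; apply/clsE; apply: ev_mono2 (rp_add y z) (rp_add x y) => k -> ->.
by rewrite addrA.
Qed.
Fact haddC : commutative hadd.
Proof. by move=> x y; apply/clsE/evT => k; rewrite addrC. Qed.
Fact hadd0 : left_id hzero hadd.
Proof.
move=> x; rewrite -[RHS]rpK; apply/clsE.
by apply: ev_mono (clsK (fun=> 0)) => k ->; rewrite add0r.
Qed.
Fact haddN : left_inverse hzero hopp hadd.
Proof. move=> x; apply/clsE; apply: ev_mono (clsK (fun k => - rp x k)) => k ->.
by rewrite addNr. Qed.

HB.instance Definition _ := GRing.isZmodule.Build hyper haddA haddC hadd0 haddN.

Fact hmulA : associative hmul.
Proof.
move=> x y z; apply/clsE; apply: ev_mono2 (rp_mul y z) (rp_mul x y) => k -> ->.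
by rewrite mulrA.
Qed.
Fact hmulC : commutative hmul.
Proof. by move=> x y; apply/clsE/evT => k; rewrite mulrC. Qed.
Fact hmul1 : left_id hone hmul.
Proof.
move=> x; rewrite -[RHS]rpK; apply/clsE.
by apply: ev_mono (clsK (fun=> 1)) => k ->; rewrite mul1r.
Qed.
Fact hmulD : left_distributive hmul hadd.
Proof.
move=> x y z; apply/clsE; apply: ev_mono2 (rp_add x y) (ev_and (rp_mul x z) (rp_mul y z)).
by move=> k -> [-> ->]; rewrite mulrDl.
Qed.
Fact hone_neq0 : hone != hzero.
Proof.
apply/eqP => /clsE H; have [k /eqP] := ev_ex H; by rewrite oner_eq0.
Qed.

HB.instance Definition _ :=
  GRing.Zmodule_isComNzRing.Build hyper hmulA hmulC hmul1 hmulD hone_neq0.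

Fact hmulV (x : hyper) : x != 0 -> hinv x * x = 1.
Proof.
move=> x0; apply/clsE.
have /ev_not nx : ~ ev (fun k => rp x k = 0).
  by move=> H; case/eqP: x0; apply/rpE; apply: ev_mono2 H (clsK (fun _ => 0)) => k -> ->.
apply: ev_mono2 nx (clsK (fun k => (rp x k)^-1)) => k /eqP xk ->.
by rewrite mulVf.
Qed.
Fact hinv0 : hinv 0 = 0.
Proof. by apply/clsE; apply: ev_mono (clsK (fun=> 0)) => k ->; rewrite invr0. Qed.

HB.instance Definition _ := GRing.ComNzRing_isField.Build hyper hmulV hinv0.

Definition hle (x y : hyper) : bool := `[< ev (fun k => rp x k <= rp y k) >].
Definition hlt (x y : hyper) : bool := (y != x) && hle x y.
Definition hnorm (x : hyper) : hyper := cls (fun k => `|rp x k|).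

Lemma rp0 : ev (fun k => rp 0 k = 0). Proof. exact: clsK. Qed.
Lemma rp1 : ev (fun k => rp 1 k = 1). Proof. exact: clsK. Qed.
Lemma rpD (x y : hyper) : ev (fun k => rp (x + y) k = rp x k + rp y k).
Proof. exact: clsK. Qed.
Lemma rpM (x y : hyper) : ev (fun k => rp (x * y) k = rp x k * rp y k).
Proof. exact: clsK. Qed.
Lemma rpN (x : hyper) : ev (fun k => rp (- x) k = - rp x k).
Proof. exact: clsK. Qed.
Lemma rpV (x : hyper) : ev (fun k => rp (x^-1) k = (rp x k)^-1).
Proof. exact: clsK. Qed.

Fact hle_add (x y : hyper) : hle 0 x -> hle 0 y -> hle 0 (x + y).
Proof.
move=> /asboolP Hx /asboolP Hy; apply/asboolP.
apply: ev_mono2 (ev_and Hx Hy) (ev_and rp0 (rpD x y)) => k [hx hy] [e ->].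
by rewrite e in hx hy *; apply: addr_ge0.
Qed.
Fact hle_mul (x y : hyper) : hle 0 x -> hle 0 y -> hle 0 (x * y).
Proof.
move=> /asboolP Hx /asboolP Hy; apply/asboolP.
apply: ev_mono2 (ev_and Hx Hy) (ev_and rp0 (rpM x y)) => k [hx hy] [e ->].
by rewrite e in hx hy *; apply: mulr_ge0.
Qed.
Fact hle_anti (x : hyper) : hle 0 x -> hle x 0 -> x = 0.
Proof.
move=> /asboolP Hx /asboolP Hy; apply/rpE.
by apply: ev_mono2 Hx Hy => k Hx Hy; apply/le_anti/andP.
Qed.
Fact hsub_ge0 (x y : hyper) : hle 0 (y - x) = hle x y.
Proof.
apply/asboolP/asboolP => H.
  apply: ev_mono2 H (ev_and rp0 (ev_and (rpD y (- x)) (rpN x))) => k H [h0 [hD hN]].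
  by move: H; rewrite h0 hD hN subr_ge0.
apply: ev_mono2 H (ev_and rp0 (ev_and (rpD y (- x)) (rpN x))) => k H [h0 [hD hN]].
by rewrite h0 hD hN subr_ge0.
Qed.
Fact hle_total (x : hyper) : hle 0 x || hle x 0.
Proof.
apply/orP; have /ev_or[H|H] : ev (fun k => rp 0 k <= rp x k \/ rp x k <= rp 0 k).
  by apply: evT => k; apply/orP; apply: le_total.
by left; apply/asboolP.
by right; apply/asboolP.
Qed.
Fact hnormN (x : hyper) : hnorm (- x) = hnorm x.
Proof. by apply/clsE; apply: ev_mono (rpN x) => k ->; rewrite normrN. Qed.
Fact hge0_norm (x : hyper) : hle 0 x -> hnorm x = x.
Proof.
move=> /asboolP Hx; rewrite -[RHS]rpK; apply/clsE.
by apply: ev_mono2 Hx rp0 => k hx e; rewrite e in hx; rewrite ger0_norm.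
Qed.
Fact hlt_def (x y : hyper) : hlt x y = (y != x) && hle x y.
Proof. by []. Qed.

HB.instance Definition _ := Num.IntegralDomain_isLeReal.Build hyper
  hle_add hle_mul hle_anti hsub_ge0 hle_total hnormN hge0_norm hlt_def.

Lemma rp_le (x y : hyper) : x <= y <-> ev (fun k => rp x k <= rp y k).
Proof. by split=> [/asboolP|H]; last by apply/asboolP. Qed.

Lemma rp_lt (x y : hyper) : x < y <-> ev (fun k => rp x k < rp y k).
Proof.
rewrite real_ltNge ?num_real //; split=> [/negP|H].
  by rewrite rp_le => /ev_not; apply: ev_mono => k /negP; rewrite -real_ltNge ?num_real.
apply/negP; rewrite rp_le => H'; have [k []] := ev_ex (ev_and H H').
by rewrite leNgt => ->.
Qed.

Lemma rp_norm (x : hyper) : ev (fun k => rp `|x| k = `|rp x k|).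
Proof. exact: clsK. Qed.

Lemma rp_sum (I : Type) (s : seq I) (F : I -> hyper) :
  ev (fun k => rp (\sum_(i <- s) F i) k = \sum_(i <- s) rp (F i) k).
Proof.
elim: s => [|i s IH]; first by apply: ev_mono rp0 => k; rewrite !big_nil.
rewrite big_cons; apply: ev_mono2 IH (rpD (F i) (\sum_(j <- s) F j)) => k e ->.
by rewrite big_cons e.
Qed.

Definition emb (r : R) : hyper := cls (fun _ => r).

Lemma rp_emb r : ev (fun k => rp (emb r) k = r).
Proof. exact: clsK. Qed.

Fact emb_additive : zmod_morphism emb.
Proof.
move=> x y; apply/clsE.
apply: ev_mono2 (rp_emb x) (ev_and (rpN (emb y)) (rp_emb y)) => k e1 [e2 e3].
by rewrite /emb e1 e2 e3.
Qed.
Fact emb_multiplicative : monoid_morphism emb.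
Proof.
split=> // x y; apply/clsE.
by apply: ev_mono2 (rp_emb x) (rp_emb y) => k -> ->.
Qed.
HB.instance Definition _ := GRing.isZmodMorphism.Build R hyper emb emb_additive.
HB.instance Definition _ := GRing.isMonoidMorphism.Build R hyper emb emb_multiplicative.

Lemma emb_le r s : (emb r <= emb s) = (r <= s).
Proof.
apply/idP/idP => [/rp_le H|rs].
  by have [k [[-> ->]]] := ev_ex (ev_and (ev_and (rp_emb r) (rp_emb s)) H).
by apply/rp_le; apply: ev_mono2 (rp_emb r) (rp_emb s) => k -> ->.
Qed.

Lemma emb_gt0 r : (0 < emb r) = (0 < r).
Proof. by rewrite !ltNge -(rmorph0 emb) emb_le. Qed.

End Hyper.

(** * Linear relations between monomials on a face *)

Section Asymptotics.
Variable R : realType.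

Lemma near_log_le_linear (a C d : R) : 0 < d ->
  \forall n \near \oo, C + a * ln n%:R <= d * n%:R.
Proof.
move=> d0; near=> n.
have n1 : 1 <= n%:R :> R by near: n; exact: nbhs_infty_ger.
have n0 : 0 < n%:R :> R by apply: lt_le_trans n1.
pose s : R := Num.sqrt n%:R.
have s1 : 1 <= s by rewrite -sqrtr1 ler_sqrt.
have ss : n%:R = s * s by rewrite -expr2 sqr_sqrtr // ltW.
have lns : ln (n%:R : R) <= 2 * s.
  rewrite ss lnM ?posrE; [|lra|lra].
  by have := @ln_sublinear R s ltac:(lra); lra.
have ln0 : 0 <= ln (n%:R : R) by apply: ln_ge0.
have big : (`|C| + 2 * `|a|) / d <= s.
  rewrite -[leLHS]ger0_norm; last first.
    by apply: divr_ge0; [apply: addr_ge0 => //; apply: mulr_ge0|exact: ltW].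
  rewrite -sqrtr_sqr ler_sqrt //.
  near: n; exact: nbhs_infty_ger.
have {}big : `|C| + 2 * `|a| <= d * s by rewrite (mulrC d) -ler_pdivrMr.
have h1 : a * ln n%:R <= `|a| * (2 * s).
  apply: le_trans (_ : `|a| * ln n%:R <= _); first by rewrite ler_wpM2r // ler_norm.
  by rewrite ler_wpM2l.
have h2 : C <= `|C| * s by apply: le_trans (ler_norm _) _; rewrite ler_peMr.
have : (`|C| + 2 * `|a|) * s <= d * s * s by rewrite ler_wpM2r //; lra.
by rewrite -mulrA -ss; lra.
Unshelve. all: by end_near. Qed.

(* Fixed finite sums of real powers of k: the coefficient of any power above the error
   order vanishes. *)
Lemma powers_lin_indep (I : finType) (C e : I -> R) (B M : R) :
  (forall k : nat, `|\sum_i C i * expR (e i * ln k.+1%:R)| <= B * expR (- M * ln k.+1%:R)) ->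
  forall E, - M < E -> \sum_(i | e i == E) C i = 0.
Proof.
(* Stated for subfamilies so that the terms with the largest exponent can be removed: divided by the
   top power, the sum tends to their total coefficient, which is therefore zero. *)
suff H (A : {set I}) :
  (forall k : nat, `|\sum_(i in A) C i * expR (e i * ln k.+1%:R)|
     <= B * expR (- M * ln k.+1%:R)) ->
  forall E, - M < E -> \sum_(i in A | e i == E) C i = 0.
  move=> bnd E ME; rewrite -[RHS](H [set: I]%SET _ E ME).
    by apply: eq_bigl => i; rewrite inE.
  by move=> k; rewrite (eq_bigl xpredT) // => i; rewrite inE.
have [n] := ubnP #|A|; elim: n A => // n IH A An bnd E ME.
have [->|/set0Pn[a aA]] := eqVneq A finset.set0.
  by rewrite big_pred0 // => i; rewrite inE.
pose m := [arg max_(i > a in A) e i]%O.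
have [mA mmax] : m \in A /\ forall i, i \in A -> e i <= e m.
  by rewrite /m; case: arg_maxP => // i iA h; split=> // j; apply: h.
have [eM|Me] := leP (e m) (- M).
  rewrite big_pred0 // => i; apply/negbTE/negP => /andP[/mmax h /eqP iE]; lra.
pose A' := finset (fun i => (i \in A) && (e i != e m)).
pose G := \sum_(i in A | e i == e m) C i.
have split_sum (F : I -> R) :
    \sum_(i in A) F i = \sum_(i in A | e i == e m) F i + \sum_(i in A') F i.
  rewrite (bigID (fun i => e i == e m)) /=; congr (_ + _).
  by apply: eq_bigl => i; rewrite !inE.
have head k : \sum_(i in A | e i == e m) C i * expR (e i * ln k.+1%:R)
    = G * expR (e m * ln k.+1%:R).
  by rewrite /G mulr_suml; apply: eq_bigr => i /andP[_ /eqP ->].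
have G0 : G = 0.
  apply/eqP; rewrite -normr_le0; apply/ler_addgt0Pr => r r0; rewrite add0r.
  (* [d] is a common gap between the top exponent and both the other exponents and the error order -
     M. *)
  have [d [d0 dM dA]] : exists d : R, [/\ 0 < d, d <= e m + M &
      forall i, i \in A' -> d <= e m - e i].
    pose d i := if i \in A' then e m - e i else e m + M.
    exists (\big[Num.min/e m + M]_i d i); split.
    - elim/big_ind: _ => [|x y x0 y0|i _]; [lra|by rewrite lt_min x0|].
      rewrite /d inE; case: ifP => [/andP[/mmax h ne]|_]; last lra.
      by rewrite subr_gt0 lt_neqAle ne.
    - exact: bigmin_le_id.
    - move=> i iA; apply: le_trans (_ : d i <= _); last by rewrite /d iA.
      exact: bigmin_le_cond.
  pose S := `|B| + \sum_(i in A') `|C i|.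
  have S0 : 0 <= S by rewrite addr_ge0 // sumr_ge0.
  have [k [k0 Sk]] : exists k : nat, 0 <= ln k.+1%:R :> R /\
      S * expR (- d * ln k.+1%:R) <= r.
    have [k1 hk] : exists k : nat, (S / r + 1) / d <= k%:R :> R.
      have [N _ HN] := @nbhs_infty_ger R ((S / r + 1) / d).
      by exists N; apply: (HN N) => /=.
    have [k hk2] : exists k : nat, expR k1%:R <= k%:R :> R.
      have [N _ HN] := @nbhs_infty_ger R (expR k1%:R).
      by exists N; apply: (HN N) => /=.
    have kk : expR k1%:R <= k.+1%:R :> R.
      by apply: le_trans hk2 _; rewrite ler_nat.
    have lk : k1%:R <= ln k.+1%:R :> R by rewrite -[leLHS]expRK ler_ln ?posrE ?expR_gt0.
    exists k; split; first by apply: le_trans lk.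
    rewrite mulNr expRN ler_pdivrMr ?expR_gt0 // -ler_pdivrMl // mulrC.
    apply: le_trans (expR_ge1Dx _).
    have : (S / r + 1) <= k1%:R * d by rewrite -ler_pdivrMr.
    have : k1%:R * d <= ln k.+1%:R * d by rewrite ler_wpM2r // ltW.
    by lra.
  have E0 : G = (\sum_(i in A) C i * expR (e i * ln k.+1%:R)
      - \sum_(i in A') C i * expR (e i * ln k.+1%:R)) * expR (- e m * ln k.+1%:R).
    rewrite split_sum head addrK -mulrA -expRD mulNr subrr expR0 mulr1 //.
  apply: le_trans Sk; rewrite E0 normrM (ger0_norm (expR_ge0 _)).
  have hB : B * expR (- M * ln k.+1%:R) * expR (- e m * ln k.+1%:R) <=
      `|B| * expR (- d * ln k.+1%:R).
    rewrite -mulrA -expRD.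
    apply: le_trans (_ : `|B| * expR (- M * ln k.+1%:R + - e m * ln k.+1%:R) <= _).
      by rewrite ler_wpM2r ?expR_ge0 // ler_norm.
    rewrite ler_wpM2l // ler_expR -mulrDl ler_wpM2r //; lra.
  apply: le_trans (_ : (B * expR (- M * ln k.+1%:R) +
     \sum_(i in A') `|C i| * expR (e i * ln k.+1%:R)) * expR (- e m * ln k.+1%:R) <= _).
    rewrite ler_wpM2r ?expR_ge0 //; apply: le_trans (ler_normB _ _) _.
    rewrite lerD //; apply: le_trans (ler_norm_sum _ _ _) _.
    by apply: ler_sum => i _; rewrite normrM (ger0_norm (expR_ge0 _)).
  rewrite mulrDl mulrDl lerD // !mulr_suml; apply: ler_sum => i iA.
  rewrite -mulrA ler_wpM2l // -expRD ler_expR -mulrDl ler_wpM2r //.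
  by have := dA i iA; lra.
have IHA : forall E, - M < E -> \sum_(i in A' | e i == E) C i = 0.
  apply: IH => [|k].
    apply: leq_trans (_ : #|A| <= n)%N => //; apply: proper_card.
    apply/fintype.properP; split; first by apply/fintype.subsetP => i; rewrite inE => /andP[].
    by exists m => //; rewrite inE eqxx andbF.
  by apply: le_trans (bnd k); rewrite split_sum head G0 mul0r add0r.
have [->|EN] := eqVneq E (e m); first exact: G0.
rewrite -[RHS](IHA E ME); apply: eq_bigl => i; rewrite inE.
by case: (i \in A) => //=; have [->|] := eqVneq (e i) E; rewrite ?EN ?andbF.
Qed.

(** * Falling factorials and the binomial series *)

Definition falling (j : nat) : {poly R} := \prod_(i < j) ('X - i%:R%:P).

Definition bin_coef (a : R) (j : nat) : R := (falling j).[a] / j`!%:R.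

Lemma falling_recl (a : R) j : (falling j.+1).[a] = a * (falling j).[a - 1].
Proof.
rewrite /falling big_ord_recl !hornerE; congr (_ * _); first by rewrite subr0.
rewrite !horner_prod; apply: eq_bigr => i _; rewrite !hornerE.
by rewrite lift0 -natr1; ring.
Qed.

Lemma bin_coefS (a : R) j : j.+1%:R * bin_coef a j.+1 = a * bin_coef (a - 1) j.
Proof.
rewrite /bin_coef falling_recl factS natrM invfM.
have j0 : j.+1%:R != 0 :> R by rewrite pnatr_eq0.
by field; rewrite pnatr_eq0 -lt0n fact_gt0 addrC natr1 j0.
Qed.

Lemma bin_coef0 (a : R) : bin_coef a 0 = 1.
Proof. by rewrite /bin_coef /falling big_ord0 hornerC divr1. Qed.

(** Newton's binomial series with a remainder uniform on [0, 1]. The derivative of the remainder of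
    order J + 1 for a is a times the remainder of order J for a - 1, so the mean value theorem gives
    the induction step. *)
Lemma binomial_expansion (J : nat) (a : R) : exists C : R,
  forall z : R, 0 <= z <= 1 ->
  `|(1 + z) `^ a - \sum_(j < J) bin_coef a j * z ^+ j| <= C * z ^+ J.
Proof.
elim: J a => [|J IH] a.
  exists (2 `^ `|a|) => z /andP[z0 z1]; rewrite big_ord0 subr0 expr0 mulr1.
  rewrite ger0_norm ?powR_ge0 //.
  apply: le_trans (_ : (1 + z) `^ `|a| <= _).
    by apply: ler_powR; [lra|exact: ler_norm].
  by apply: ge0_ler_powR; rewrite ?nnegrE //; lra.
have [C HC] := IH (a - 1).
exists (`|a| * C) => z /andP[z0 z1].
pose f := fun z : R => (1 + z) `^ a - \sum_(j < J.+1) bin_coef a j * z ^+ j.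
pose df := fun z : R => a * ((1 + z) `^ (a - 1) - \sum_(j < J) bin_coef (a - 1) j * z ^+ j).
have f_derive (x : R) : 0 <= x -> is_derive x 1 f (df x).
  move=> x0; have x1 : 0 < 1 + x by lra.
  have d1 : is_derive x 1 (fun z : R => (1 + z) `^ a) (a * (1 + x) `^ (a - 1)).
    have ds : is_derive x 1 (fun z : R => 1 + z) 1.
      have := is_deriveD (is_derive_cst (1 : R) x (1 : R)) (is_derive_id x (1 : R)).
      by rewrite add0r.
    have := @is_derive1_comp R (fun y => y `^ a) (fun z : R => 1 + z) x _ _
      (is_derive1_powR a x1) ds.
    by rewrite mulr1.
  pose p : {poly R} := \poly_(j < J.+1) bin_coef a j.
  have -> : f = (fun z : R => (1 + z) `^ a - p.[z]).
    by apply/funext => y; rewrite /f horner_poly.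
  have -> : df x = a * (1 + x) `^ (a - 1) - p^`().[x].
    rewrite /df mulrBr; congr (_ - _).
    rewrite (_ : p^`() = \poly_(j < J) (a * bin_coef (a - 1) j)).
      rewrite horner_poly mulr_sumr; apply: eq_bigr => j _; ring.
    apply/polyP => i; rewrite coef_deriv !coef_poly ltnS.
    by case: ltnP => _; rewrite ?mul0rn // -mulr_natl bin_coefS.
  exact: is_deriveB d1 (is_derive_poly p x).
have df_bound (x : R) : 0 <= x <= z -> `|df x| <= `|a| * (C * z ^+ J).
  move=> /andP[x0 xz]; rewrite /df normrM ler_wpM2l //.
  have hx := HC x ltac:(lra); apply: (le_trans hx).
  have C0 : 0 <= C.
    by have := HC 1 ltac:(lra); rewrite expr1n mulr1; apply: le_trans.
  by rewrite ler_wpM2l // lerXn2r.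
have [| |c /itvP c0z] := @MVT_segment R f df 0 z z0.
- by move=> x /itvP xz; apply: f_derive; rewrite xz.
- apply: derivable_within_continuous => x; rewrite in_itv /= => /andP[x0 _].
  by have [] := f_derive x x0.
have f0 : f 0 = 0.
  rewrite /f addr0 powR1 big_ord_recl expr0 mulr1 bin_coef0 big1 ?addr0 ?subrr //.
  by move=> i _; rewrite lift0 expr0n mulr0.
rewrite f0 !subr0 => fz; rewrite -/(f z) fz normrM (ger0_norm z0).
rewrite exprSr !mulrA ler_wpM2r // -mulrA; apply: df_bound.
by rewrite !c0z.
Qed.

End Asymptotics.

Section FaceRelation.
Variable R : realType.

Lemma falling_horner0 j : (falling R j).[0] = (j == 0)%:R.
Proof.
rewrite /falling; case: j => [|j]; first by rewrite big_ord0 hornerC.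
by rewrite big_ord_recl hornerM hornerXsubC subrr mul0r.
Qed.

Lemma falling_horner1 j : (falling R j).[1] = (j <= 1)%:R.
Proof.
case: j => [|[|j]]; rewrite /falling.
- by rewrite big_ord0 hornerC.
- by rewrite big_ord1 hornerXsubC subr0.
- by rewrite 2!big_ord_recl !hornerM (hornerXsubC 1%:R) subrr mul0r mulr0.
Qed.

Lemma size_falling j : size (falling R j) = j.+1.
Proof. by rewrite /falling size_prod_XsubC /index_enum -enumT size_enum_ord. Qed.

(** The falling factorials are monic of each degree, so the leading term can be removed and the
    degree drops. *)
Lemma falling_span (L : {poly R} -> R) (J : nat) :
  (forall c f g, L (c *: f + g) = c * L f + L g) ->
  (forall j, (j < J)%N -> L (falling R j) = 0) ->
  forall f : {poly R}, (size f <= J)%N -> L f = 0.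
Proof.
move=> Llin; have L0 : L 0 = 0 by have := Llin 1 0 0; rewrite scaler0 addr0 mul1r; lra.
elim: J => [|J IH] LJ f sf.
  by move: sf; rewrite leqn0 size_poly_eq0 => /eqP ->.
pose g := f - f`_J *: falling R J.
have sg : (size g <= J)%N.
  apply/leq_sizeP => i; rewrite leq_eqVlt => /orP[/eqP <-|Ji].
    rewrite coefB coefZ.
    have /monicP : falling R J \is monic by apply: monic_prod_XsubC.
    by rewrite /lead_coef size_falling /= => ->; rewrite mulr1 subrr.
  rewrite coefB coefZ [f`_i]nth_default ?(leq_trans sf) //.
  by rewrite [X in _ * X]nth_default ?size_falling // mulr0 subr0.
have -> : f = f`_J *: falling R J + g by rewrite /g addrC subrK.
rewrite Llin LJ // mulr0 add0r; apply: IH => // j Jj; apply: LJ; exact: leqW.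
Qed.

(* The only linear relation between the monomials x1^c x2^a x3^b (a + b + c = 1) along the
   curve (1, k + 2, k + 1) is x1 - x2 + x3 = 0. *)
Lemma face_relation (I : finType) (q a b : I -> R) :
  (forall i, [/\ 0 <= a i, 0 <= b i & a i + b i <= 1]) ->
  (forall k : nat, \sum_i q i * expR (a i * ln k.+2%:R + b i * ln k.+1%:R) = 0) ->
  \sum_(i | a i == 1) q i + \sum_(i | a i + b i == 0) q i = 0.
Proof.
move=> ab H.
pose s i := a i + b i.
(* Large enough for the interpolation polynomial [f] below, of degree at most [#|I|] + 1. *)
pose J := #|I|.+2.
have [C HC] := choice (fun i => binomial_expansion J (a i)).
(* With m = k + 1 the i-th monomial is m^(s i) (1 + 1/m)^(a i). After binomial expansion the power
   m^(1 - j0) comes from the terms with s = 1, and from those with s = 0 only if j0 = 1, because a =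
   0 there; an s strictly between never produces an integer exponent. *)
have coef0 (j0 : nat) : (j0 < J)%N ->
    \sum_(i | s i == 1) q i * bin_coef (a i) j0 + (j0 == 1)%:R * \sum_(i | s i == 0) q i = 0.
  move=> j0J.
  pose B := \sum_i `|q i| * `|C i|.
  have := @powers_lin_indep R _ (fun p : I * 'I_J => q p.1 * bin_coef (a p.1) p.2)
    (fun p => s p.1 - p.2%:R) B (J%:R - 1) _ (1 - j0%:R) _.
  rewrite (_ : \sum_(p | _) _ = \sum_i \sum_(j < J | s i - j%:R == 1 - j0%:R)
     q i * bin_coef (a i) j); last by rewrite pair_big_dep.
  have inner i : \sum_(j < J | s i - j%:R == 1 - j0%:R) q i * bin_coef (a i) j =
     (if s i == 1 then q i * bin_coef (a i) j0 else 0) +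
     (if s i == 0 then (j0 == 1)%:R * q i else 0).
    have [a0 b0 ab1] := ab i.
    have [s1|s1] := eqVneq (s i) 1.
      rewrite s1 oner_eq0 addr0 (big_pred1 (Ordinal j0J)) // => j.
      by rewrite /= (inj_eq (addrI _)) eqr_opp eqr_nat.
    have [s0|s0] := eqVneq (s i) 0.
      have ai : a i = 0 by move: s0; rewrite /s; lra.
      rewrite add0r s0 ai; case: j0 j0J => [|j0] j0J.
        rewrite mul0r big_pred0 // => j; apply/negbTE/eqP => e.
        by have : 0 <= (j : nat)%:R :> R by []; lra.
      rewrite (big_pred1 (Ordinal (ltnW j0J))) => [|j]; last first.
        rewrite -natr1 [X in X == _](_ : _ = - j%:R); last by rewrite sub0r.
        rewrite (_ : 1 - _ = - j0%:R); last by ring.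
        by rewrite eqr_opp eqr_nat.
      rewrite /= /bin_coef falling_horner0 mulrC.
      by case: j0 {j0J} => [|j0] /=; rewrite ?fact0 ?divr1 ?mul0r.
    rewrite addr0 big_pred0 // => j; apply/negbTE/eqP => e.
    have sgt0 : 0 < s i by rewrite lt_neqAle eq_sym s0 /s; lra.
    have slt1 : s i < 1 by rewrite lt_neqAle s1 /s; lra.
    have e1 : j0%:R < j.+1%:R :> R by rewrite -natr1; lra.
    have e2 : j.+1%:R < j0.+1%:R :> R by rewrite -!natr1; lra.
    by move: e1 e2; rewrite !ltr_nat; lia.
  rewrite (eq_bigr _ (fun i _ => inner i)) big_split /= -!big_mkcond /= mulr_sumr.
  apply; last first.
    have : j0%:R <= (J.-1)%:R :> R by rewrite ler_nat -ltnS.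
    by rewrite /J /= -[#|I|.+2%:R]natr1; lra.
  move=> k; set x : R := ln k.+1%:R.
  have x0 : 0 <= x by rewrite /x ln_ge0 // ler1n.
  pose z : R := k.+1%:R^-1.
  have k0 : 0 < k.+1%:R :> R by rewrite ltr0n.
  have z01 : 0 <= z <= 1 by rewrite invr_ge0 ltW //= invf_le1 // ler1n.
  have zx : z = expR (- x) by rewrite expRN lnK.
  have lnz : ln k.+2%:R = x + ln (1 + z).
    rewrite -lnM ?posrE //; last by case/andP: z01; lra.
    by rewrite mulrDr mulr1 divff ?gt_eqF // natr1.
  rewrite -(pair_bigA _ (fun i (j : 'I_J) => q i * bin_coef (a i) j *
    expR ((s i - j%:R) * x))) /=.
  rewrite -normrN -sub0r -[X in `|X - _|](H k) -sumrB.
  apply: le_trans (ler_norm_sum _ _ _) _; rewrite mulr_suml; apply: ler_sum => i _.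
  rewrite -/x lnz (_ : expR _ = expR (s i * x) * (1 + z) `^ (a i)); last first.
    rewrite /powR gt_eqF; last by case/andP: z01; lra.
    by rewrite -expRD /s; congr expR; ring.
  rewrite (_ : \sum_j _ = q i * (expR (s i * x) * \sum_(j < J) bin_coef (a i) j * z ^+ j));
    last first.
    rewrite mulrA mulr_sumr; apply: eq_bigr => j _.
    rewrite zx -expRM_natl (_ : (s i - j%:R) * x = s i * x + j%:R * - x); last by ring.
    by rewrite expRD; ring.
  rewrite -mulrBr -mulrBr !normrM -mulrA ler_wpM2l // ger0_norm ?expR_ge0 //.
  apply: le_trans (_ : expR x * (C i * z ^+ J) <= _).
    apply: ler_pM => //; [exact: expR_ge0| |exact: HC].
    by rewrite ler_expR ler_piMl //; have [] := ab i.
  rewrite mulrCA; apply: le_trans (_ : `|C i| * (expR x * z ^+ J) <= _).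
    rewrite ler_wpM2r ?ler_norm // mulr_ge0 ?expR_ge0 // exprn_ge0 //.
    by case/andP: z01.
  rewrite ler_wpM2l // zx -expRM_natl -expRD ler_expR; lra.
(* By [coef0], L kills the falling factorials of degree below J: the values of the j-th one at 1 and
   at 0 differ only for j = 1. *)
pose L (f : {poly R}) := \sum_(i | s i == 1) q i * f.[a i] +
   (f.[1] - f.[0]) * \sum_(i | s i == 0) q i.
have Llin c f g : L (c *: f + g) = c * L f + L g.
  rewrite /L (_ : \sum_(i | s i == 1) q i * (c *: f + g).[a i] =
    c * (\sum_(i | s i == 1) q i * f.[a i]) + \sum_(i | s i == 1) q i * g.[a i]).
    by rewrite !hornerD !hornerZ; ring.
  rewrite mulr_sumr -big_split /=; apply: eq_bigr => i _.
  by rewrite hornerD hornerZ; ring.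
have Lfall j : (j < J)%N -> L (falling R j) = 0.
  move=> jJ; have f0 : j`!%:R != 0 :> R by rewrite pnatr_eq0 -lt0n fact_gt0.
  have := congr1 (fun y => j`!%:R * y) (coef0 j jJ).
  rewrite /= mulr0 mulrDr mulr_sumr => <-; rewrite /L; congr (_ + _).
    by apply: eq_bigr => i _; rewrite /bin_coef; field.
  rewrite mulrA falling_horner0 falling_horner1; congr (_ * _).
  by case: j {jJ f0} => [|[|j]] /=; rewrite ?subrr ?subr0 ?mulr0 ?mulr1 ?fact0.
(* Interpolation: [f] is 1 at 1 and 0 at 0 and at every other a i, so that L f is the sum in
   question. *)
pose A := [seq a i | i <- enum I & (a i != 0) && (a i != 1)].
pose f : {poly R} := 'X * \prod_(y <- A) ((1 - y)^-1 *: ('X - y%:P)).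
have sf : (size f <= J)%N.
  apply: leq_trans (size_polyMleq _ _) _; rewrite size_polyX addSn /= add1n ltnS.
  have sA : (size A <= #|I|)%N.
    by rewrite size_map size_filter; apply: leq_trans (count_size _ _) _; rewrite -cardE.
  apply: leq_trans (_ : (size A).+1 <= _)%N => //.
  elim: (A) => [|y l IH]; first by rewrite big_nil size_polyC oner_eq0.
  rewrite big_cons; apply: leq_trans (size_polyMleq _ _) _ => /=.
  rewrite -subn1 leq_subLR.
  apply: leq_trans (leq_add (leq_trans (size_scale_leq _ _)
    (eq_leq (size_XsubC y))) IH) _; lia.
have fE y : f.[y] = y * \prod_(u <- A) ((1 - u)^-1 * (y - u)).
  rewrite /f hornerM hornerX horner_prod; congr (_ * _).
  by apply: eq_bigr => u _; rewrite !hornerE.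
have f1 : f.[1] = 1.
  rewrite fE mul1r big_map big_filter big1 // => i /andP[_ i1].
  by rewrite mulVf // subr_eq0 eq_sym.
have f0 : f.[0] = 0 by rewrite fE mul0r.
have fa i : f.[a i] = (a i == 1)%:R.
  have [->|i1] := eqVneq (a i) 1; first exact: f1.
  have [->|i0] := eqVneq (a i) 0; first exact: f0.
  rewrite fE; apply/eqP; rewrite mulf_eq0 (negbTE i0) /= prodf_seq_eq0.
  apply/hasP; exists (a i); last by rewrite /= subrr mulr0.
  by apply/mapP; exists i => //; rewrite mem_filter i1 i0 mem_enum.
have := falling_span Llin Lfall sf; rewrite /L f1 f0 subr0 mul1r => Lf; apply: etrans Lf.
congr (_ + _); rewrite [LHS]big_mkcond [RHS]big_mkcond /=; apply: eq_bigr => i _.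
rewrite fa /s; have [a0 b0 ab1] := ab i.
have [ai|_] := eqVneq (a i) 1; last by rewrite mulr0; case: ifP.
by rewrite mulr1 (_ : b i = 0) ?ai ?addr0 ?eqxx //; lra.
Qed.

Lemma submx_of_annihilator (p m : nat) (A : 'M[R]_(m, p)) (y : 'rV[R]_p) :
  (forall v : 'cV[R]_p, A *m v = 0 -> y *m v = 0) -> (y <= A)%MS.
Proof.
move=> H; rewrite submxE; apply/eqP/matrixP => i j; rewrite [RHS]mxE.
have colM m' (B : 'M[R]_(m', p)) (r : 'I_m') :
    (B *m col j (cokermx A)) r ord0 = (B *m cokermx A) r j.
  by rewrite !mxE; apply: eq_bigr => k _; rewrite mxE.
rewrite -colM H ?mxE //; apply/matrixP => r c.
by rewrite ord1 colM mulmx_coker !mxE.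
Qed.

(** Double annihilator in finite dimension. The rank of the first n vectors is maximal for some n,
    and these vectors then span the whole sequence. *)
Lemma seq_annihilator (p : nat) (g : nat -> 'rV[R]_p) (y : 'rV[R]_p) :
  (forall v : 'cV[R]_p, (forall k, g k *m v = 0) -> y *m v = 0) ->
  exists (n : nat) (c : nat -> R), y = \sum_(k < n) c k *: g k.
Proof.
move=> H; pose A n := \matrix_(k < n) g k.
have [n nmax] : exists n, forall m, (\rank (A m) <= \rank (A n))%N.
  have ex : exists r, `[< exists n, \rank (A n) = r >].
    by exists (\rank (A 0)); apply/asboolP; exists 0.
  have bd r : `[< exists n, \rank (A n) = r >] -> (r <= p)%N.
    by move=> /asboolP[n <-]; apply: rank_leq_col.
  case: (ex_maxnP ex bd) => r /asboolP[n rn] rmax; exists n => m.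
  by rewrite rn; apply: rmax; apply/asboolP; exists m.
have sub m k : (k < m)%N -> (g k <= A m)%MS.
  by move=> km; have := row_sub (Ordinal km) (A m); rewrite rowK.
have gA k : (g k <= A n)%MS.
  have nm : (A n <= A (maxn n k.+1))%MS.
    apply/row_subP => i; rewrite rowK; apply: sub.
    by rewrite leq_max ltn_ord.
  have /eqmxP/eqmx_sym e : (A n == A (maxn n k.+1))%MS.
    by rewrite -(geq_leqif (mxrank_leqif_eq nm)).
  by rewrite -e sub // leq_max ltnSn orbT.
have : (y <= A n)%MS.
  apply: submx_of_annihilator => v Av; apply: H => k.
  by have /submxP[D ->] := gA k; rewrite -mulmxA Av mulmx0.
move=> /submxP[D ->]; exists n, (fun k => if insub k is Some i then D ord0 i else 0).
rewrite mulmx_sum_row; apply: eq_bigr => i _; rewrite rowK.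
by rewrite valK.
Qed.

(** Dual form of [face_relation]: a coefficient vector killed by all evaluations along the curve is
    killed by the right-hand side too, which is therefore a finite combination of evaluations. *)
Lemma face_functional (I : finType) (a b : I -> R) :
  (forall i, [/\ 0 <= a i, 0 <= b i & a i + b i <= 1]) ->
  exists (n : nat) (c : nat -> R), forall i,
    \sum_(k < n) c k * expR (a i * ln k.+2%:R + b i * ln k.+1%:R) =
    (a i == 1)%:R + (a i + b i == 0)%:R.
Proof.
move=> ab.
pose g k : 'rV[R]_#|I| := \row_i
  expR (a (enum_val i) * ln k.+2%:R + b (enum_val i) * ln k.+1%:R).
pose y : 'rV[R]_#|I| := \row_i
  ((a (enum_val i) == 1)%:R + (a (enum_val i) + b (enum_val i) == 0)%:R).
have [|n [c yE]] := @seq_annihilator _ g y.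
  move=> v gv; pose q i := v (enum_rank i) ord0.
  have -> : y *m v = const_mx (\sum_(i | a i == 1) q i + \sum_(i | a i + b i == 0) q i).
    apply/matrixP => r t; rewrite !ord1 !mxE.
    rewrite [in RHS]big_mkcond [X in _ + X]big_mkcond -big_split /=.
    rewrite (reindex (fun i : I => enum_rank i)) /=; last first.
      by apply: onW_bij; exact: enum_rank_bij.
    apply: eq_bigr => i _; rewrite mxE enum_rankK /q mulrDl.
    by congr (_ + _); case: ifP => _; rewrite ?mul1r ?mul0r.
  rewrite face_relation //.
  move=> k; have /matrixP/(_ ord0 ord0) := gv k; rewrite !mxE => gk.
  apply: etrans gk.
  rewrite [RHS](reindex (fun i : I => enum_rank i)) /=; last first.
    by apply: onW_bij; exact: enum_rank_bij.
  by apply: eq_bigr => i _; rewrite mxE enum_rankK mulrC.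
exists n, c => i; have /rowP/(_ (enum_rank i)) := yE.
rewrite mxE enum_rankK => ->; rewrite summxE; apply: eq_bigr => k _.
by rewrite !mxE enum_rankK.
Qed.

End FaceRelation.

(** * The multiplier *)

Lemma near_fin (I : finType) (P : I -> nat -> Prop) :
  (forall i, \forall n \near \oo, P i n) -> \forall n \near \oo, forall i, P i n.
Proof.
move=> nP; suff H (s : seq I) : \forall n \near \oo, forall i, i \in s -> P i n.
  by apply: filterS (H (enum I)) => n Hn i; apply: Hn; rewrite mem_enum.
elim: s => [|i s IH]; first by near=> n.
near=> n => j; rewrite inE => /orP[/eqP -> |]; first by near: n.
by move: j; near: n.
Unshelve. all: by end_near. Qed.

Section Vanishing.
Variable R : realType.

Definition vanishing (f : nat -> R) : Prop :=
  forall r, 0 < r -> \forall n \near \oo, f n <= r.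

Lemma vanishingD f g : vanishing f -> vanishing g -> vanishing (fun n => f n + g n).
Proof.
move=> vf vg r r0; have r2 : 0 < r / 2 by lra.
near=> n; have : f n <= r / 2 by near: n; apply: vf.
have : g n <= r / 2 by near: n; apply: vg.
lra.
Unshelve. all: by end_near. Qed.

Lemma vanishing_sum (I : Type) (s : seq I) (P : pred I) (f : I -> nat -> R) :
  (forall i, P i -> vanishing (f i)) -> vanishing (fun n => \sum_(i <- s | P i) f i n).
Proof.
move=> vf; elim: s => [|i s IH] r r0.
  by near=> n; rewrite big_nil ltW.
case Pi: (P i); last by near=> n; rewrite big_cons Pi; near: n; apply: IH.
have := vanishingD (vf i Pi) IH r0; apply: filterS => n.
by rewrite big_cons Pi.
Unshelve. all: by end_near. Qed.

Lemma vanishing_exp (c a C d : R) : 0 <= c -> 0 < d ->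
  vanishing (fun n => c * expR (a * ln n%:R + C - d * n%:R)).
Proof.
move=> c0 d0 r r0.
have H := near_log_le_linear a (C - ln r + ln (c + 1)) d0.
near=> n; have H1 : C - ln r + ln (c + 1) + a * ln n%:R <= d * n%:R by near: n.
have c1 : 0 < c + 1 by lra.
apply: le_trans (_ : (c + 1) * expR (a * ln n%:R + C - d * n%:R) <= _).
  by rewrite ler_wpM2r ?expR_ge0 //; lra.
rewrite -[X in X * _]lnK ?posrE // -expRD -[leRHS]lnK ?posrE // ler_expR; lra.
Unshelve. all: by end_near. Qed.

Lemma vanishing_pow (c d : R) : 0 <= c -> 0 < d ->
  vanishing (fun n => c * expR (- d * ln n%:R)).
Proof.
move=> c0 d0 r r0.
pose t : R := (ln (c + 1) - ln r) / d.
near=> n.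
have ntt : expR t <= n%:R by near: n; exact: nbhs_infty_ger.
have ln_t : t <= ln n%:R.
  rewrite -[leLHS]expRK ler_ln ?posrE ?expR_gt0 //.
  by apply: lt_le_trans ntt; exact: expR_gt0.
have {ln_t} : ln (c + 1) - ln r <= ln n%:R * d by rewrite -ler_pdivrMr.
have c1 : 0 < c + 1 by lra.
move=> H; apply: le_trans (_ : (c + 1) * expR (- d * ln n%:R) <= _).
  by rewrite ler_wpM2r ?expR_ge0 //; lra.
rewrite -[X in X * _]lnK ?posrE // -expRD -[leRHS]lnK ?posrE // ler_expR; lra.
Unshelve. all: by end_near. Qed.

End Vanishing.

Lemma sum_ord5 (V : nmodType) (F : 'I_5) (h : 'I_5 -> V) :
  \sum_i h i = h F + h (F + 1) + h (F + 2%:R) + h (F + 3%:R) + h (F + 4%:R).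
Proof.
rewrite (reindex_inj (addrI F)) /= 5!big_ord_recr big_ord0 /= add0r.
by congr (_ + _ + _ + _ + _); congr (h _); apply/val_inj; case: F => -[|[|[|[|[|m]]]]].
Qed.

(** * Positive definiteness of the multiplier kernel *)

Section PositiveDefinite.
Variables (R : realType) (E : zmodType) (beta : E -> E -> R) (e : 'I_5 -> E).
Hypothesis betaC : forall x y, beta x y = beta y x.
Hypothesis betaD : forall x y z, beta (x + y) z = beta x z + beta y z.
Hypothesis beta_ge0 : forall x, 0 <= beta x x.
Hypothesis beta_e : forall i j, beta (e i) (e j) = (i == j)%:R.

Definition sqn x := beta x x.
Definition co (i : 'I_5) x := beta x (e i).

Lemma beta0 z : beta 0 z = 0.
Proof. by have := betaD 0 0 z; rewrite addr0; lra. Qed.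
Lemma betaN x z : beta (- x) z = - beta x z.
Proof. by have := betaD x (- x) z; rewrite subrr beta0; lra. Qed.
Lemma betaDr x y z : beta z (x + y) = beta z x + beta z y.
Proof. by rewrite betaC betaD !(betaC _ z). Qed.
Lemma betaNr x z : beta z (- x) = - beta z x.
Proof. by rewrite betaC betaN betaC. Qed.

(** This parallelogram law makes the kernel exp([sqn (x + y)] ln n) nearly diagonal: up to diagonal
    factors its entries are exp(- [sqn (x - y)] ln n). *)
Lemma sqnD x y : sqn (x + y) = 2 * sqn x + 2 * sqn y - sqn (x - y).
Proof.
by rewrite /sqn !(betaD, betaDr, betaN, betaNr) (betaC y x); ring.
Qed.

Lemma sqnB x y : sqn (x - y) = sqn x - 2 * beta x y + sqn y.
Proof. by rewrite /sqn !(betaD, betaDr, betaN, betaNr) (betaC y x); ring. Qed.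

(** Degenerate case of Cauchy-Schwarz. As E is only an abelian group, natural multiples replace real
    scalars: 0 <= 2 k [beta s y] + [sqn y] for all k gives 0 <= [beta s y], and this is applied to x
    and to - x. *)
Lemma sqn0_beta x y : sqn x = 0 -> beta x y = 0.
Proof.
move=> x0; have sc k s : beta (s *+ k) y = k%:R * beta s y.
  elim: k => [|k IH]; first by rewrite mulr0n beta0 mul0r.
  by rewrite mulrS betaD IH -natr1; ring.
have sq s k : sqn s = 0 -> 0 <= 2 * k%:R * beta s y + sqn y.
  move=> s0; have := beta_ge0 (s *+ k + y); rewrite betaD !betaDr.
  have -> : beta (s *+ k) (s *+ k) = 0.
    have sc2 j w : beta (s *+ j) w = j%:R * beta s w.
      elim: j => [|j IH]; first by rewrite mulr0n beta0 mul0r.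
      by rewrite mulrS betaD IH -natr1; ring.
    by rewrite sc2 betaC sc2 -/(sqn s) s0 !mulr0.
  by rewrite (betaC y) sc -/(sqn y); lra.
suff pos s : sqn s = 0 -> 0 <= beta s y.
  apply/le_anti/andP; split; last exact: pos.
  have := pos (- x); rewrite betaN /sqn betaN betaNr opprK -/(sqn x) => /(_ x0).
  by lra.
move=> s0; rewrite leNgt; apply/negP => neg.
have [N _ HN] := @nbhs_infty_ger R ((sqn y + 1) / - beta s y).
have := HN N (leqnn N); rewrite /= ler_pdivrMr ?oppr_gt0 // => h.
by have := sq s N s0; have := beta_ge0 y; rewrite -/(sqn y); lra.
Qed.

Lemma sqn0_co i x : sqn (x - e i) = 0 -> forall j, co j x = (i == j)%:R.
Proof.
move=> x0 j; have := sqn0_beta (e j) x0; rewrite betaD betaN beta_e /co; lra.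
Qed.

Lemma sqn_sub_e i x : sqn (x - e i) = sqn x - 2 * co i x + 1.
Proof. by rewrite sqnB /co /sqn beta_e eqxx. Qed.

Lemma coD i x y : co i (x + y) = co i x + co i y. Proof. exact: betaD. Qed.

(* Logarithm of the evaluation of the monomial x at (1, k + 2, k + 1, w, w), w = e^(-n^2),
   a near-zero of the Horn form, placed on the face of the simplex starting at F. *)
Definition face_log (n : nat) (F : 'I_5) (k : nat) (x : E) : R :=
  co (F + 1) x * ln k.+2%:R + co (F + 2%:R) x * ln k.+1%:R
  - (co (F + 3%:R) x + co (F + 4%:R) x) * n%:R ^+ 2.

Definition moment (n : nat) (x : E) : R :=
  \sum_F \sum_(k < n) expR (face_log n F k x).

(* Vanishes exactly on twice the standard simplex. *)
Definition off_simplex (x : E) : R :=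
  \sum_i (`|co i x| - co i x) / 2 + `|\sum_i co i x - 2|.

Definition vertex (x : E) : bool := [exists i, sqn (x - (e i + e i)) == 0].

(* The negative sign at the vertices is what makes the Horn sum of the multiplier negative. *)
Definition perturbation (n : nat) (x : E) : R :=
  (if vertex x then -1 else 1) *
  expR (2 * n%:R ^+ 2 * off_simplex x + sqn x * ln n%:R).

Definition multiplier (n : nat) (x : E) : R :=
  moment n x + expR (- n%:R) * perturbation n x.

Lemma face_logD n F k x y : face_log n F k (x + y) = face_log n F k x + face_log n F k y.
Proof. by rewrite /face_log !coD; ring. Qed.

(** The share of [off_simplex] that falls to each factor of a product: subadditivity bounds the
    kernel off the diagonal, and there is equality on the diagonal. It vanishes exactly on the
    standard simplex. *)
Definition half_off (x : E) : R :=
  \sum_i (`|co i x| - co i x) / 2 + `|\sum_i co i x - 1|.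

Lemma half_off_ge0 x : 0 <= half_off x.
Proof.
rewrite /half_off addr_ge0 // sumr_ge0 // => i _.
by rewrite divr_ge0 // subr_ge0 ler_norm.
Qed.

Lemma off_simplexD x y : off_simplex (x + y) <= half_off x + half_off y.
Proof.
have sumD : \sum_i co i (x + y) = \sum_i co i x + \sum_i co i y.
  by rewrite -big_split; apply: eq_bigr => i _; rewrite coD.
rewrite /off_simplex /half_off sumD addrACA -[X in _ <= X + _]big_split lerD //=.
  apply: ler_sum => i _; rewrite coD /=.
  have := ler_normD (co i x) (co i y); lra.
have := ler_normD (\sum_i co i x - 1) (\sum_i co i y - 1).
by rewrite (_ : _ - 1 + _ = \sum_i co i x + \sum_i co i y - 2) //; ring.
Qed.

Lemma off_simplexDD x : off_simplex (x + x) = 2 * half_off x.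
Proof.
have sumD : \sum_i co i (x + x) - 2 = 2 * (\sum_i co i x - 1).
  by rewrite mulrBr mulr1 mulr_sumr; congr (_ - _); apply: eq_bigr => i _; rewrite coD; ring.
rewrite /off_simplex /half_off sumD normrM [`|2|]ger0_norm // [RHS]mulrDr; congr (_ + _).
rewrite mulr_sumr; apply: eq_bigr => i _; rewrite coD.
by rewrite (_ : co i x + co i x = 2 * co i x) ?normrM ?[`|2|]ger0_norm //; ring.
Qed.

(** The decay rate in n^2 of [expR (face_log n F k x)] divided by [weight n x]. The factor 2 turns
    the contribution of the coordinates F + 3 and F + 4 into their absolute values, so that the gap
    is a sum of nonnegative terms and vanishes only on the face. *)
Definition face_gap (F : 'I_5) (x : E) : R :=
  2 * half_off x + co (F + 3%:R) x + co (F + 4%:R) x.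

Lemma face_gap_ge0 F x : 0 <= face_gap F x.
Proof.
rewrite /face_gap /half_off !(sum_ord5 F).
have n0 := ler_norm (co F x). have n1 := ler_norm (co (F + 1) x).
have n2 := ler_norm (co (F + 2%:R) x).
have n3 := normr_ge0 (co (F + 3%:R) x). have n4 := normr_ge0 (co (F + 4%:R) x).
set s := `|_ - 1|; have s0 : 0 <= s by exact: normr_ge0.
lra.
Qed.

Lemma face_gap0 F x : face_gap F x = 0 <->
  [/\ 0 <= co (F + 1) x, 0 <= co (F + 2%:R) x, co (F + 1) x + co (F + 2%:R) x <= 1,
      co F x = 1 - co (F + 1) x - co (F + 2%:R) x &
      co (F + 3%:R) x = 0 /\ co (F + 4%:R) x = 0].
Proof.
rewrite /face_gap /half_off !(sum_ord5 F).
move: (co F x) (co (F + 1) x) (co (F + 2%:R) x) (co (F + 3%:R) x) (co (F + 4%:R) x).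
move=> c0 c1 c2 c3 c4; split=> [H|[h1 h2 h3 h0 [-> ->]]]; last first.
  rewrite !normr0 !ger0_norm //; [|lra|lra]; rewrite h0.
  rewrite (_ : _ - 1 = 0) ?normr0; [lra|lra].
have n0 := ler_norm c0. have n1 := ler_norm c1. have n2 := ler_norm c2.
have n3 := normr_ge0 c3. have n4 := normr_ge0 c4.
move: H; set s := `|_ - 1| => H; have s0 : 0 <= s by exact: normr_ge0.
have e0 : `|c0| = c0 by lra. have e1 : `|c1| = c1 by lra. have e2 : `|c2| = c2 by lra.
have /eqP : `|c3| = 0 by lra. rewrite normr_eq0 => /eqP e3.
have /eqP : `|c4| = 0 by lra. rewrite normr_eq0 => /eqP e4.
have /eqP : s = 0 by lra. rewrite normr_eq0 => /eqP es.
have p0 := normr_ge0 c0. have p1 := normr_ge0 c1. have p2 := normr_ge0 c2.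
split=> //; lra.
Qed.

Lemma sqn_ge0 x : 0 <= sqn x. Proof. exact: beta_ge0. Qed.

Lemma sqn0B x y : sqn x = 0 -> sqn y = 0 -> sqn (x - y) = 0.
Proof. by move=> x0 y0; rewrite sqnB x0 y0 (sqn0_beta _ x0); ring. Qed.

Definition at_vertex (x : E) : bool := [exists i, sqn (x - e i) == 0].

Lemma vertex_double x : vertex (x + x) = at_vertex x.
Proof.
apply: eq_existsb => i.
rewrite (_ : x + x - (e i + e i) = (x - e i) + (x - e i)); last by rewrite opprD addrACA.
rewrite sqnD subrr (_ : sqn 0 = 0) ?subr0; last exact: beta0.
by apply/eqP/eqP; lra.
Qed.

(* The diagonal scaling that turns the Hankel matrix of [perturbation] almost into a
   diagonal matrix of signs. *)
Definition weight (n : nat) (x : E) : R :=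
  expR (2 * n%:R ^+ 2 * half_off x + 2 * sqn x * ln n%:R).

Variables (I : finType) (c : I -> E).
Hypothesis c_sep : forall a b, a != b -> sqn (c a - c b) != 0.

(** In the variables [u a * weight n (c a)] the diagonal entries are signs, -1 at the vertices and 1
    elsewhere, and by [sqnD] and [off_simplexD] the separation of the classes makes the other
    entries tend to 0. *)
Lemma perturbation_lower_bound : \forall n \near \oo, forall u : I -> R,
  (\sum_a (u a * weight n (c a)) ^+ 2) / 2
    - 2 * \sum_(a | at_vertex (c a)) (u a * weight n (c a)) ^+ 2
  <= \sum_a \sum_b u a * u b * perturbation n (c a + c b).
Proof.
(* Off-diagonal entries of size at most [d] cost at most [d * #|I|] of the square norm, which is
   below 1/2; the other half remains in the bound. *)
pose d : R := (2 * (#|I|.+1)%:R)^-1.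
have d0 : 0 < d by rewrite invr_gt0 mulr_gt0 // ltr0n.
have small : \forall n \near \oo, forall a b, a != b ->
    expR (- sqn (c a - c b) * ln n%:R) <= d.
  apply: near_fin => a; apply: near_fin => b.
  have [ab|ab] := eqVneq a b; first by near=> n.
  have Nab : 0 < sqn (c a - c b) by rewrite lt_neqAle eq_sym c_sep // sqn_ge0.
  have := vanishing_pow ler01 Nab d0; apply: filterS => n; rewrite mul1r => H _.
  exact: H.
near=> n => u.
have sm : forall a b, a != b -> expR (- sqn (c a - c b) * ln n%:R) <= d.
  by near: n.
pose z a := u a * weight n (c a).
have diag a : perturbation n (c a + c a) =
    (if at_vertex (c a) then -1 else 1) * weight n (c a) ^+ 2.
  rewrite /perturbation vertex_double off_simplexDD sqnD subrr /sqn beta0; congr (_ * _).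
  by rewrite /weight [RHS]expr2 -expRD; congr expR; rewrite /sqn; ring.
have offd a b : a != b -> `|perturbation n (c a + c b)| <=
    weight n (c a) * weight n (c b) * d.
  move=> ab; rewrite /perturbation normrM [X in X * _](_ : _ = 1); last first.
    by case: ifP; rewrite ?normrN normr1.
  rewrite mul1r ger0_norm ?expR_ge0 //.
  apply: le_trans (_ : _ <= weight n (c a) * weight n (c b) *
     expR (- sqn (c a - c b) * ln n%:R)) _; last first.
    by rewrite ler_wpM2l ?sm // mulr_ge0 // expR_ge0.
  rewrite /weight -!expRD ler_expR sqnD.
  have : 2 * n%:R ^+ 2 * off_simplex (c a + c b) <=
     2 * n%:R ^+ 2 * (half_off (c a) + half_off (c b)).
    by rewrite ler_wpM2l ?off_simplexD // mulr_ge0 // exprn_ge0.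
  lra.
have term a b : (if b == a then (if at_vertex (c a) then -1 else 1) * z a ^+ 2 else 0)
    - d * ((z a ^+ 2 + z b ^+ 2) / 2) <= u a * u b * perturbation n (c a + c b).
  have zz0 : 0 <= d * ((z a ^+ 2 + z b ^+ 2) / 2).
    by rewrite mulr_ge0 ?(ltW d0) // divr_ge0 // addr_ge0 // sqr_ge0.
  have [->|ba] := eqVneq b a.
    rewrite -[X in _ <= X]subr0 lerB //; first by rewrite diag /z; lra.
    by rewrite mulr_ge0 ?(ltW d0) // divr_ge0 // addr_ge0 // sqr_ge0.
  rewrite sub0r lerNl -mulNr; apply: le_trans (ler_norm _) _.
  rewrite normrM normrN normrM.
  apply: le_trans (ler_wpM2l _ (offd a b _)) _; [by rewrite mulr_ge0|by rewrite eq_sym|].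
  rewrite [X in X <= _](_ : _ = d * (`|z a| * `|z b|)); last first.
    have wE x : `|weight n x| = weight n x by rewrite ger0_norm // expR_ge0.
    by rewrite /z !normrM !wE; ring.
  rewrite ler_wpM2l ?(ltW d0) //.
  have := sqr_ge0 (`|z a| - `|z b|).
  by rewrite sqrrB !real_normK ?num_real //; lra.
apply: le_trans (ler_sum _ (fun a _ => ler_sum _ (fun b _ => term a b))).
set S := \sum_a (u a * weight n (c a)) ^+ 2.
set V := \sum_(a | _) _; set sg := fun a => if at_vertex (c a) then -1 else 1 : R.
have -> : \sum_a \sum_b ((if b == a then sg a * z a ^+ 2 else 0)
    - d * ((z a ^+ 2 + z b ^+ 2) / 2)) = \sum_a sg a * z a ^+ 2 - d * (#|I|%:R * S).
  rewrite (eq_bigr (fun a => sg a * z a ^+ 2 - d * ((#|I|%:R * z a ^+ 2 + S) / 2))).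
    rewrite sumrB -mulr_sumr -mulr_suml big_split /= -mulr_sumr sumr_const -/S.
    by rewrite -[S *+ _]mulr_natl; congr (_ - _); lra.
  move=> a _; rewrite sumrB -big_mkcond big_pred1_eq -mulr_sumr -mulr_suml.
  by rewrite big_split /= sumr_const -[z a ^+ 2 *+ _]mulr_natl.
have -> : \sum_a sg a * z a ^+ 2 = S - 2 * V.
  rewrite /S /V [X in 2 * X]big_mkcond mulr_sumr -sumrB; apply: eq_bigr => a _.
  by rewrite /sg; case: ifP => _; rewrite /z; ring.
have S0 : 0 <= S by apply: sumr_ge0 => a _; apply: sqr_ge0.
have dI : d * #|I|%:R <= 1 / 2.
  by rewrite /d mulrC ler_pdivrMr ?mulr_gt0 ?ltr0n // -[#|I|.+1%:R]natr1; lra.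
have := ler_wpM2r S0 dI.
lra.
Unshelve. all: by end_near. Qed.

Lemma ord5_cyc_neq (F i j : 'I_5) : i != j -> (F + i == F + j) = false.
Proof. by move=> ij; rewrite (inj_eq (addrI F)) (negbTE ij). Qed.

Lemma ord5_cyc_neq0 (F i : 'I_5) : i != 0 -> (F + i == F) = false.
Proof. by move=> i0; rewrite -[X in _ == X]addr0 ord5_cyc_neq. Qed.

(** If [sqn x] is at most 1 and a coordinate equals 1, then [sqn (x - e i)] is at most 0, so x is
    that vertex up to a null vector. Larger norms are left to the factor exp(2 [sqn x] ln n) in
    [weight]. *)
Lemma vertex_on_face F x : sqn x <= 1 ->
  (sqn (x - e F) == 0)%:R + (sqn (x - e (F + 1)) == 0)%:R =
  (face_gap F x == 0)%:R *
    ((co (F + 1) x == 1)%:R + (co (F + 1) x + co (F + 2%:R) x == 0)%:R) :> R.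
Proof.
move=> x1.
have near_e i : co i x = 1 -> sqn (x - e i) == 0.
  move=> xi; have := sqn_ge0 (x - e i); rewrite sqn_sub_e xi => h.
  by apply/eqP/le_anti/andP; split; lra.
have -> : (sqn (x - e (F + 1)) == 0) = (face_gap F x == 0) && (co (F + 1) x == 1).
  apply/eqP/andP => [/sqn0_co h|[_ /eqP /near_e /eqP //]].
  rewrite h eqxx; split=> //; apply/eqP/face_gap0.
  by rewrite !h eqxx !ord5_cyc_neq // ord5_cyc_neq0 // /= mulr1n mulr0n; do ?split=> //; lra.
have -> : (sqn (x - e F) == 0) =
    (face_gap F x == 0) && (co (F + 1) x + co (F + 2%:R) x == 0).
  apply/eqP/andP => [/sqn0_co h|[/eqP/face_gap0 [h1 h2 h3 h0 _] /eqP h12]]; last first.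
    by apply/eqP/near_e; lra.
  have cF (i : 'I_5) : i != 0 -> co (F + i) x = 0.
    by move=> i0; rewrite h eq_sym ord5_cyc_neq0.
  rewrite !cF // addr0 eqxx; split=> //; apply/eqP/face_gap0.
  by rewrite !cF // h eqxx /= mulr1n; do ?split=> //; lra.
by case: (face_gap F x == 0); rewrite ?mul1r ?mul0r ?addr0 1?addrC.
Qed.

Definition vertex_sum (u : I -> R) (i : 'I_5) : R := \sum_(a | sqn (c a - e i) == 0) u a.

(* [face_functional] writes evaluation at both vertices of an edge as a combination of
   evaluations along the face, so small moments make each sum over adjacent vertices small.
   The cycle of vertices being odd, the sum at each vertex is then small too. *)
Lemma face_control : \forall n \near \oo, forall (F : 'I_5) (u : I -> R) (T : R),
  0 <= T -> (forall a, `|u a| * weight n (c a) <= T) ->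
  (forall k, (k < n)%N ->
     `|\sum_a u a * expR (face_log n F k (c a))| <= T * expR (- (n%:R / 2))) ->
  expR (2 * ln n%:R) * `|vertex_sum u F + vertex_sum u (F + 1)| <= T / 20.
Proof.
apply: near_fin => F.
pose face a := face_gap F (c a) == 0.
(* Exponents off the face are replaced by 0 to meet the hypothesis of [face_functional]; the factor
   [face a] in [y] cuts these terms out again. *)
pose a' a := if face a then co (F + 1) (c a) else 0.
pose b' a := if face a then co (F + 2%:R) (c a) else 0.
have ab' a : [/\ 0 <= a' a, 0 <= b' a & a' a + b' a <= 1].
  rewrite /a' /b' /face; case: eqP => [/face_gap0 [] //|_].
  by rewrite addr0.
have [n0 [kap kapE]] := face_functional ab'.
pose C k a := co (F + 1) (c a) * ln k.+2%:R + co (F + 2%:R) (c a) * ln k.+1%:R.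
(* Three errors relative to T: the moments themselves, of order e^(-n/2); the terms off the face,
   which decay with [face_gap]; and the classes of norm above 1, whose [weight] exceeds the vertex
   weight n^2 by a power of n. *)
pose W n := \sum_(k < n0) `|kap k| * expR (2 * ln n%:R + 0 - 2^-1 * n%:R) +
  \sum_(k < n0) \sum_(a | ~~ face a)
     `|kap k| * expR (2 * ln n%:R + C k a - face_gap F (c a) * n%:R) +
  \sum_(a | 1 < sqn (c a)) 2 * expR (- (2 * (sqn (c a) - 1)) * ln n%:R).
have vW : vanishing W.
  apply: vanishingD; first apply: vanishingD.
  - by apply: vanishing_sum => k _; apply: vanishing_exp => //; lra.
  - apply: vanishing_sum => k _; apply: vanishing_sum => a fa; apply: vanishing_exp => //.
    by rewrite lt_neqAle eq_sym fa face_gap_ge0.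
  - by apply: vanishing_sum => a Na; apply: vanishing_pow => //; lra.
near=> n => u T T0 uT qT.
have Wn : W n <= 1 / 20 by near: n; apply: vW; lra.
have n1 : 1 <= n%:R :> R by near: n; exact: nbhs_infty_ger.
have n0n : (n0 <= n)%N by near: n; exact: nbhs_infty_ge.
have ln0 : 0 <= ln n%:R :> R by apply: ln_ge0.
set w2 := expR (2 * ln n%:R); have w20 : 0 <= w2 by exact: expR_ge0.
have uexp a t : `|u a| * expR t <= T * expR (t - 2 * n%:R ^+ 2 * half_off (c a)
    - 2 * sqn (c a) * ln n%:R).
  rewrite (_ : expR t = weight n (c a) * expR (t - 2 * n%:R ^+ 2 * half_off (c a)
    - 2 * sqn (c a) * ln n%:R)); last by rewrite -expRD; congr expR; ring.
  by rewrite mulrA ler_wpM2r ?expR_ge0.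
have Nln a : 0 <= sqn (c a) * ln n%:R by rewrite mulr_ge0 ?sqn_ge0.
have nn : n%:R <= n%:R ^+ 2 :> R by rewrite expr2 ler_peMr //; lra.
pose y a : R := (face a)%:R * ((co (F + 1) (c a) == 1)%:R +
   (co (F + 1) (c a) + co (F + 2%:R) (c a) == 0)%:R).
pose io a : R := (sqn (c a - e F) == 0)%:R + (sqn (c a - e (F + 1)) == 0)%:R.
have yE a : y a = \sum_(k < n0) if face a then kap k * expR (face_log n F k (c a)) else 0.
  rewrite /y; case fa: (face a); last by rewrite mul0r big1.
  have := kapE a; rewrite /a' /b' fa mul1r => <-; apply: eq_bigr => k _.
  congr (_ * expR _); rewrite /face_log.
  by have /face_gap0[_ _ _ _ [-> ->]] := eqP fa; rewrite addr0 mul0r subr0.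
have sumE : vertex_sum u F + vertex_sum u (F + 1) = \sum_a u a * io a.
  rewrite /vertex_sum [X in X + _]big_mkcond [X in _ + X]big_mkcond -big_split /=.
  apply: eq_bigr => a _; rewrite /io mulrDr.
  by congr (_ + _); case: ifP => _; rewrite ?mulr1 ?mulr0.
have uy : \sum_a u a * y a = \sum_(k < n0) kap k *
    (\sum_a u a * expR (face_log n F k (c a)) -
     \sum_(a | ~~ face a) u a * expR (face_log n F k (c a))).
  under eq_bigr => a _ do rewrite yE mulr_sumr.
  rewrite exchange_big /=; apply: eq_bigr => k _.
  rewrite (bigID face) /= [X in _ + X]big1 ?addr0; last first.
    by move=> a /negbTE ->; rewrite mulr0.
  rewrite [X in _ * (X - _)](bigID face) /= addrK mulr_sumr.
  by apply: eq_bigr => a ->; ring.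
have part1 : w2 * `|\sum_a u a * y a| <= T *
  (\sum_(k < n0) `|kap k| * expR (2 * ln n%:R + 0 - 2^-1 * n%:R) +
  \sum_(k < n0) \sum_(a | ~~ face a)
     `|kap k| * expR (2 * ln n%:R + C k a - face_gap F (c a) * n%:R)).
  rewrite uy -big_split mulr_sumr /=.
  apply: le_trans (ler_wpM2l w20 (ler_norm_sum _ _ _)) _.
  rewrite mulr_sumr; apply: ler_sum => k _.
  rewrite normrM mulrCA -mulr_sumr -mulrDr [leRHS]mulrCA ler_wpM2l //.
  apply: le_trans (ler_wpM2l w20 (ler_normB _ _)) _.
  rewrite mulrDr mulrDr lerD //.
    apply: le_trans (ler_wpM2l w20 (qT k (leq_trans (ltn_ord k) n0n))) _.
    rewrite mulrCA ler_wpM2l // -expRD ler_expR; lra.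
  apply: le_trans (ler_wpM2l w20 (ler_norm_sum _ _ _)) _.
  rewrite !mulr_sumr; apply: ler_sum => a fa.
  rewrite normrM (ger0_norm (expR_ge0 _)).
  apply: le_trans (ler_wpM2l w20 (uexp a _)) _.
  rewrite mulrCA ler_wpM2l // -expRD ler_expR.
  have : face_gap F (c a) * n%:R <= face_gap F (c a) * n%:R ^+ 2.
    by rewrite ler_wpM2l // face_gap_ge0.
  have := Nln a; rewrite /face_log /C /face_gap; lra.
have part2 : w2 * `|\sum_a u a * (io a - y a)| <= T *
    \sum_(a | 1 < sqn (c a)) 2 * expR (- (2 * (sqn (c a) - 1)) * ln n%:R).
  rewrite (bigID (fun a => 1 < sqn (c a))) /= [X in _ + X]big1 ?addr0; last first.
    move=> a; rewrite -leNgt => Na.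
    by rewrite /io /y /face vertex_on_face // subrr mulr0.
  apply: le_trans (ler_wpM2l w20 (ler_norm_sum _ _ _)) _.
  rewrite !mulr_sumr; apply: ler_sum => a Na; rewrite normrM.
  have d2 : `|io a - y a| <= 2.
    by rewrite /io /y /face; do 5![case: (_ == _) => /=]; rewrite ler_norml ?mulr1n ?mulr0n; lra.
  apply: le_trans (_ : w2 * (`|u a| * 2) <= _); first by rewrite ler_wpM2l // ler_wpM2l.
  have := uexp a (2 * ln n%:R); rewrite -/w2 => h.
  rewrite (_ : w2 * (`|u a| * 2) = 2 * (`|u a| * w2)); last by ring.
  rewrite [leRHS]mulrCA ler_wpM2l //.
  apply: (le_trans h); rewrite ler_wpM2l // ler_expR.
  have : 0 <= n%:R ^+ 2 * half_off (c a) by rewrite mulr_ge0 ?half_off_ge0 // exprn_ge0.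
  by lra.
rewrite sumE (_ : \sum_a _ = \sum_a u a * y a + \sum_a u a * (io a - y a)); last first.
  by rewrite -big_split /=; apply: eq_bigr => a _; ring.
apply: le_trans (ler_wpM2l w20 (ler_normD _ _)) _.
rewrite mulrDr; apply: le_trans (lerD part1 part2) _.
rewrite -mulrDr -/(W n).
by apply: le_trans (ler_wpM2l T0 Wn) _; lra.
Unshelve. all: by end_near. Qed.

(** Each evaluation is multiplicative by [face_logD], so its Hankel kernel has rank one. *)
Lemma moment_gram (n : nat) (u : I -> R) :
  \sum_a \sum_b u a * u b * moment n (c a + c b) =
  \sum_F \sum_(k < n) (\sum_a u a * expR (face_log n F k (c a))) ^+ 2.
Proof.
under eq_bigr => a _.
  under eq_bigr => b _ do rewrite /moment mulr_sumr.
  rewrite exchange_big /=.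
  over.
rewrite exchange_big /=; apply: eq_bigr => F _.
under eq_bigr => a _.
  under eq_bigr => b _ do rewrite mulr_sumr.
  rewrite exchange_big /=.
  over.
rewrite exchange_big /=; apply: eq_bigr => k _.
rewrite expr2 big_distrlr /=; apply: eq_bigr => a _; apply: eq_bigr => b _.
by rewrite face_logD expRD; ring.
Qed.

Lemma weight_at_vertex n i a : sqn (c a - e i) = 0 -> weight n (c a) = expR (2 * ln n%:R).
Proof.
move=> /[dup] /sqn0_co h s0.
have N1 : sqn (c a) = 1.
  by move: s0; rewrite sqn_sub_e h eqxx /= mulr1n; lra.
have g0 : face_gap i (c a) = 0.
  have cF (j : 'I_5) : j != 0 -> co (i + j) (c a) = 0.
    by move=> i0; rewrite h eq_sym ord5_cyc_neq0.
  apply/face_gap0.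
  by rewrite !cF // h eqxx /= mulr1n; do ?split=> //; lra.
rewrite /weight N1; congr expR; move: g0; rewrite /face_gap.
rewrite !h !(eq_sym i) !ord5_cyc_neq0 //= mulr0n => g0.
have -> : half_off (c a) = 0 by lra.
by ring.
Qed.

(** Only the vertex terms of the perturbation are negative. [face_control] bounds them by a small
    multiple of Z + L / eta, where Z is the weighted square norm and L the contribution of the
    moments: a large L pays for them directly, a small one makes them small against Z. *)
Lemma multiplier_positive_definite : \forall n \near \oo, forall u : I -> R,
  expR (- n%:R) / 4 * \sum_a u a ^+ 2 <=
  \sum_a \sum_b u a * u b * multiplier n (c a + c b).
Proof.
near=> n.
have n1 : 1 <= n%:R :> R by near: n; exact: nbhs_infty_ger.
have pertP : forall u : I -> R,
    (\sum_a (u a * weight n (c a)) ^+ 2) / 2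
      - 2 * \sum_(a | at_vertex (c a)) (u a * weight n (c a)) ^+ 2
    <= \sum_a \sum_b u a * u b * perturbation n (c a + c b).
  by near: n; exact: perturbation_lower_bound.
have ctlP : forall (F : 'I_5) (u : I -> R) (T : R),
    0 <= T -> (forall a, `|u a| * weight n (c a) <= T) ->
    (forall k, (k < n)%N ->
       `|\sum_a u a * expR (face_log n F k (c a))| <= T * expR (- (n%:R / 2))) ->
    expR (2 * ln n%:R) * `|vertex_sum u F + vertex_sum u (F + 1)| <= T / 20.
  by near: n; exact: face_control.
move=> u.
have ln0 : 0 <= ln n%:R :> R by apply: ln_ge0.
pose z a := u a * weight n (c a).
pose Z := \sum_a z a ^+ 2.
pose L := \sum_F \sum_(k < n) (\sum_a u a * expR (face_log n F k (c a))) ^+ 2.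
pose V := \sum_(a | at_vertex (c a)) z a ^+ 2.
set eta := expR (- n%:R); have eta0 : 0 < eta by exact: expR_gt0.
have Z0 : 0 <= Z by apply: sumr_ge0 => a _; exact: sqr_ge0.
have L0 : 0 <= L by apply: sumr_ge0 => F _; apply: sumr_ge0 => k _; exact: sqr_ge0.
have -> : \sum_a \sum_b u a * u b * multiplier n (c a + c b) =
    L + eta * \sum_a \sum_b u a * u b * perturbation n (c a + c b).
  rewrite /L -moment_gram mulr_sumr -big_split; apply: eq_bigr => a _.
  rewrite mulr_sumr -big_split; apply: eq_bigr => b _.
  by rewrite /multiplier /= -/eta; ring.
have pert : Z / 2 - 2 * V <= \sum_a \sum_b u a * u b * perturbation n (c a + c b).
  exact: pertP.
(* Both hypotheses of [face_control] now hold by construction: T^2 bounds each square of [z a], and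
   eta T^2 bounds the square of each evaluation occurring in L. *)
pose T := Num.sqrt (Z + L / eta).
have TT : T ^+ 2 = Z + L / eta by rewrite sqr_sqrtr // addr_ge0 // divr_ge0 // ltW.
have T0 : 0 <= T by exact: sqrtr_ge0.
have zT a : `|u a| * weight n (c a) <= T.
  have -> : `|u a| * weight n (c a) = `|z a|.
    by rewrite normrM [`|weight _ _|]ger0_norm // expR_ge0.
  rewrite -sqrtr_sqr ler_sqrt; last by rewrite addr_ge0 // divr_ge0 // ltW.
  apply: le_trans (_ : Z <= _); last by rewrite lerDl divr_ge0 // ltW.
  by rewrite /Z (bigD1 a) //= lerDl sumr_ge0 // => b _; exact: sqr_ge0.
have qT F k : (k < n)%N ->
    `|\sum_a u a * expR (face_log n F k (c a))| <= T * expR (- (n%:R / 2)).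
  move=> kn; set q := \sum_a _.
  have -> : expR (- (n%:R / 2)) = Num.sqrt eta.
    rewrite -[LHS]ger0_norm ?expR_ge0 // -sqrtr_sqr expr2 -expRD.
    by congr (Num.sqrt (expR _)); lra.
  rewrite -sqrtrM; last by rewrite addr_ge0 // divr_ge0 // ltW.
  rewrite -sqrtr_sqr ler_sqrt; last first.
    by rewrite mulr_ge0 ?(ltW eta0) // addr_ge0 // divr_ge0 // ltW.
  rewrite mulrDl divfK ?gt_eqF //.
  apply: le_trans (_ : L <= _); last by rewrite lerDr mulr_ge0 // ltW.
  rewrite /L (bigD1 F) //= (bigD1 (Ordinal kn)) //= -/q -addrA lerDl addr_ge0 //.
    by apply: sumr_ge0 => j _; exact: sqr_ge0.
  by apply: sumr_ge0 => G _; apply: sumr_ge0 => j _; exact: sqr_ge0.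
have ctl : forall F, expR (2 * ln n%:R) * `|vertex_sum u F + vertex_sum u (F + 1)| <= T / 20.
  by move=> F; apply: ctlP => // k; apply: qT.
set w2 := expR (2 * ln n%:R) in ctl; have w20 : 0 <= w2 by exact: expR_ge0.
(* Around the odd cycle, twice a vertex sum is an alternating sum of the five sums over adjacent
   vertices, hence at most 5 T / 20; this gives T / 8. *)
have vsT i : (w2 * vertex_sum u i) ^+ 2 <= T ^+ 2 / 64.
  have h i' : - (T / 20) <= w2 * vertex_sum u i' + w2 * vertex_sum u (i' + 1) <= T / 20.
    rewrite -ler_norml -mulrDr normrM (ger0_norm w20); exact: ctl.
  have := h i. have := h (i + 1). have := h (i + 2%:R). have := h (i + 3%:R).
  have := h (i + 4%:R).
  have -> : i + 4%:R + 1 = i :> 'I_5 by apply/val_inj; case: i => -[|[|[|[|[|m]]]]].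
  have -> : i + 3%:R + 1 = i + 4%:R :> 'I_5 by rewrite -addrA; congr (_ + _); apply/val_inj.
  have -> : i + 2%:R + 1 = i + 3%:R :> 'I_5 by rewrite -addrA; congr (_ + _); apply/val_inj.
  have -> : i + 1 + 1 = i + 2%:R :> 'I_5 by rewrite -addrA; congr (_ + _); apply/val_inj.
  move=> /andP[a4 b4] /andP[a3 b3] /andP[a2 b2] /andP[a1 b1] /andP[a0 b0].
  have v1 : `|w2 * vertex_sum u i| <= T / 8 by rewrite ler_norml; lra.
  rewrite -real_normK ?num_real // (_ : T ^+ 2 / 64 = (T / 8) ^+ 2); last by field.
  by apply: lerXn2r; rewrite ?nnegrE ?divr_ge0 //.
have Vle : V <= \sum_i (w2 * vertex_sum u i) ^+ 2.
  apply: le_trans (_ : \sum_a \sum_(i | sqn (c a - e i) == 0) z a ^+ 2 <= _).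
    rewrite /V big_mkcond /=; apply: ler_sum => a _.
    case: (boolP (at_vertex _)) => [/existsP[i ai]|_].
      by rewrite (bigD1 i) //= lerDl sumr_ge0 // => j _; exact: sqr_ge0.
    by apply: sumr_ge0 => j _; exact: sqr_ge0.
  rewrite (exchange_big_dep xpredT) //=; apply: ler_sum => i _.
  case: (pickP (fun a => sqn (c a - e i) == 0)) => [a ai|none]; last first.
    by rewrite big_pred0 // sqr_ge0.
  (* Separation leaves at most one class at each vertex, so that the vertex sum is a single
     coefficient. *)
  have uniq_a b : (sqn (c b - e i) == 0) = (b == a).
    have [->|ba] := eqVneq b a; first exact: ai.
    apply/negbTE/negP => /eqP bi; case/eqP: (c_sep ba).
    rewrite (_ : c b - c a = (c b - e i) - (c a - e i)); last by rewrite opprB addrA subrK.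
    by apply: sqn0B => //; apply/eqP.
  rewrite /vertex_sum !(big_pred1 a) // /z (weight_at_vertex n (i := i)); last exact/eqP.
  by rewrite mulrC.
have V5 : V <= 5 * (T ^+ 2 / 64).
  apply: (le_trans Vle); apply: le_trans (ler_sum _ (fun i _ => vsT i)) _.
  by rewrite sumr_const card_ord -[leLHS]mulr_natl.
have uZ : \sum_a u a ^+ 2 <= Z.
  apply: ler_sum => a _; rewrite /z exprMn ler_peMr ?sqr_ge0 // exprn_ege1 //.
  rewrite /weight -[X in X <= _]expR0 ler_expR addr_ge0 //.
    by rewrite !mulr_ge0 ?half_off_ge0 ?exprn_ge0.
  by rewrite !mulr_ge0 ?sqn_ge0.
have Le0 : 0 <= L / eta by rewrite divr_ge0 // ltW.
have main : Z / 4 - L / eta / 4 <= Z / 2 - 2 * V by move: V5; rewrite TT; lra.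
have e1 : eta * (Z / 4 - L / eta / 4) <=
    eta * \sum_a \sum_b u a * u b * perturbation n (c a + c b).
  by rewrite ler_wpM2l ?(ltW eta0) //; apply: le_trans main pert.
have e2 : eta * (Z / 4 - L / eta / 4) = eta * Z / 4 - L / 4.
  by field; rewrite gt_eqF.
have e3 : eta / 4 * \sum_a u a ^+ 2 <= eta / 4 * Z.
  have e40 : 0 <= eta / 4 by lra.
  exact: (ler_wpM2l e40 uZ).
lra.
Unshelve. all: by end_near. Qed.

End PositiveDefinite.

(** * The Horn form *)

(** Adjacency in the 5-cycle, tabulated so that its rotation symmetry is checked by evaluation. *)
Definition pentagon (i j : nat) : bool :=
  nth false (nth [::] [:: [:: false; true; false; false; true];
                          [:: true; false; true; false; false];
                          [:: false; true; false; true; false];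
                          [:: false; false; true; false; true];
                          [:: true; false; false; true; false]] i) j.

Definition horn (R : pzRingType) (i j : nat) : R := if pentagon i j then -1 else 1.

Lemma pentagon_rot (F i j : 'I_5) : pentagon (F + i)%R (F + j)%R = pentagon i j.
Proof.
by case: F i j => -[|[|[|[|[|m]]]]] F [[|[|[|[|[|m1]]]]] i] [[|[|[|[|[|m2]]]]] j].
Qed.

(** Rotation makes the identity available for every F. Copositivity picks F by the sign of the last
    bracket; the evaluation at near-zeros picks the face on which they lie. *)
Lemma horn_form (R : comNzRingType) (y : 'I_5 -> R) (F : 'I_5) :
  \sum_(i : 'I_5) \sum_(j : 'I_5) horn R i j * y i * y j =
  (y F - y (F + 1) + y (F + 2%:R) + y (F + 3%:R) - y (F + 4%:R)) ^+ 2
  + 4 * (y (F + 1) * y (F + 3%:R)) + 4 * (y (F + 2%:R) * (y (F + 4%:R) - y (F + 3%:R))).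
Proof.
pose z (i : 'I_5) := y (F + i).
rewrite (reindex_inj (addrI F)) /=.
rewrite (eq_bigr (fun i : 'I_5 => \sum_(j : 'I_5) horn R i j * z i * z j)); last first.
  move=> i _; rewrite (reindex_inj (addrI F)) /=; apply: eq_bigr => j _.
  by rewrite /horn pentagon_rot.
have -> : y F = z 0 by rewrite /z addr0.
rewrite -/(z 1) -/(z 2%:R) -/(z 3%:R) -/(z 4%:R).
rewrite (sum_ord5 0) !(sum_ord5 0) !add0r /horn /=; ring.
Qed.

(** y cannot decrease strictly all the way around the cycle, so for some F the last bracket in
    [horn_form] is nonnegative. *)
Lemma horn_copositive (R : realDomainType) (y : 'I_5 -> R) :
  (forall i, 0 <= y i) -> 0 <= \sum_(i : 'I_5) \sum_(j : 'I_5) horn R i j * y i * y j.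
Proof.
move=> y0.
have [F h] : exists F : 'I_5, y (F + 3%:R) <= y (F + 4%:R).
  apply: contrapT => /forallNP H.
  have h F : y (F + 4%:R) < y (F + 3%:R) by rewrite ltNge; apply/negP/H.
  have := h 0; have := h 1; have := h 2%:R; have := h 3%:R; have := h 4%:R.
  rewrite (_ : 4%:R + 4%:R = 3%:R :> 'I_5); last exact/val_inj.
  rewrite (_ : 4%:R + 3%:R = 2%:R :> 'I_5); last exact/val_inj.
  rewrite (_ : 3%:R + 4%:R = 2%:R :> 'I_5); last exact/val_inj.
  rewrite (_ : 3%:R + 3%:R = 1 :> 'I_5); last exact/val_inj.
  rewrite (_ : 2%:R + 4%:R = 1 :> 'I_5); last exact/val_inj.
  rewrite (_ : 2%:R + 3%:R = 0 :> 'I_5); last exact/val_inj.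
  rewrite (_ : 1 + 4%:R = 0 :> 'I_5); last exact/val_inj.
  rewrite (_ : 1 + 3%:R = 4%:R :> 'I_5); last exact/val_inj.
  by rewrite !add0r; lra.
by rewrite (horn_form y F) !addr_ge0 ?sqr_ge0 // !mulr_ge0 // subr_ge0.
Qed.

(** * Growth and Horn sum of the multiplier *)

Section Multiplier.
Variables (R : realType) (E : zmodType) (beta : E -> E -> R) (e : 'I_5 -> E).
Hypothesis betaC : forall x y, beta x y = beta y x.
Hypothesis betaD : forall x y z, beta (x + y) z = beta x z + beta y z.
Hypothesis beta_ge0 : forall x, 0 <= beta x x.
Hypothesis beta_e : forall i j, beta (e i) (e j) = (i == j)%:R.

Lemma multiplier_growth (x : E) : exists j : nat,
  \forall n \near \oo, `|multiplier beta e n x| <= expR (j%:R * n%:R ^+ 2).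
Proof.
pose A : R := \sum_i `|co beta e i x|.
pose B : R := 2 * off_simplex beta e x + sqn beta x.
have A0 : 0 <= A by apply: sumr_ge0.
have off0 : 0 <= off_simplex beta e x.
  rewrite /off_simplex addr_ge0 // sumr_ge0 // => i _.
  by rewrite divr_ge0 // subr_ge0 ler_norm.
have B0 : 0 <= B by rewrite addr_ge0 ?mulr_ge0 ?beta_ge0.
(* A bounds the exponents in [moment] and B that of the perturbation; 5 accounts for the 5 n
   summands of [moment], and 1 for adding the two parts. *)
have [j jAB] : exists j : nat, A + B + 6 <= j%:R.
  have [N _ HN] := @nbhs_infty_ger R (A + B + 6).
  by exists N; apply: (HN N) => /=.
exists j; near=> n.
have n1 : 1 <= n%:R :> R by near: n; exact: nbhs_infty_ger.
have n2 : n%:R <= n%:R ^+ 2 :> R by rewrite expr2 ler_peMr //; lra.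
have n0 : 0 <= n%:R ^+ 2 :> R by rewrite exprn_ge0.
have lnk (k : nat) : (k < n)%N -> (0 <= ln (k.+1%:R : R) <= n%:R ^+ 2) /\
    (0 <= ln (k.+2%:R : R) <= n%:R ^+ 2).
  move=> kn; have ln_le (m : nat) : (0 < m)%N -> (m <= n.+1)%N ->
      0 <= ln (m%:R : R) <= n%:R ^+ 2.
    move=> m0 mn; rewrite ln_ge0 ?ler1n //=; apply: le_trans n2.
    have := @le_ln1Dx R n%:R ltac:(lra); apply: le_trans.
    rewrite ler_ln ?posrE ?ltr0n //; last lra.
    by rewrite addrC natr1 ler_nat.
  by split; apply: ln_le => //; lia.
have flog F k : (k < n)%N -> face_log beta e n F k x <= A * n%:R ^+ 2.
  move=> kn; have [/andP[l1 l1'] /andP[l2 l2']] := lnk k kn.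
  have bound (c l : R) : 0 <= l <= n%:R ^+ 2 -> c * l <= `|c| * n%:R ^+ 2.
    move=> /andP[h1 h2]; apply: le_trans (_ : `|c| * l <= _).
      by rewrite ler_wpM2r // ler_norm.
    by rewrite ler_wpM2l.
  rewrite /face_log /A (sum_ord5 F).
  have h1 := bound (co beta e (F + 1) x) (ln k.+2%:R) ltac:(lra).
  have h2 := bound (co beta e (F + 2%:R) x) (ln k.+1%:R) ltac:(lra).
  have h3 := bound (- co beta e (F + 3%:R) x) (n%:R ^+ 2) ltac:(lra).
  have h4 := bound (- co beta e (F + 4%:R) x) (n%:R ^+ 2) ltac:(lra).
  have h5 : 0 <= `|co beta e F x| * n%:R ^+ 2 by rewrite mulr_ge0.
  rewrite normrN in h3; rewrite normrN in h4; lra.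
have m1 : `|moment beta e n x| <= expR ((A + 5) * n%:R ^+ 2).
  rewrite ger0_norm; last first.
    by apply: sumr_ge0 => F _; apply: sumr_ge0 => k _; exact: expR_ge0.
  apply: le_trans (_ : \sum_(F < 5) \sum_(k < n) expR (A * n%:R ^+ 2) <= _).
    apply: ler_sum => F _; apply: ler_sum => k _; rewrite ler_expR; exact: flog.
  rewrite !sumr_const !card_ord -mulrnA -[_ *+ (n * 5)]mulr_natl.
  rewrite (_ : expR ((A + 5) * n%:R ^+ 2) = expR (5 * n%:R ^+ 2) * expR (A * n%:R ^+ 2));
    last by rewrite -expRD; congr expR; ring.
  rewrite ler_wpM2r ?expR_ge0 // natrM; apply: le_trans (expR_ge1Dx _); lra.
have m2 : `|expR (- n%:R) * perturbation beta e n x| <= expR (B * n%:R ^+ 2).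
  rewrite /perturbation 2!normrM [X in _ * (X * _)](_ : _ = 1); last first.
    by case: ifP; rewrite ?normrN normr1.
  rewrite mul1r !ger0_norm ?expR_ge0 // -expRD ler_expR.
  have /andP[l0 l1] : 0 <= ln (n%:R : R) <= n%:R ^+ 2.
    rewrite ln_ge0 //=; apply: le_trans n2; apply: ltW; apply: ln_sublinear; lra.
  have : sqn beta x * ln n%:R <= sqn beta x * n%:R ^+ 2 by rewrite ler_wpM2l // beta_ge0.
  rewrite /B; lra.
apply: le_trans (ler_normD _ _) _; apply: le_trans (lerD m1 m2) _.
apply: le_trans (_ : expR ((A + B + 5) * n%:R ^+ 2) + expR ((A + B + 5) * n%:R ^+ 2) <= _).
  by rewrite lerD // ler_expR ler_wpM2r //; lra.
rewrite -mulr2n -[expR _ *+ 2]mulr_natl.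
apply: le_trans (_ : expR 1 * expR ((A + B + 5) * n%:R ^+ 2) <= _).
  by rewrite ler_wpM2r ?expR_ge0 //; have := @expR_ge1Dx R 1; lra.
rewrite -expRD ler_expR.
have : (A + B + 6) * n%:R ^+ 2 <= j%:R * n%:R ^+ 2 by rewrite ler_wpM2r.
lra.
Unshelve. all: by end_near. Qed.

(** At (1, k + 2, k + 1, w, w) the square in [horn_form] and the difference of the last two
    coordinates vanish; only 4 (k + 2) w is left. *)
Lemma sum_horn_moment (n : nat) :
  \sum_(i : 'I_5) \sum_(j : 'I_5) horn R i j * moment beta e n (e i + e j) =
  \sum_(F : 'I_5) \sum_(k < n) 4 * (k.+2%:R * expR (- n%:R ^+ 2)).
Proof.
under eq_bigr => i _.
  under eq_bigr => j _ do rewrite /moment mulr_sumr.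
  rewrite exchange_big /=.
  over.
rewrite exchange_big /=; apply: eq_bigr => F _.
under eq_bigr => i _.
  under eq_bigr => j _ do rewrite mulr_sumr.
  rewrite exchange_big /=.
  over.
rewrite exchange_big /=; apply: eq_bigr => k _.
pose y i := expR (face_log beta e n F k (e i)).
transitivity (\sum_(i : 'I_5) \sum_(j : 'I_5) horn R i j * y i * y j).
  apply: eq_bigr => i _; apply: eq_bigr => j _.
  by rewrite (face_logD e betaD) expRD mulrA.
rewrite (horn_form y F).
have yF : y F = 1.
  rewrite /y /face_log /co !beta_e !(eq_sym F) !ord5_cyc_neq0 //= !mulr0n.
  by rewrite !mul0r !addr0 mul0r subr0 expR0.
have y1 : y (F + 1) = k.+2%:R.
  rewrite /y /face_log /co !beta_e eqxx !ord5_cyc_neq //= !mulr0n.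
  by rewrite !mul0r !addr0 mul0r subr0 mul1r lnK // posrE.
have y2 : y (F + 2%:R) = k.+1%:R.
  rewrite /y /face_log /co !beta_e eqxx !ord5_cyc_neq //= !mulr0n.
  by rewrite !mul0r !addr0 mul0r subr0 add0r mul1r lnK // posrE.
have y3 : y (F + 3%:R) = expR (- n%:R ^+ 2).
  rewrite /y /face_log /co !beta_e eqxx !ord5_cyc_neq //= !mulr0n.
  by rewrite !mul0r !addr0 sub0r mul1r.
have y4 : y (F + 4%:R) = expR (- n%:R ^+ 2).
  rewrite /y /face_log /co !beta_e eqxx !ord5_cyc_neq //= !mulr0n.
  by rewrite !mul0r !addr0 sub0r add0r mul1r.
by rewrite yF y1 y2 y3 y4 -!natr1; ring.
Qed.

(** [sqn] is 4 on a doubled vertex and 2 on a sum of two distinct ones, so the perturbation is - n^4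
    on the diagonal and n^2 in absolute value elsewhere: its Horn sum is dominated by -5 n^4. The
    moments contribute only n^2 e^(-n^2) up to a constant, far below the factor e^(-n). *)
Lemma horn_multiplier_negative : \forall n \near \oo,
  \sum_(i : 'I_5) \sum_(j : 'I_5) horn R i j * multiplier beta e n (e i + e j)
    <= - expR (- n%:R).
Proof.
near=> n.
have n4 : 4 <= n%:R :> R by near: n; exact: nbhs_infty_ger.
have n0 : 0 < n%:R :> R by lra.
set eta := expR (- n%:R).
have eta0 : 0 < eta by exact: expR_gt0.
have coE i j k : co beta e k (e i + e j) = (i == k)%:R + (j == k)%:R.
  by rewrite /co betaD !beta_e.
have off0 i j : off_simplex beta e (e i + e j) = 0.
  rewrite /off_simplex big1 => [|k _]; last first.
    by rewrite coE ger0_norm ?addr_ge0 // subrr mul0r.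
  rewrite add0r (eq_bigr (fun k => (i == k)%:R + (j == k)%:R : R)) => [|k _]; last exact: coE.
  rewrite big_split /=.
  have one (l : 'I_5) : \sum_k (l == k)%:R = 1 :> R.
    rewrite (bigD1 l) //= eqxx big1 ?addr0 // => k kl.
    by rewrite eq_sym (negbTE kl).
  by rewrite !one (_ : 1 + 1 - 2 = 0) ?normr0 //; lra.
have sqnE i j : sqn beta (e i + e j) = 2 + 2 * (i == j)%:R.
  rewrite /sqn betaD !(betaC _ (e i + e j)) !betaD !beta_e !eqxx (eq_sym j i).
  by case: (i == j); rewrite ?mulr1n ?mulr0n; lra.
have powE (m : nat) : expR (m%:R * ln n%:R) = n%:R ^+ m :> R.
  by rewrite expRM_natl lnK // posrE.
have pert (i j : 'I_5) : horn R i j * perturbation beta e n (e i + e j) <=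
    (if j == i then - n%:R ^+ 4 else 0) + n%:R ^+ 2.
  rewrite /perturbation off0 mulr0 add0r sqnE.
  have [->|ji] := eqVneq j i.
    rewrite /= mulr1n mulr1 (_ : 2 + 2 = 4%:R :> R); last lra.
    rewrite powE (_ : vertex _ _ _ = true); last first.
      by apply/existsP; exists i; rewrite subrr /sqn (beta0 betaD).
    rewrite (_ : horn R i i = 1); last by rewrite /horn; case: i => -[|[|[|[|[|m]]]]].
    by have := sqr_ge0 (n%:R : R); lra.
  rewrite /= mulr0n mulr0 addr0 add0r powE.
  apply: le_trans (ler_norm _) _.
  rewrite normrM normrM (_ : `|horn R i j| = 1); last first.
    by rewrite /horn; case: ifP; rewrite ?normrN normr1.
  rewrite (_ : `|if _ then _ else _| = 1); last by case: ifP; rewrite ?normrN normr1.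
  by rewrite !mul1r ger0_norm ?sqr_ge0.
have -> : \sum_(i : 'I_5) \sum_(j : 'I_5) horn R i j * multiplier beta e n (e i + e j) =
  \sum_(i : 'I_5) \sum_(j : 'I_5) horn R i j * moment beta e n (e i + e j) +
  eta * \sum_(i : 'I_5) \sum_(j : 'I_5) horn R i j * perturbation beta e n (e i + e j).
  rewrite mulr_sumr -big_split; apply: eq_bigr => i _.
  rewrite mulr_sumr -big_split; apply: eq_bigr => j _.
  by rewrite /multiplier /= -/eta; ring.
rewrite sum_horn_moment.
have s1 : \sum_(F : 'I_5) \sum_(k < n) 4 * (k.+2%:R * expR (- n%:R ^+ 2)) <=
    20 * n%:R * (n%:R + 1) * eta.
  apply: le_trans (_ : \sum_(F : 'I_5) \sum_(k < n) 4 * ((n%:R + 1) * eta) <= _).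
    apply: ler_sum => F _; apply: ler_sum => k _; rewrite ler_wpM2l //.
    rewrite ler_pM ?expR_ge0 //; first by rewrite natr1 ler_nat ltnS ltn_ord.
    by rewrite ler_expR lerN2 expr2 ler_peMr //; lra.
  by rewrite !sumr_const !card_ord -mulrnA -[_ *+ (n * 5)]mulr_natl natrM; lra.
have s2 : \sum_(i : 'I_5) \sum_(j : 'I_5) horn R i j * perturbation beta e n (e i + e j) <=
    25 * n%:R ^+ 2 - 5 * n%:R ^+ 4.
  apply: le_trans (ler_sum _ (fun i _ => ler_sum _ (fun j _ => pert i j))) _.
  rewrite (eq_bigr (fun=> - n%:R ^+ 4 + 5 * n%:R ^+ 2)); last first.
    move=> i _; rewrite big_split /= -big_mkcond big_pred1_eq sumr_const card_ord.
    by rewrite -[_ *+ 5]mulr_natl.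
  by rewrite sumr_const card_ord -[_ *+ 5]mulr_natl; lra.
have key : 20 * n%:R * (n%:R + 1) + (25 * n%:R ^+ 2 - 5 * n%:R ^+ 4) <= -1 :> R.
  have q : 16 * n%:R ^+ 2 <= n%:R ^+ 4 :> R.
    rewrite (_ : n%:R ^+ 4 = n%:R ^+ 2 * n%:R ^+ 2); last by rewrite -exprD.
    rewrite ler_wpM2r ?sqr_ge0 //.
    by rewrite (_ : 16 = 4 ^+ 2) ?lerXn2r ?nnegrE //; lra.
  have q1 : 4 * n%:R <= n%:R ^+ 2 :> R by rewrite expr2 ler_wpM2r // ltW.
  by have : n%:R * n%:R = n%:R ^+ 2 :> R by []; lra.
have : eta * (\sum_(i : 'I_5) \sum_(j : 'I_5) horn R i j * perturbation beta e n (e i + e j))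
    <= eta * (25 * n%:R ^+ 2 - 5 * n%:R ^+ 4) by rewrite ler_pM2l.
have : eta * (20 * n%:R * (n%:R + 1) + (25 * n%:R ^+ 2 - 5 * n%:R ^+ 4)) <= eta * -1.
  by rewrite ler_pM2l.
lra.
Unshelve. all: by end_near. Qed.

End Multiplier.

(** * A bilinear form modulo finite elements *)

Section FiniteElements.
Variable R : realType.
Local Notation S := (hyper R).
Local Notation emb := (@emb R).

Definition fin (x : S) : Prop := exists j : R, `|x| <= emb j.

Lemma fin_emb r : fin (emb r).
Proof. by exists `|r|; rewrite ler_norml -raddfN !emb_le; rewrite -ler_norml. Qed.

Lemma fin0 : fin 0. Proof. by rewrite -(rmorph0 emb); exact: fin_emb. Qed.

Lemma finD x y : fin x -> fin y -> fin (x + y).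
Proof.
move=> [j hj] [k hk]; exists (j + k); rewrite rmorphD.
by apply: le_trans (ler_normD _ _) _; rewrite lerD.
Qed.

Lemma finM x y : fin x -> fin y -> fin (x * y).
Proof.
move=> [j hj] [k hk]; exists (j * k); rewrite rmorphM normrM.
by rewrite ler_pM.
Qed.

Lemma finZ r x : fin x -> fin (emb r * x).
Proof. by move=> hx; apply: finM => //; exact: fin_emb. Qed.

Lemma finN x : fin x -> fin (- x).
Proof. by move=> [j hj]; exists j; rewrite normrN. Qed.

Lemma finB x y : fin x -> fin y -> fin (x - y).
Proof. by move=> hx hy; apply: finD => //; exact: finN. Qed.

Definition hyper_nat : S := cls (fun n => n%:R).

Lemma hyper_nat_gt r : emb r < hyper_nat.
Proof.
apply/rp_lt; apply: ev_mono2 (rp_emb r) (ev_and (clsK (fun n => n%:R : R)) _).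
  move=> n -> [-> h]; exact: h.
by apply: ev_oo; near=> n; near: n; exact: nbhs_infty_gtr.
Unshelve. all: by end_near. Qed.

Lemma hyper_nat_gt0 : 0 < hyper_nat.
Proof. by rewrite -(rmorph0 emb) hyper_nat_gt. Qed.

(** If p X + c has an infinitesimal value, the value of p is a finite element divided by an infinite
    one; so p is zero by induction, and then c is infinitesimal, hence zero. *)
Lemma hyper_nat_poly (p : {poly R}) :
  (forall r, 0 < r -> `|(map_poly emb p).[hyper_nat]| <= emb r) -> p = 0.
Proof.
elim/poly_ind: p => // p c IH H.
have E : (map_poly emb (p * 'X + c%:P)).[hyper_nat] =
    (map_poly emb p).[hyper_nat] * hyper_nat + emb c.
  by rewrite rmorphD rmorphM /= map_polyX map_polyC !hornerE.
rewrite E in H.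
have p0 : p = 0.
  apply: IH => r r0; rewrite -(ler_pM2r hyper_nat_gt0).
  rewrite -[X in _ * X <= _]ger0_norm ?(ltW hyper_nat_gt0) // -normrM.
  apply: le_trans (_ : emb (1 + `|c|) <= _).
    rewrite rmorphD -[X in `|X|](addrK (emb c)).
    apply: le_trans (ler_normB _ _) _; rewrite lerD //; first exact: H.
    by rewrite ler_norml -raddfN !emb_le -ler_norml.
  rewrite -ler_pdivrMl ?emb_gt0 //.
  rewrite -fmorphV -rmorphM; apply: ltW; exact: hyper_nat_gt.
have c0 : c = 0.
  move: H; rewrite p0 rmorph0 horner0 mul0r add0r => H.
  apply/eqP; rewrite -normr_le0; apply/ler_addgt0Pr => r r0; rewrite add0r.
  have := H r r0; rewrite ler_norml -raddfN !emb_le -ler_norml //.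
by rewrite p0 c0 mul0r add0r.
Qed.

(** The exponents start at 1 because 1 itself is finite: distinct positive powers of an infinite
    element are independent modulo finite elements. *)
Definition base (i : nat) : S := hyper_nat ^+ i.+1.

Lemma base_indep (c : 'I_5 -> R) :
  fin (\sum_(i : 'I_5) emb (c i) * base i) -> forall i, c i = 0.
Proof.
move=> [j hj].
pose p : {poly R} := \poly_(i < 5) c (inord i).
have pE : \sum_(i : 'I_5) emb (c i) * base i = (map_poly emb p).[hyper_nat] * hyper_nat.
  rewrite (horner_coef_wide (n := 5)); last first.
    by rewrite size_map_poly; exact: size_poly.
  rewrite mulr_suml; apply: eq_bigr => i _.
  by rewrite coef_map coef_poly ltn_ord inord_val /base exprSr mulrA.
have : p = 0.
  apply: hyper_nat_poly => r r0; rewrite -(ler_pM2r hyper_nat_gt0).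
  rewrite -[X in _ * X <= _]ger0_norm ?(ltW hyper_nat_gt0) // -normrM -pE.
  apply: (le_trans hj); rewrite -ler_pdivrMl ?emb_gt0 //.
  rewrite -fmorphV -rmorphM; apply: ltW; exact: hyper_nat_gt.
move=> p0 i; have := congr1 (fun q : {poly R} => q`_i) p0.
by rewrite coef_poly ltn_ord inord_val coef0.
Qed.

(* Graph of a partial bilinear form: (x, y, a) says that the value at (x, y) is a. *)
Definition form_graph := set (S * S * R).

Definition in_dom (G : form_graph) x := exists a, G (x, x, a).

(** The condition that a null vector is finite, with its converse, makes the form an inner product
    on its domain modulo [fin], with the five directions of the Horn form orthonormal. *)
Definition good_form (G : form_graph) : Prop :=
  [/\ [/\ forall x y a b, G (x, y, a) -> G (x, y, b) -> a = b,
          forall x y a, G (x, y, a) -> G (y, x, a),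
          forall x y a, G (x, y, a) -> in_dom G x &
          forall x y, in_dom G x -> in_dom G y -> exists a, G (x, y, a)],
      forall r x y z a b, G (x, z, a) -> G (y, z, b) -> G (emb r * x + y, z, r * a + b),
      forall x a, G (x, x, a) -> 0 <= a /\ (a = 0 -> fin x),
      forall x, fin x -> G (x, x, 0) &
      forall i j : 'I_5, G (base i, base j, (i == j)%:R)].

Definition base_form : form_graph := [set p | exists r s : 'I_5 -> R,
  [/\ fin (p.1.1 - \sum_(i : 'I_5) emb (r i) * base i),
      fin (p.1.2 - \sum_(i : 'I_5) emb (s i) * base i) & p.2 = \sum_i r i * s i]].

Lemma base_rep_uniq x (r s : 'I_5 -> R) :
  fin (x - \sum_(i : 'I_5) emb (r i) * base i) ->
  fin (x - \sum_(i : 'I_5) emb (s i) * base i) -> r =1 s.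
Proof.
move=> hr hs i; apply/eqP; rewrite -subr_eq0; apply/eqP.
apply: (base_indep (c := fun i => r i - s i)).
have := finB hs hr; rewrite opprB addrC addrA subrK -sumrB.
by under eq_bigr do rewrite -mulrBl -rmorphB.
Qed.

Lemma base_form_good : good_form base_form.
Proof.
split; first split.
- move=> x y a b [r [s [/= h1 h2 ->]]] [r' [s' [/= h1' h2' ->]]].
  apply: eq_bigr => i _; rewrite (base_rep_uniq h1 h1') (base_rep_uniq h2 h2') //.
- move=> x y a [r [s [/= h1 h2 ->]]]; exists s, r; split=> //=.
  by apply: eq_bigr => i _; rewrite mulrC.
- by move=> x y a [r [s [/= h1 h2 _]]]; exists (\sum_i r i * r i), r, r.
- move=> x y [a [r [_ [/= h1 _ _]]]] [b [s [_ [/= h2 _ _]]]].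
  by exists (\sum_i r i * s i), r, s.
- move=> t x y z a b [r [s [/= h1 h2 ->]]] [r' [s' [/= h1' h2' ->]]].
  exists (fun i => t * r i + r' i), s; split=> //=.
    have := finD (finZ t h1) h1'; congr (fin _).
    rewrite mulrBr addrACA -opprD; congr (_ - _).
    rewrite mulr_sumr -big_split /=; apply: eq_bigr => i _.
    by rewrite rmorphD rmorphM mulrDl mulrA.
  rewrite mulr_sumr -big_split /=; apply: eq_bigr => i _.
  by rewrite (base_rep_uniq h2' h2); ring.
- move=> x a [r [s [/= h1 h2 ->]]].
  have rs : \sum_i r i * s i = \sum_i r i ^+ 2.
    by apply: eq_bigr => i _; rewrite (base_rep_uniq h2 h1) expr2.
  rewrite rs; split; first by apply: sumr_ge0 => i _; exact: sqr_ge0.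
  move=> /eqP; rewrite psumr_eq0 => [/allP r0|i _]; last exact: sqr_ge0.
  move: h1; rewrite big1 ?subr0 // => i _.
  have := r0 i (mem_index_enum i); rewrite /= sqrf_eq0 => /eqP ->.
  by rewrite rmorph0 mul0r.
- move=> x fx; exists (fun=> 0), (fun=> 0); split=> /=.
  + by rewrite big1 ?subr0 // => i _; rewrite rmorph0 mul0r.
  + by rewrite big1 ?subr0 // => i _; rewrite rmorph0 mul0r.
  + by rewrite big1 // => i _; rewrite mul0r.
- have single (i : 'I_5) : \sum_(k : 'I_5) emb (i == k)%:R * base k = base i.
    rewrite (bigD1 i) //= eqxx rmorph1 mul1r big1 ?addr0 // => k ki.
    by rewrite eq_sym (negbTE ki) rmorph0 mul0r.
  move=> i j; exists (fun k => (i == k)%:R), (fun k => (j == k)%:R); split=> /=.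
  + by rewrite single subrr; exact: fin0.
  + by rewrite single subrr; exact: fin0.
  + rewrite (bigD1 i) //= eqxx mul1r big1 ?addr0 1?eq_sym // => k ki.
    by rewrite eq_sym (negbTE ki) mul0r.
Qed.

Lemma good_form_bigcup (F : set form_graph) : F !=set0 ->
  F `<=` good_form -> total_on F subset -> good_form (\bigcup_(X in F) X).
Proof.
move=> [X0 FX0] Fgood Ftot.
have two p q : (\bigcup_(X in F) X) p -> (\bigcup_(X in F) X) q ->
    exists X, [/\ F X, good_form X, X p & X q].
  move=> [X FX Xp] [Y FY Yq]; case: (Ftot X Y FX FY) => sub.
    by exists Y; split=> //; [exact: Fgood|exact: sub].
  by exists X; split=> //; [exact: Fgood|exact: sub].
split; first split.
- move=> x y a b p q; have [X [_ [[u _ _ _] _ _ _ _] Xp Xq]] := two _ _ p q.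
  exact: u Xp Xq.
- move=> x y a [X FX Xp]; exists X => //; have [[_ c _ _] _ _ _ _] := Fgood X FX.
  exact: c.
- move=> x y a [X FX Xp]; have [[_ _ d _] _ _ _ _] := Fgood X FX.
  by have [b Xb] := d _ _ _ Xp; exists b, X.
- move=> x y [a p] [b q]; have [X [FX [[_ _ _ t] _ _ _ _] Xp Xq]] := two _ _ p q.
  have [|| g Xg] := t x y; [by exists a|by exists b|].
  by exists g, X.
- move=> r x y z a b p q; have [X [FX [_ l _ _ _] Xp Xq]] := two _ _ p q.
  by exists X => //; exact: l.
- move=> x a [X FX Xp]; have [_ _ h _ _] := Fgood X FX; exact: h.
- move=> x fx; exists X0 => //; have [_ _ _ h _] := Fgood X0 FX0; exact: h.
- move=> i j; exists X0 => //; have [_ _ _ _ h] := Fgood X0 FX0; exact: h.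
Qed.

Lemma in_dom_lin G r x y :
  good_form G -> in_dom G x -> in_dom G y -> in_dom G (emb r * x + y).
Proof.
move=> [[_ _ d t] l _ _ _] dx dy.
have [a xy] := t x y dx dy; have [b yy] := dy.
exact: d (l r _ _ _ _ _ xy yy).
Qed.

(** The new vector gets norm 1 and is orthogonal to the old domain, so that no new null vectors
    appear. *)
Definition extend_form (G : form_graph) (x0 : S) : form_graph :=
  [set p | exists x y a r s, G (x, y, a) /\
     p = (x + emb r * x0, y + emb s * x0, a + r * s)].

Lemma extend_form_good G x0 : good_form G -> ~ in_dom G x0 -> good_form (extend_form G x0).
Proof.
move=> gG x0G; have [[u c d t] l pos f b] := gG.
have G00 : G (0, 0, 0) by apply: f; exact: fin0.
have d0 : in_dom G 0 by exists 0.
have uniq x r y s : in_dom G x -> in_dom G y -> x + emb r * x0 = y + emb s * x0 ->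
    x = y /\ r = s.
  move=> dx dy e; have [rs|rs] := eqVneq r s.
    by split=> //; move: e; rewrite rs => /addIr.
  case: x0G; have rs0 : emb (r - s) != 0 by rewrite fmorph_eq0 subr_eq0.
  have -> : x0 = emb ((r - s)^-1) * (emb (-1) * x + y) + 0.
    rewrite addr0 fmorphV; apply: (mulfI rs0); rewrite mulVKf //.
    rewrite rmorphB rmorphN1 mulN1r.
    have := congr1 (fun z => z - x - emb s * x0) e.
    by rewrite /= (addrC x) addrK addrAC addrK mulrBl addrC => ->.
  by apply: in_dom_lin => //; exact: in_dom_lin.
have dl x y a : G (x, y, a) -> in_dom G x by exact: d.
have dr x y a : G (x, y, a) -> in_dom G y by move=> /c; exact: d.
split; first split.
- move=> X Y a a' [x [y [a1 [r [s [p [-> -> ->]]]]]]] [x' [y' [a1' [r' [s' [p' [e1 e2 ->]]]]]]].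
  have [ex er] := uniq _ _ _ _ (dl _ _ _ p) (dl _ _ _ p') e1.
  have [ey es] := uniq _ _ _ _ (dr _ _ _ p) (dr _ _ _ p') e2.
  by subst; rewrite (u _ _ _ _ p p').
- move=> X Y a [x [y [a1 [r [s [p [-> -> ->]]]]]]].
  by exists y, x, a1, s, r; split; [exact: c|rewrite (mulrC r s)].
- move=> X Y a [x [y [a1 [r [s [p [-> _ _]]]]]]].
  by have [g xg] := dl _ _ _ p; exists (g + r * r), x, x, g, r, r.
- move=> X Y [a [x [x' [a1 [r [r' [p [-> _ _]]]]]]]] [a' [y [y' [a2 [s [s' [q [-> _ _]]]]]]]].
  have [g xy] := t _ _ (dl _ _ _ p) (dl _ _ _ q).
  by exists (g + r * s), x, y, g, r, s.
- move=> w X Y Z a a' [x [z [a1 [r [s [p [-> -> ->]]]]]]] [y [z' [a1' [r' [s' [p' [-> e ->]]]]]]].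
  have [ez es] := uniq _ _ _ _ (dr _ _ _ p) (dr _ _ _ p') e; subst.
  exists (emb w * x + y), z', (w * a1 + a1'), (w * r + r'), s'; split; first exact: l.
  by congr (_, _, _); rewrite ?rmorphD ?rmorphM; ring.
- move=> X a [x [y [a1 [r [s [p [-> e ->]]]]]]].
  have [ex er] := uniq _ _ _ _ (dl _ _ _ p) (dr _ _ _ p) e; subst.
  have [p0 pf] := pos _ _ p; have s0 := sqr_ge0 s; rewrite -expr2.
  split=> [|e0]; first lra.
  have /eqP : s ^+ 2 = 0 by lra.
  rewrite sqrf_eq0 => /eqP ->; rewrite rmorph0 mul0r addr0; apply: pf; lra.
- move=> x fx; exists x, x, 0, 0, 0; split; first exact: f.
  by rewrite rmorph0 !mul0r !addr0.
- move=> i j; exists (base i), (base j), (i == j)%:R, 0, 0; split; first exact: b.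
  by rewrite rmorph0 !mul0r !addr0.
Qed.

Lemma hyper_form : exists beta : S -> S -> R,
  [/\ forall x y, beta x y = beta y x,
      forall x y z, beta (x + y) z = beta x z + beta y z,
      forall x, 0 <= beta x x,
      forall x, beta x x = 0 <-> fin x &
      forall i j : 'I_5, beta (base i) (base j) = (i == j)%:R].
Proof.
have [F Fsub Ftot|G [GP Gmax]] := @Zorn_bigcup _ (fun G => G = set0 \/ good_form G).
  have [[X FX X0]|none] := pselect (exists2 X, F X & X <> set0); last first.
    left; rewrite bigcup0 // => X FX; apply: contrapT => X0.
    by apply: none; exists X.
  right; have -> : \bigcup_(X in F) X = \bigcup_(X in F `&` [set X | X <> set0]) X.
    apply/seteqP; split=> p [Y FY Yp]; last by exists Y => //; case: FY.
    by exists Y => //; split=> //= Y0; rewrite Y0 in Yp.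
  apply: good_form_bigcup.
  - by exists X.
  - by move=> Y [FY Y0]; case: (Fsub Y FY).
  - by move=> Y Z [FY _] [FZ _]; exact: Ftot.
have gG : good_form G.
  case: GP => // G0; case: (Gmax base_form); last by right; exact: base_form_good.
  rewrite G0; split; first exact: sub0set.
  move=> /(_ (0, 0, 0)); apply.
  by have [_ _ _ f _] := base_form_good; apply: f; exact: fin0.
have domT x : in_dom G x.
  apply: contrapT => xG; apply: (Gmax (extend_form G x)); last first.
    by right; exact: extend_form_good.
  have [_ _ _ f _] := gG.
  split; last first.
    move=> sub; apply: xG; exists (0 + 1 * 1); apply: sub.
    exists 0, 0, 0, 1, 1; split; first exact/f/fin0.
    by rewrite rmorph1 !mul1r !add0r.
  move=> [[y z] a] Gp; exists y, z, a, 0, 0; split=> //.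
  by rewrite rmorph0 !mul0r !addr0.
have [[u c d t] l pos f b] := gG.
have tot p : exists a, G (p.1, p.2, a) by exact: t.
have [bt btE] := choice tot.
exists (fun x y => bt (x, y)); split.
- by move=> x y; apply: u (btE (x, y)) _; apply: c; exact: (btE (_, _)).
- move=> x y z; have := l 1 _ _ _ _ _ (btE (x, z)) (btE (y, z)).
  by rewrite rmorph1 !mul1r; apply: u; exact: (btE (_, _)).
- by move=> x; have [] := pos _ _ (btE (x, x)).
- move=> x; have [_ h] := pos _ _ (btE (x, x)); split; first exact: h.
  by move=> fx; apply: u (btE (x, x)) _; exact: f.
- by move=> i j; apply: u (btE (_, _)) _; exact: b.
Qed.

End FiniteElements.

(** * Bounded and negligible elements *)

Section Valuation.
Variable R : realType.
Local Notation S := (hyper R).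
Local Notation emb := (@emb R).

Definition tau : S := cls (fun n => expR (n%:R ^+ 2)).

Lemma tau_gt r : emb r < tau.
Proof.
apply/rp_lt; apply: ev_mono2 (rp_emb r) (ev_and (clsK (fun n => expR (n%:R ^+ 2) : R)) _).
  move=> n -> [-> h]; exact: h.
apply: ev_oo; near=> n.
have n1 : 1 <= n%:R :> R by near: n; exact: nbhs_infty_ger.
apply: lt_le_trans (_ : n%:R <= _); first by near: n; exact: nbhs_infty_gtr.
apply: le_trans (_ : n%:R ^+ 2 <= _); first by rewrite expr2 ler_peMr //; lra.
by have := expR_ge1Dx (n%:R ^+ 2 : R); lra.
Unshelve. all: by end_near. Qed.

Lemma tau_gt_nat (k : nat) : k%:R < tau.
Proof. by rewrite -(rmorph_nat emb) tau_gt. Qed.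

Lemma tau_gt0 : 0 < tau. Proof. exact: (tau_gt_nat 0). Qed.
Lemma tau_ge1 : 1 <= tau. Proof. exact/ltW/(tau_gt_nat 1). Qed.
Lemma tauX_gt0 j : 0 < tau ^+ j. Proof. by rewrite exprn_gt0 // tau_gt0. Qed.

Lemma tauX_homo i j : (i <= j)%N -> tau ^+ i <= tau ^+ j.
Proof. by move=> ij; rewrite ler_weXn2l // tau_ge1. Qed.

Definition bdd (x : S) : Prop := exists j : nat, `|x| <= tau ^+ j.
Definition negl (x : S) : Prop := forall j : nat, `|x| * tau ^+ j <= 1.

Lemma fin_bdd x : fin x -> bdd x.
Proof. by move=> [j hj]; exists 1%N; rewrite expr1; apply/ltW/(le_lt_trans hj)/tau_gt. Qed.

Lemma bdd_emb r : bdd (emb r). Proof. exact/fin_bdd/fin_emb. Qed.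
Lemma bdd0 : bdd 0. Proof. by rewrite -(rmorph0 emb); exact: bdd_emb. Qed.
Lemma bdd1 : bdd 1. Proof. by rewrite -(rmorph1 emb); exact: bdd_emb. Qed.

Lemma bddD x y : bdd x -> bdd y -> bdd (x + y).
Proof.
move=> [j hj] [k hk]; exists (maxn j k).+1.
apply: le_trans (ler_normD _ _) _; rewrite exprS.
apply: le_trans (_ : 2%:R * tau ^+ maxn j k <= _); last first.
  by rewrite ler_wpM2r ?(ltW (tauX_gt0 _)) // ltW // tau_gt_nat.
rewrite mulr_natl mulr2n lerD //.
  by apply: le_trans hj _; apply: tauX_homo; exact: leq_maxl.
by apply: le_trans hk _; apply: tauX_homo; exact: leq_maxr.
Qed.

Lemma bddM x y : bdd x -> bdd y -> bdd (x * y).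
Proof. by move=> [j hj] [k hk]; exists (j + k)%N; rewrite normrM exprD ler_pM. Qed.

Lemma bddN x : bdd x -> bdd (- x).
Proof. by move=> [j hj]; exists j; rewrite normrN. Qed.

Lemma bddX x n : bdd x -> bdd (x ^+ n).
Proof. by move=> hx; elim: n => [|n IH]; [exact: bdd1|rewrite exprS; exact: bddM]. Qed.

Lemma bdd_sum (I : Type) (s : seq I) (P : pred I) (F : I -> S) :
  (forall i, P i -> bdd (F i)) -> bdd (\sum_(i <- s | P i) F i).
Proof. by move=> H; elim/big_ind: _ => // [|x y]; [exact: bdd0|exact: bddD]. Qed.

Lemma bdd_le x y : `|x| <= `|y| -> bdd y -> bdd x.
Proof. by move=> xy [j hj]; exists j; exact: le_trans hj. Qed.

Lemma negl0 : negl 0. Proof. by move=> j; rewrite normr0 mul0r. Qed.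

Lemma negl_le x y : `|x| <= `|y| -> negl y -> negl x.
Proof.
move=> xy hy j; apply: le_trans (hy j).
by rewrite ler_wpM2r // ltW // tauX_gt0.
Qed.

Lemma neglN x : negl x -> negl (- x).
Proof. by move=> hx j; rewrite normrN. Qed.

Lemma neglD x y : negl x -> negl y -> negl (x + y).
Proof.
move=> hx hy j; rewrite -(ler_pM2r tau_gt0) -mulrA -exprSr mul1r.
apply: le_trans (_ : 2%:R <= _); last by apply/ltW/tau_gt_nat.
apply: le_trans (_ : (`|x| + `|y|) * tau ^+ j.+1 <= _).
  by rewrite ler_wpM2r ?(ltW (tauX_gt0 _)) // ler_normD.
by rewrite mulrDl (_ : 2%:R = 1 + 1) // lerD.
Qed.

Lemma negl_sum (I : Type) (s : seq I) (P : pred I) (F : I -> S) :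
  (forall i, P i -> negl (F i)) -> negl (\sum_(i <- s | P i) F i).
Proof. by move=> H; elim/big_ind: _ => // [|x y]; [exact: negl0|exact: neglD]. Qed.

Lemma neglMr x y : bdd x -> negl y -> negl (x * y).
Proof.
move=> [k hk] hy j; rewrite normrM; apply: le_trans (hy (k + j)%N).
rewrite exprD -mulrA [leRHS]mulrCA ler_wpM2r //.
by rewrite mulr_ge0 // ltW // tauX_gt0.
Qed.

Lemma neglMl x y : negl x -> bdd y -> negl (x * y).
Proof. by move=> hx hy; rewrite mulrC; exact: neglMr. Qed.

Lemma negl_bdd x : negl x -> bdd x.
Proof. by move=> /(_ 0%N); rewrite expr0 mulr1 => hx; exists 0%N; rewrite expr0. Qed.

Lemma negl_small x r : negl x -> 0 < r -> `|x| <= emb r.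
Proof.
move=> hx r0; have e0 : 0 < emb r by rewrite emb_gt0.
have := hx 1%N; rewrite expr1 => h.
rewrite -(ler_pM2r tau_gt0); apply: (le_trans h).
by rewrite -ler_pdivrMl // mulr1 -fmorphV ltW // tau_gt.
Qed.

Lemma negl1 : ~ negl 1.
Proof. by move=> /(_ 1%N); rewrite normr1 mul1r expr1 leNgt (tau_gt_nat 1). Qed.

(** This makes [bdd] a valuation ring with maximal ideal [negl]: an inverse above every power of
    [tau] means an element below every negative power. *)
Lemma bdd_or_negl x : bdd (x^-1) \/ negl x.
Proof.
have [|nb] := pselect (bdd x^-1); [by left|right=> j].
have [->|x0] := eqVneq x 0; first by rewrite normr0 mul0r.
rewrite leNgt; apply/negP => h; apply: nb; exists j.
rewrite normfV; apply: ltW; rewrite invf_plt ?posrE ?normr_gt0 ?tauX_gt0 //.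
by rewrite -(ltr_pM2r (tauX_gt0 j)) mulVf ?gt_eqF ?tauX_gt0.
Qed.

Lemma negl_inv x : negl x -> bdd x^-1 -> x = 0.
Proof.
move=> hx hi; apply: contrapT => /eqP x0; apply: negl1.
by rewrite -(divff x0); exact: neglMl.
Qed.

Lemma rpX (x : S) (j : nat) : ev (fun n => rp (x ^+ j) n = rp x n ^+ j).
Proof.
elim: j => [|j IH]; first exact: rp1.
by rewrite exprS; apply: ev_mono2 IH (rpM x (x ^+ j)) => n e ->; rewrite e exprS.
Qed.

Lemma rp_horner (p : {poly S}) : exists q : nat -> {poly R}, forall x,
  ev (fun n => rp p.[x] n = (q n).[rp x n]).
Proof.
exists (fun n => \poly_(i < size p) rp p`_i n) => x.
rewrite horner_coef.
have h1 := rp_sum (index_enum 'I_(size p)) (fun i : 'I_(size p) => p`_i * x ^+ i).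
have h2 := @ev_fin 'I_(size p) (fun i n => rp (p`_i * x ^+ i) n = rp p`_i n * rp x n ^+ i)
  (fun i => ev_mono2 (fun n e1 e2 => etrans e2 (congr1 _ e1)) (rpX x i) (rpM p`_i (x ^+ i))).
apply: ev_mono2 h1 h2 => n -> e; rewrite horner_poly.
by apply: eq_bigr => i _; rewrite e.
Qed.

(** Transfer: the real intermediate value theorem gives a root in almost every coordinate, and a
    choice of these roots is the root in S. *)
Lemma hyper_ivt (p : {poly S}) (a b : S) : a <= b -> p.[a] <= 0 -> 0 <= p.[b] ->
  exists x, [/\ a <= x, x <= b & p.[x] = 0].
Proof.
move=> /rp_le ab /rp_le pa /rp_le pb; have [q qE] := rp_horner p.
pose P n x := [/\ rp a n <= x, x <= rp b n & (q n).[x] = 0].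
have : exists x : nat -> R, forall n, (exists y, P n y) -> P n (x n).
  have /choice[f fP] : forall n, exists x, (exists y, P n y) -> P n x.
    move=> n; have [[y Py]|none] := pselect (exists y, P n y); first by exists y.
    by exists 0 => -[y Py]; case: none; exists y.
  by exists f.
move=> [x xP].
have evP : ev (fun n => P n (x n)).
  apply: ev_mono2 (ev_and ab (ev_and pa pb)) (ev_and (rp0 R) (ev_and (qE a) (qE b))).
  move=> n [h1 [h2 h3]] [e0 [e1 e2]]; apply: xP.
  rewrite e0 e1 in h2; rewrite e0 e2 in h3.
  have [|y /andP[y1 y2] /rootP y3] := @poly_ivt R (q n) (rp a n) (rp b n) h1.
    by rewrite h2 h3.
  by exists y.
exists (cls x); split.
- by apply/rp_le; apply: ev_mono2 evP (clsK x) => n [h _ _] ->.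
- by apply/rp_le; apply: ev_mono2 evP (clsK x) => n [_ h _] ->.
- apply/rpE; apply: ev_mono2 (ev_and evP (clsK x)) (ev_and (qE (cls x)) (rp0 R)).
  by move=> n [[_ _ h] e] [-> ->]; rewrite e.
Qed.

(** * Bounded polynomials and Hensel's lemma *)

Definition bdd_poly (p : {poly S}) : Prop := forall i, bdd p`_i.

Lemma bdd_horner p x : bdd_poly p -> bdd x -> bdd p.[x].
Proof.
move=> hp hx; rewrite horner_coef; apply: bdd_sum => i _.
by apply: bddM => //; exact: bddX.
Qed.

Lemma bdd_nderivn p n : bdd_poly p -> bdd_poly p^`N(n).
Proof.
move=> hp i; rewrite coef_nderivn -mulr_natr; apply: bddM => //.
by rewrite -(rmorph_nat emb); exact: bdd_emb.
Qed.

Lemma horner_taylor2 (p : {poly S}) : bdd_poly p -> forall x h, bdd x -> bdd h ->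
  exists2 r, bdd r & p.[x + h] = p.[x] + p^`().[x] * h + h ^+ 2 * r.
Proof.
move=> hp x h hx hh.
have E : p.[x + h] = \sum_(i < (size p).+2) p^`N(i).[x] * h ^+ i.
  rewrite nderiv_taylor; last exact: mulrC.
  rewrite (big_ord_widen _ (fun i => p^`N(i).[x] * h ^+ i) (leqW (leqnSn (size p)))).
  rewrite [LHS]big_mkcond /=; apply: eq_bigr => i _; case: ltnP => // le.
  by rewrite nderivn_poly0 // horner0 mul0r.
exists (\sum_(i < size p) p^`N(i.+2).[x] * h ^+ i).
  apply: bdd_sum => i _; apply: bddM; last exact: bddX.
  by apply: bdd_horner => //; exact: bdd_nderivn.
rewrite E !big_ord_recl /= (_ : bump 0 0 = 1%N) // expr0 mulr1 expr1 nderivn0 nderivn1 addrA.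
congr (_ + _); rewrite mulr_sumr; apply: eq_bigr => i _.
by rewrite (_ : bump 0 (bump 0 i) = i.+2) // !exprS; ring.
Qed.

(* Newton steps of twice the usual length in the two directions bracket a root. *)
Lemma hensel (g : {poly S}) (x : S) : bdd_poly g -> bdd x -> negl g.[x] ->
  ~ negl g^`().[x] -> exists2 y, g.[y] = 0 & negl (y - x).
Proof.
move=> hg hx gx g'x.
have [gx0|gx0] := eqVneq g.[x] 0; first by exists x => //; rewrite subrr; exact: negl0.
have g'0 : g^`().[x] != 0.
  by apply/eqP => e; apply: g'x; rewrite e; exact: negl0.
have g'V : bdd (g^`().[x])^-1 by case: (bdd_or_negl g^`().[x]).
set d := g^`().[x] in g'x g'0 g'V *; set u := g.[x] in gx gx0 *.
(* At x + h and x - h the linear parts are 3 u and - u, and the quadratic error is at most half of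
   |u|, so the two values have opposite signs. *)
pose h := 2%:R * u / d.
have hneg : negl h.
  rewrite /h -mulrA; apply: neglMr; last exact: neglMl.
  by rewrite -(rmorph_nat emb); exact: bdd_emb.
have dh : d * h = 2%:R * u by rewrite /h; field.
have est s : s = h \/ s = - h -> exists2 w, g.[x + s] = u + d * s + w & `|w| <= `|u| / 2%:R.
  move=> hs; have ns : negl s by case: hs => ->; [|exact: neglN].
  have as_ : `|s| = `|h| by case: hs => ->; rewrite ?normrN.
  have [r hr e] := horner_taylor2 hg hx (negl_bdd ns).
  exists (s ^+ 2 * r) => //.
  have sm : `|s * r / d| <= emb (4^-1).
    by apply: negl_small; [apply: neglMl => //; exact: neglMl|lra].
  have -> : `|s ^+ 2 * r| = `|d * h| * `|s * r / d|.
    rewrite (_ : s ^+ 2 * r = (s * d) * (s * r / d)); last by field.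
    by rewrite normrM [`|s * d|]normrM [`|d * h|]normrM as_ [`|h| * _]mulrC.
  rewrite dh normrM [`|2%:R|]ger0_norm //.
  rewrite fmorphV (rmorph_nat emb) in sm.
  apply: le_trans (_ : 2%:R * `|u| * 4%:R^-1 <= _); last by lra.
  by rewrite ler_wpM2l // mulr_ge0.
have [w1 e1 b1] := est h (or_introl erefl).
have [w2 e2 b2] := est (- h) (or_intror erefl).
rewrite mulrN dh in e2; rewrite dh in e1.
have ivt a b : negl a -> negl b -> g.[x + a] <= 0 -> 0 <= g.[x + b] ->
    exists2 y, g.[y] = 0 & negl (y - x).
  move=> na nb ga gb.
  have small l y : negl l -> forall k, negl k -> x + l <= y -> y <= x + k -> negl (y - x).
    move=> nl k nk ly yk; apply: (@negl_le _ (`|l| + `|k|)).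
      rewrite [leRHS]ger0_norm ?addr_ge0 // ler_norml.
      have := ler_norm (- l); have := ler_norm k; rewrite normrN.
      have := normr_ge0 k; have := normr_ge0 l; lra.
    by apply: neglD => j; rewrite normr_id.
  have [ab|/ltW ab] := leP (x + a) (x + b).
    by have [y [y1 y2 y3]] := hyper_ivt ab ga gb; exists y => //; exact: small y1 y2.
  have [||y [y1 y2 y3]] := @hyper_ivt (- g) _ _ ab; rewrite ?hornerN ?oppr_le0 ?oppr_ge0 //.
  exists y; last exact: small y1 y2.
  by apply/eqP; rewrite -oppr_eq0 -hornerN y3.
have nnh : negl (- h) by exact: neglN.
move: b1 b2; rewrite !ler_norml => /andP[b1 b1'] /andP[b2 b2'].
have [u0|u0] := leP 0 u.
  rewrite ger0_norm // in b1 b1' b2 b2'.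
  by apply: (ivt (- h) h) => //; rewrite ?e1 ?e2; lra.
rewrite ltr0_norm // in b1 b1' b2 b2'.
by apply: (ivt h (- h)) => //; rewrite ?e1 ?e2; lra.
Qed.

(** Reduction modulo [negl] is injective on such a ring; for a maximal one it is also onto the
    residue field. Negation comes from [emb (- 1)]. *)
Definition coef_ring (K : set S) : Prop :=
  [/\ forall r, K (emb r), forall x y, K x -> K y -> K (x + y),
      forall x y, K x -> K y -> K (x * y), forall x, K x -> bdd x &
      forall x, K x -> negl x -> x = 0].

Definition poly_in (K : set S) (p : {poly S}) : Prop := forall i, K p`_i.

Definition adjoin (K : set S) (x : S) : set S := [set y | exists2 p, poly_in K p & y = p.[x]].

Section CoefRing.
Variables (K : set S) (gK : coef_ring K).

Lemma coef_ring0 : K 0.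
Proof. by have [e _ _ _ _] := gK; have := e 0; rewrite rmorph0. Qed.

Lemma coef_ringN x : K x -> K (- x).
Proof.
have [e _ m _ _] := gK => Kx; rewrite -mulN1r -(rmorphN1 emb).
by apply: m => //; exact: e.
Qed.

Lemma coef_ring_sum (I : Type) (s : seq I) (P : pred I) (F : I -> S) :
  (forall i, P i -> K (F i)) -> K (\sum_(i <- s | P i) F i).
Proof.
have [_ a _ _ _] := gK => H.
by apply: (big_ind (fun z => K z)) => //; exact: coef_ring0.
Qed.

Lemma poly_inC c : K c -> poly_in K c%:P.
Proof. by move=> Kc i; rewrite coefC; case: eqP => // _; exact: coef_ring0. Qed.

Lemma poly_inX : poly_in K 'X.
Proof. by have [e _ _ _ _] := gK => i; rewrite coefX -(rmorph_nat emb); exact: e. Qed.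

Lemma poly_inD p q : poly_in K p -> poly_in K q -> poly_in K (p + q).
Proof. by have [_ a _ _ _] := gK => hp hq i; rewrite coefD; exact: a. Qed.

Lemma poly_inM p q : poly_in K p -> poly_in K q -> poly_in K (p * q).
Proof.
have [_ _ m _ _] := gK => hp hq i; rewrite coefM.
by apply: coef_ring_sum => j _; exact: m.
Qed.

Lemma poly_inN p : poly_in K p -> poly_in K (- p).
Proof. by move=> hp i; rewrite coefN; exact: coef_ringN. Qed.

Lemma poly_inXn n : poly_in K 'X^n.
Proof.
elim: n => [|n IH]; last by rewrite exprS; apply: poly_inM => //; exact: poly_inX.
by rewrite expr0; apply: poly_inC; have [e _ _ _ _] := gK; rewrite -(rmorph1 emb); exact: e.
Qed.

Lemma poly_in_bdd p : poly_in K p -> bdd_poly p.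
Proof. by have [_ _ _ b _] := gK => hp i; exact: b. Qed.

Lemma adjoin_sub x : K `<=` adjoin K x.
Proof. by move=> c Kc; exists c%:P; [exact: poly_inC|rewrite hornerC]. Qed.

Lemma adjoin_self x : adjoin K x x.
Proof. by exists 'X; [exact: poly_inX|rewrite hornerX]. Qed.

Lemma adjoin_coef_ring x : bdd x ->
  (forall p, poly_in K p -> negl p.[x] -> p.[x] = 0) -> coef_ring (adjoin K x).
Proof.
move=> hx h; split.
- by move=> r; apply: adjoin_sub; have [e _ _ _ _] := gK.
- move=> _ _ [p hp ->] [q hq ->]; exists (p + q); last by rewrite hornerD.
  exact: poly_inD.
- move=> _ _ [p hp ->] [q hq ->]; exists (p * q); last by rewrite hornerM.
  exact: poly_inM.
- by move=> _ [p hp ->]; apply: bdd_horner => //; exact: poly_in_bdd.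
- by move=> _ [p hp ->]; exact: h.
Qed.

Hypothesis Kmax : forall B, coef_ring B -> K `<=` B -> B `<=` K.

(** A nonzero a in K is not negligible, so its inverse is bounded and the localization of K at the
    powers of a is still a coefficient ring; maximality puts it inside K. *)
Lemma coef_ringV a : K a -> K a^-1.
Proof.
have [e ad m b n] := gK => Ka.
have [->|a0] := eqVneq a 0; first by rewrite invr0; exact: coef_ring0.
have aX k : K (a ^+ k).
  by elim: k => [|k IH]; [rewrite expr0 -(rmorph1 emb); exact: e|rewrite exprS; exact: m].
have aV : bdd a^-1.
  by case: (bdd_or_negl a) => // na; case/eqP: a0; exact: n.
pose B : set S := [set y | exists c k, K c /\ y = c * a ^- k].
apply: (Kmax (B := B)).
- split.
  + by move=> r; exists (emb r), 0%N; rewrite expr0 invr1 mulr1.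
  + move=> _ _ [c [k [Kc ->]]] [c' [k' [Kc' ->]]].
    exists (c * a ^+ k' + c' * a ^+ k), (k + k')%N; split; first by apply: ad; exact: m.
    by rewrite exprD; field; rewrite !expf_neq0.
  + move=> _ _ [c [k [Kc ->]]] [c' [k' [Kc' ->]]].
    exists (c * c'), (k + k')%N; split; first exact: m.
    by rewrite exprD; field; rewrite !expf_neq0.
  + move=> _ [c [k [Kc ->]]]; apply: bddM; first exact: b.
    by rewrite -exprVn; exact: bddX.
  + move=> _ [c [k [Kc ->]]] h.
    suff -> : c = 0 by rewrite mul0r.
    apply: n => //; rewrite -[c](mulfVK (expf_neq0 k a0)).
    by apply: neglMl => //; exact: b.
- by move=> c Kc; exists c, 0%N; rewrite expr0 invr1 mulr1.
- exists 1, 1%N; split; first by rewrite -(rmorph1 emb); exact: e.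
  by rewrite mul1r expr1.
Qed.

(* A polynomial of least degree over K that is negligible at x has a non-negligible
   derivative at x, hence a root y near x, and K(y) is still a coefficient ring. *)
Lemma coef_ring_residue x : bdd x -> exists2 c, K c & negl (x - c).
Proof.
have [e ad m b n] := gK => hx.
(* If reduction is injective on K[x], x itself can be adjoined. Otherwise x is algebraic modulo
   [negl]. *)
have [A|B] := pselect (forall p, poly_in K p -> negl p.[x] -> p.[x] = 0).
  exists x; last by rewrite subrr; exact: negl0.
  apply: (Kmax (adjoin_coef_ring hx A) (adjoin_sub x)); exact: adjoin_self.
pose bad k := `[< exists p, [/\ poly_in K p, negl p.[x], p != 0 & size p = k] >].
have ex : exists k, bad k.
  move/existsNP: B => [p /not_implyP[hp /not_implyP[np p0]]].
  exists (size p); apply/asboolP; exists p; split=> //.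
  by apply: contra_notN p0 => /eqP ->; rewrite horner0.
case: (ex_minnP ex) => k /asboolP[p [hp np p0 sp]] kmin.
have lp0 : lead_coef p != 0 by rewrite lead_coef_eq0.
pose g := (lead_coef p)^-1 *: p.
have Kl : K (lead_coef p)^-1 by apply: coef_ringV; exact: hp.
have hg : poly_in K g by move=> i; rewrite coefZ; apply: m.
have lg : lead_coef g = 1 by rewrite lead_coefZ mulVf.
have sg : size g = k by rewrite size_scale ?invr_eq0.
have ng : negl g.[x] by rewrite hornerZ; apply: neglMr => //; exact: b.
have min_k q : poly_in K q -> negl q.[x] -> (size q < k)%N -> q = 0.
  move=> hq nq sq; apply: contrapT => /eqP q0.
  by move: sq; rewrite ltnNge kmin //; apply/asboolP; exists q.
have k2 : (1 < k)%N.
  rewrite ltnNge; apply/negP => k1.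
  have gC : g = (g`_0)%:P by apply: size1_polyC; rewrite sg.
  have g00 : g`_0 = 0 by apply: n => //; rewrite gC hornerC in ng.
  by move/eqP: lg; rewrite gC g00 lead_coefC eq_sym oner_eq0.
(* By minimality a negligible value would make the derivative the zero polynomial, but its leading
   coefficient is the degree of g, nonzero in characteristic 0. *)
have g'x : ~ negl g^`().[x].
  move=> h; have hd : poly_in K g^`().
    move=> i; rewrite coef_deriv -mulr_natr; apply: m => //.
    by rewrite -(rmorph_nat emb); exact: e.
  have sd : (size g^`() < k)%N.
    by rewrite -sg lt_size_deriv // -size_poly_eq0 sg; case: k k2 {sp kmin min_k sg}.
  have := congr1 (fun q : {poly S} => q`_(k.-2)) (min_k _ hd h sd).
  rewrite coef0 coef_deriv (_ : k.-2.+1 = (size g).-1); last first.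
    by rewrite sg; case: k k2 {sp kmin min_k sg sd} => [|[]].
  rewrite -lead_coefE lg => /eqP; rewrite pnatr_eq0 sg.
  by case: k k2 {sp kmin min_k sg sd} => [|[]].
have [y gy yx] := hensel (poly_in_bdd hg) hx ng g'x.
have hy : bdd y by rewrite -(subrK x y); apply: bddD => //; exact: negl_bdd.
exists y; last by rewrite -opprB; exact: neglN.
apply: (Kmax _ (adjoin_sub y)); last exact: adjoin_self.
apply: adjoin_coef_ring => // h.
(* Division by the monic g, one leading term at a time, leaves the value at y unchanged. Below the
   degree of g, negligibility passes from y to the nearby x, and minimality applies. *)
have [s] := ubnP (size h); elim: s h => // s IH h sh hh nh.
have [hk|kh] := ltnP (size h) k.
  suff -> : h = 0 by rewrite horner0.
  apply: min_k => //.
  have [r hr er] := horner_taylor2 (poly_in_bdd hh) hx (negl_bdd yx).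
  have -> : h.[x] = h.[y] - (y - x) * (h^`().[x] + (y - x) * r).
    by rewrite addrC subrK in er; rewrite er; ring.
  apply: neglD => //; apply: neglN; apply: neglMl => //; apply: bddD.
    apply: bdd_horner => // i; rewrite coef_deriv -mulr_natr; apply: bddM.
      exact: (poly_in_bdd hh).
    by rewrite -(rmorph_nat emb); exact: bdd_emb.
  by apply: bddM => //; exact: negl_bdd.
pose q := h - lead_coef h *: ('X^(size h - k) * g).
have hq : poly_in K q.
  apply: poly_inD => //; apply: poly_inN; rewrite -mul_polyC; apply: poly_inM.
    by apply: poly_inC; exact: hh.
  by apply: poly_inM => //; exact: poly_inXn.
have qy : q.[y] = h.[y] by rewrite hornerD hornerN hornerZ hornerM gy !mulr0 subr0.
have h0 : h != 0 by rewrite -size_poly_gt0; apply: leq_trans kh; exact: ltnW.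
rewrite -qy in nh *; apply: IH => //.
suff : (size q < size h)%N by lia.
have sh0 : (0 < size h)%N by rewrite size_poly_gt0.
have shift i : (lead_coef h *: ('X^(size h - k) * g))`_i =
    lead_coef h * (if (i < size h - k)%N then 0 else g`_(i - (size h - k))).
  by rewrite coefZ coefXnM.
rewrite -(prednK sh0) ltnS; apply/leq_sizeP => i hi.
rewrite coefB shift; have [->|ih] := eqVneq i (size h).-1.
  rewrite ltnNge (_ : (size h - k <= (size h).-1)%N = true) /=; last by lia.
  rewrite (_ : ((size h).-1 - (size h - k))%N = (size g).-1); last by rewrite sg; lia.
  by rewrite -!lead_coefE lg mulr1 subrr.
have {}hi : (size h <= i)%N by lia.
rewrite nth_default // ltnNge (leq_trans (leq_subr _ _) hi) /=.
by rewrite nth_default ?mulr0 ?subrr // sg leq_subRL ?subnK // (leq_trans (leq_subr _ _) hi).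
Qed.

End CoefRing.

Lemma coef_ring_bigcup (F : set (set S)) : F !=set0 ->
  F `<=` coef_ring -> total_on F subset -> coef_ring (\bigcup_(X in F) X).
Proof.
move=> [X0 FX0] Fg Ftot.
have two p q : (\bigcup_(X in F) X) p -> (\bigcup_(X in F) X) q ->
    exists X, [/\ F X, coef_ring X, X p & X q].
  move=> [X FX Xp] [Y FY Yq]; case: (Ftot X Y FX FY) => sub.
    by exists Y; split=> //; [exact: Fg|exact: sub].
  by exists X; split=> //; [exact: Fg|exact: sub].
split.
- by move=> r; exists X0 => //; have [e _ _ _ _] := Fg X0 FX0.
- move=> x y p q; have [X [FX [_ a _ _ _] Xp Xq]] := two _ _ p q.
  by exists X => //; exact: a.
- move=> x y p q; have [X [FX [_ _ m _ _] Xp Xq]] := two _ _ p q.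
  by exists X => //; exact: m.
- by move=> x [X FX Xx]; have [_ _ _ b _] := Fg X FX; exact: b.
- by move=> x [X FX Xx]; have [_ _ _ _ n] := Fg X FX; exact: n.
Qed.

Lemma embs_coef_ring : coef_ring (range emb).
Proof.
split.
- by move=> r; exists r.
- by move=> _ _ [r _ <-] [s _ <-]; exists (r + s); rewrite ?rmorphD.
- by move=> _ _ [r _ <-] [s _ <-]; exists (r * s); rewrite ?rmorphM.
- by move=> _ [r _ <-]; exact: bdd_emb.
- move=> _ [r _ <-] nr; apply: negl_inv => //.
  by rewrite -fmorphV; exact: bdd_emb.
Qed.

Lemma coefficient_field : exists K : set S,
  coef_ring K /\ forall x, bdd x -> exists2 c, K c & negl (x - c).
Proof.
have [F Fsub Ftot|K [KP Kmax]] := @Zorn_bigcup _ (fun K => K = set0 \/ coef_ring K).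
  have [[X FX X0]|none] := pselect (exists2 X, F X & X <> set0); last first.
    left; rewrite bigcup0 // => X FX; apply: contrapT => X0.
    by apply: none; exists X.
  right; have -> : \bigcup_(X in F) X = \bigcup_(X in F `&` [set X | X <> set0]) X.
    apply/seteqP; split=> p [Y FY Yp]; last by exists Y => //; case: FY.
    by exists Y => //; split=> //= Y0; rewrite Y0 in Yp.
  apply: coef_ring_bigcup.
  - by exists X.
  - by move=> Y [FY Y0]; case: (Fsub Y FY).
  - by move=> Y Z [FY _] [FZ _]; exact: Ftot.
have gK : coef_ring K.
  case: KP => // K0; case: (Kmax (range emb)); last by right; exact: embs_coef_ring.
  rewrite K0; split; first exact: sub0set.
  by move=> /(_ (emb 0)); apply; exists 0.
exists K; split=> // x; apply: coef_ring_residue => // B gB KB.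
by apply: contrapT => BK; apply: (Kmax B); [split|right].
Qed.

End Valuation.

(** * Partial maps *)

Lemma count_lt (T : eqType) (p q : pred T) (s : seq T) (w : T) :
  w \in s -> q w -> ~~ p w -> (forall x, p x -> q x) -> (count p s < count q s)%N.
Proof.
move=> ws qw pw pq; elim: s ws => // x s IH; rewrite inE => /orP[/eqP <-|ws] /=.
  by rewrite qw (negbTE pw) add0n add1n ltnS; exact: sub_count.
by have := IH ws; case px: (p x); rewrite ?(pq _ px) //; case: (q x); lia.
Qed.

Section PartialMaps.
Variable R : realType.
Local Notation S := (hyper R).
Local Notation emb := (@emb R).

Definition sim (x y : S) : Prop := [/\ x != 0, y != 0, bdd (x / y) & bdd (y / x)].

Lemma sim_refl x : x != 0 -> sim x x.
Proof. by move=> x0; split; rewrite // divff //; exact: bdd1. Qed.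

Lemma sim_sym x y : sim x y -> sim y x.
Proof. by move=> [x0 y0 h h']. Qed.

Lemma sim_trans x y z : sim x y -> sim y z -> sim x z.
Proof.
move=> [x0 y0 h1 h2] [_ z0 h3 h4]; split=> //.
  by rewrite (_ : x / z = (x / y) * (y / z)); [exact: bddM|field; rewrite y0 z0].
by rewrite (_ : z / x = (z / y) * (y / x)); [exact: bddM|field; rewrite x0 y0].
Qed.

(** Members of distinct classes are linearly independent over K, because a nonzero combination is
    dominated by one of its terms. *)
Definition good_basis (s : seq S) : Prop :=
  [/\ uniq s, forall w, w \in s -> w != 0 &
      forall w w', w \in s -> w' \in s -> sim w w' -> w = w'].

Variables (K : set S) (lam : S -> S).
Hypothesis coefK : coef_ring K.
Hypothesis residueK : forall x, bdd x -> exists2 c, K c & negl (x - c).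
Hypothesis lam_bdd : forall x, bdd (lam x).
Hypothesis lamV_bdd : forall x, bdd (lam x)^-1.
Hypothesis lam_neq0 : forall x, lam x != 0.
Hypothesis lam_sim : forall x y, sim x y -> lam x = lam y.
Hypothesis lam1 : lam 1 = 1.
Hypothesis lam_pd : forall s, good_basis s -> exists k : S,
  [/\ 0 < k, bdd k^-1 & forall u : S -> S,
     k * \sum_(b <- s) u b ^+ 2 <= \sum_(b <- s) \sum_(b' <- s) u b * u b' * lam (b * b')].

Definition partial_map (s : seq S) (x y : S) : Prop := exists c : S -> S,
  [/\ forall w, K (c w), x = \sum_(w <- s) c w * w & y = \sum_(w <- s) c w * lam w * w].

(** The largest w0 with nonzero coefficient dominates: any other such w is no larger and lies in
    another class, so w / w0 is negligible, and bounded coefficients do not change this. *)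
Lemma leading_term s (c : S -> S) : good_basis s -> (forall w, K (c w)) ->
  has (fun w => c w != 0) s ->
  exists w0, [/\ w0 \in s, c w0 != 0 &
     forall w, w \in s -> w != w0 -> negl (c w * w / w0)].
Proof.
move=> [us s0 sd] Kc hc; have [_ _ _ bK _] := coefK.
have [w0 [w0s c0 wmax]] : exists w0, [/\ w0 \in s, c w0 != 0 &
    forall w, w \in s -> c w != 0 -> `|w| <= `|w0|].
  elim: s hc {us s0 sd} => //= a s IH.
  have [hs _|ns] := boolP (has (fun w => c w != 0) s).
    have [w0 [w0s c0 wmax]] := IH hs.
    have [ca|ca] := eqVneq (c a) 0.
      exists w0; split=> //; first by rewrite inE w0s orbT.
      by move=> w; rewrite inE => /orP[/eqP ->|]; [rewrite ca eqxx|exact: wmax].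
    have [aw|/ltW aw] := leP `|a| `|w0|.
      exists w0; split=> //; first by rewrite inE w0s orbT.
      by move=> w; rewrite inE => /orP[/eqP ->|]; last exact: wmax.
    exists a; split=> //; first by rewrite inE eqxx.
    move=> w; rewrite inE => /orP[/eqP ->|ws cw] //.
    exact: le_trans (wmax w ws cw) aw.
  rewrite orbF => ca; exists a; split=> //; first by rewrite inE eqxx.
  move=> w; rewrite inE => /orP[/eqP ->|ws cw] //.
  by case/hasP: ns; exists w.
exists w0; split=> // w ws ww0.
have [->|cw] := eqVneq (c w) 0; first by rewrite !mul0r; exact: negl0.
have w00 := s0 _ w0s; have wn0 := s0 _ ws.
rewrite -mulrA; apply: neglMr; first exact: bK.
case: (bdd_or_negl (w / w0)) => //; rewrite invf_div => h.
case/eqP: ww0; apply: sd => //; split=> //.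
apply: (@bdd_le _ _ 1); last exact: bdd1.
by rewrite normr1 normrM normfV ler_pdivrMr ?normr_gt0 // mul1r wmax.
Qed.

(** Both sums have their leading term at the same w0, and x lies in the class of w0, where [lam] is
    constant. *)
Lemma partial_map_leading s x y : good_basis s -> partial_map s x y ->
  (x = 0 /\ y = 0) \/ (x != 0 /\ negl (y / x - lam x)).
Proof.
move=> gs [c [Kc -> ->]].
have [hc|] := boolP (has (fun w => c w != 0) s); last first.
  rewrite -all_predC => /allP c0; left.
  have c00 w : w \in s -> c w = 0 by move=> /c0 /=; rewrite negbK => /eqP.
  by split; rewrite big_seq big1 // => w /c00 ->; rewrite !mul0r.
have [w0 [w0s c0 rest]] := leading_term gs Kc hc; right.
have [us s0 sd] := gs; have w00 := s0 _ w0s; have [_ _ _ bK nK] := coefK.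
set x' := \sum_(w <- s) c w * w; set y' := \sum_(w <- s) c w * lam w * w.
pose nu := \sum_(w <- s | w != w0) c w * w / w0.
have nnu : negl nu.
  by rewrite /nu big_seq_cond; apply: negl_sum => w /andP[ws]; exact: rest.
have xw : x' / w0 = c w0 + nu.
  rewrite /x' (bigD1_seq w0) //= mulrDl mulfK // mulr_suml.
  by [].
have tn : ~ negl (x' / w0).
  move=> h; case/eqP: c0; apply: nK => //.
  by rewrite -[c w0](addrK nu) -xw; apply: neglD => //; exact: neglN.
have x0 : x' != 0 by apply/eqP => e; apply: tn; rewrite e mul0r; exact: negl0.
have tV : bdd (x' / w0)^-1 by case: (bdd_or_negl (x' / w0)).
have sx : sim x' w0.
  split=> //; last by rewrite -invf_div.
  by rewrite xw; apply: bddD; [exact: bK|exact: negl_bdd].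
rewrite (lam_sim sx); split=> //.
have yw : y' / w0 = lam w0 * (x' / w0) +
    \sum_(w <- s | w != w0) (lam w - lam w0) * (c w * w / w0).
  rewrite xw mulrDr /nu mulr_sumr -addrA -big_split /= /y' (bigD1_seq w0) //= mulrDl mulr_suml.
  congr (_ + _); first by field.
  by apply: eq_bigr => w _; ring.
rewrite (_ : y' / x' = (y' / w0) * (x' / w0)^-1); last by field; rewrite x0 w00.
rewrite yw mulrDl mulfK; last by rewrite mulf_neq0 // invr_eq0.
rewrite addrC addKr; apply: neglMl => //.
rewrite big_seq_cond; apply: negl_sum => w /andP[ws ww0].
by apply: neglMr; [apply: bddD => //; exact: bddN|exact: rest].
Qed.

Lemma partial_map0 s x y : good_basis s -> partial_map s x y -> (x = 0 <-> y = 0).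
Proof.
move=> gs p; case: (partial_map_leading gs p) => [[-> ->] //|[x0 h]].
split=> [e|y0]; first by rewrite e eqxx in x0.
rewrite y0 mul0r sub0r in h; have /negl_inv := neglN h.
rewrite opprK => /(_ (lamV_bdd x)) /eqP; by rewrite (negbTE (lam_neq0 x)).
Qed.

Lemma partial_map_lin s a x y x' y' : K a -> partial_map s x y -> partial_map s x' y' ->
  partial_map s (a * x + x') (a * y + y').
Proof.
have [_ ad m _ _] := coefK.
move=> Ka [c [Kc -> ->]] [c' [Kc' -> ->]]; exists (fun w => a * c w + c' w); split.
- by move=> w; apply: ad => //; exact: m.
- by rewrite mulr_sumr -big_split; apply: eq_bigr => w _ /=; ring.
- by rewrite mulr_sumr -big_split; apply: eq_bigr => w _ /=; ring.
Qed.

Lemma K_nat (n : nat) : K n%:R.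
Proof. by have [e _ _ _ _] := coefK; rewrite -(rmorph_nat emb); exact: e. Qed.

Lemma partial_map00 s : partial_map s 0 0.
Proof.
exists (fun=> 0); split; first by move=> _; exact: (K_nat 0).
  by rewrite big1 // => w _; rewrite mul0r.
by rewrite big1 // => w _; rewrite !mul0r.
Qed.

Lemma partial_mapZ s a x y : K a -> partial_map s x y -> partial_map s (a * x) (a * y).
Proof.
by move=> Ka p; have := partial_map_lin Ka p (partial_map00 s); rewrite !addr0.
Qed.

Lemma partial_mapD s x y x' y' : partial_map s x y -> partial_map s x' y' ->
  partial_map s (x + x') (y + y').
Proof. by move=> p q; have := partial_map_lin (K_nat 1) p q; rewrite !mul1r. Qed.

Lemma partial_mapN s x y : partial_map s x y -> partial_map s (- x) (- y).
Proof.
by move=> p; have := partial_mapZ (coef_ringN coefK (K_nat 1)) p; rewrite !mulN1r.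
Qed.

Lemma partial_map_sum s (I : Type) (r : seq I) (F G : I -> S) :
  (forall i, partial_map s (F i) (G i)) ->
  partial_map s (\sum_(i <- r) F i) (\sum_(i <- r) G i).
Proof.
move=> H; elim: r => [|i r IH]; first by rewrite !big_nil; exact: partial_map00.
by rewrite !big_cons; exact: partial_mapD.
Qed.

Lemma partial_map_fun s x y y' : good_basis s ->
  partial_map s x y -> partial_map s x y' -> y = y'.
Proof.
move=> gs p q; have := partial_mapD q (partial_mapN p); rewrite subrr => h.
by have /(partial_map0 gs) [/(_ erefl) /eqP + _] := h; rewrite subr_eq0 => /eqP.
Qed.

Definition extends s s' := forall x y, partial_map s x y -> partial_map s' x y.

Lemma extends_cons s r : r \notin s -> extends s (r :: s).
Proof.
move=> rs x y [c [Kc -> ->]]; exists (fun w => if w == r then 0 else c w).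
have E (f : S -> S) : \sum_(w <- r :: s) (if w == r then 0 else c w) * f w =
    \sum_(w <- s) c w * f w.
  rewrite big_cons eqxx mul0r add0r; apply: eq_big_seq => w ws.
  by case: eqP => // e; rewrite -e ws in rs.
split; first by move=> w; case: ifP => // _; exact: (K_nat 0).
- by rewrite (E id).
- under [RHS]eq_bigr do rewrite -mulrA.
  by rewrite (E (fun w => lam w * w)); apply: eq_bigr => w _; rewrite mulrA.
Qed.

Lemma partial_map_head s r : uniq (r :: s) -> partial_map (r :: s) r (lam r * r).
Proof.
move=> /= /andP[rs us]; exists (fun w => (w == r)%:R).
have E (f : S -> S) : \sum_(w <- r :: s) (w == r)%:R * f w = f r.
  rewrite big_cons eqxx mul1r big_seq big1 ?addr0 // => w ws.
  by case: eqP => [e|_]; [rewrite -e ws in rs|rewrite mul0r].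
split; first by move=> w; exact: K_nat.
- by rewrite (E id).
- by under eq_bigr do rewrite -mulrA; rewrite (E (fun w => lam w * w)).
Qed.

(** As long as the remainder r shares its class with some f w, the residue in K of r / f w is
    subtracted. The remainder then falls below that class, so fewer w satisfy [bdd (f w / r)]. *)
Lemma best_approximation (s : seq S) (f : S -> S) (d : S) :
  (forall w, w \in s -> f w != 0) -> uniq s ->
  exists c : S -> S, (forall w, K (c w)) /\
    let r := d - \sum_(w <- s) c w * f w in
    r = 0 \/ (r != 0 /\ forall w, w \in s -> ~ sim r (f w)).
Proof.
move=> f0 us; have [_ ad m bK nK] := coefK.
suff H (n : nat) (r : S) : (count (fun w => `[< bdd (f w / r) >]) s < n)%N ->
    exists c : S -> S, (forall w, K (c w)) /\
    let r' := r - \sum_(w <- s) c w * f w in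
    r' = 0 \/ (r' != 0 /\ forall w, w \in s -> ~ sim r' (f w)).
  exact: H (ltnSn _).
elim: n r => // n IH r cn.
have zero : r - \sum_(w <- s) 0 * f w = r.
  by rewrite big1 ?subr0 // => w _; rewrite mul0r.
have [r0|r0] := eqVneq r 0.
  by exists (fun=> 0); split; [move=> _; exact: (K_nat 0)|left; rewrite zero].
have [none|/existsNP[w /not_implyP[ws /contrapT sr]]] :=
    pselect (forall w, w \in s -> ~ sim r (f w)).
  exists (fun=> 0); split; first by move=> _; exact: (K_nat 0).
  by right; rewrite /= zero.
have [_ fw0 b1 b2] := sr; have [a Ka na] := residueK b1.
pose r' := r - a * f w.
have r'w : r' / f w = r / f w - a by rewrite /r' mulrBl mulfK.
have sumw : \sum_(x <- s) (if x == w then a else 0) * f x = a * f w.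
  by rewrite (bigD1_seq w) //= eqxx big1 ?addr0 // => x /negbTE ->; rewrite mul0r.
have Kaw x : K (if x == w then a else 0) by case: ifP => // _; exact: (K_nat 0).
have [r'0|r'0] := eqVneq r' 0.
  exists (fun x => if x == w then a else 0); split=> //; left.
  by rewrite sumw.
have [|c [Kc Hc]] := IH r'.
  apply: leq_trans (_ : count (fun w => `[< bdd (f w / r) >]) s <= n)%N => //.
  apply: (count_lt ws); first by apply/asboolP.
    apply/asboolP => h; have /negl_inv : negl (r' / f w) by rewrite r'w.
    by rewrite invf_div => /(_ h) /eqP; rewrite mulf_eq0 (negbTE r'0) invr_eq0 (negbTE fw0).
  move=> x /asboolP h; apply/asboolP.
  rewrite (_ : f x / r = (f x / r') * ((r' / f w) * (f w / r))); last first.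
    by field; rewrite r0 fw0 r'0.
  apply: bddM => //; apply: bddM => //; rewrite r'w; exact: negl_bdd.
exists (fun x => (if x == w then a else 0) + c x); split.
  by move=> x; apply: ad.
rewrite /= (_ : r - _ = r' - \sum_(w <- s) c w * f w) //.
rewrite /r' -addrA -opprD -sumw -big_split /=; congr (_ - _).
by apply: eq_bigr => x _; rewrite mulrDl.
Qed.

Lemma good_basis_cons s r : good_basis s -> r != 0 -> (forall w, w \in s -> ~ sim r w) ->
  good_basis (r :: s).
Proof.
move=> [us s0 sd] r0 rs.
have nrs : r \notin s by apply/negP => /[dup] /rs h /s0 w0; apply: h; exact: sim_refl.
split; first by rewrite /= nrs.
- by move=> w; rewrite inE => /orP[/eqP ->|/s0].
- move=> w w'; rewrite !inE => /orP[/eqP ->|ws] /orP[/eqP ->|ws'] //.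
  + by move=> h; case: (rs _ ws').
  + by move=> /sim_sym h; case: (rs _ ws).
  + exact: sd.
Qed.

Lemma partial_map_self s c : good_basis s -> (forall w, K (c w)) ->
  partial_map s (\sum_(w <- s) c w * w) (\sum_(w <- s) c w * (lam w * w)).
Proof.
by move=> gs Kc; exists c; split=> //; apply: eq_bigr => w _; rewrite mulrA.
Qed.

(** A nonzero remainder of the reduction lies in a new class, so it joins the basis. *)
Lemma partial_map_forth s d : good_basis s ->
  exists s' e, [/\ good_basis s', extends s s' & partial_map s' d e].
Proof.
move=> gs; have [us s0 sd] := gs.
have [c [Kc /=]] := @best_approximation s id d s0 us.
set r := d - _ => Hr; have self := partial_map_self gs Kc.
have dr : d = \sum_(w <- s) c w * w + r by rewrite /r addrC subrK.
case: Hr => [r0|[r0 rs]].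
  by exists s; eexists; split; [exact: gs|by []|rewrite dr r0 addr0; exact: self].
have gs' := good_basis_cons gs r0 rs; have [us' _ _] := gs'.
have ex : extends s (r :: s) by apply: extends_cons; case/andP: us'.
exists (r :: s); eexists; split=> //; rewrite dr.
by apply: partial_mapD; [exact/ex/self|exact: partial_map_head].
Qed.

(** Here the reduction takes place among the images. A remainder r in a new class has the preimage
    [r / lam r]: [lam] and its inverse being bounded, this quotient lies in the class of r, where
    [lam] takes the same value. *)
Lemma partial_map_back s e : good_basis s ->
  exists s' d, [/\ good_basis s', extends s s' & partial_map s' d e].
Proof.
move=> gs; have [us s0 sd] := gs.
have lamM_neq0 w : w != 0 -> lam w * w != 0 by move=> w0; rewrite mulf_neq0.
have simM w : w != 0 -> sim (lam w * w) w.
  move=> w0; split; rewrite ?lamM_neq0 ?mulfK //.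
  by rewrite invfM mulrCA divff // mulr1.
have [c [Kc /=]] := @best_approximation s (fun w => lam w * w) e
  (fun w ws => lamM_neq0 w (s0 w ws)) us.
set r := e - _ => Hr; have self := partial_map_self gs Kc.
have er : e = \sum_(w <- s) c w * (lam w * w) + r by rewrite /r addrC subrK.
case: Hr => [r0|[r0 rs]].
  by exists s; eexists; split; [exact: gs|by []|rewrite er r0 addr0; exact: self].
pose q := r / lam r.
have q0 : q != 0 by rewrite mulf_neq0 // invr_eq0.
have sq : sim q r.
  split=> //; first by rewrite /q mulrAC divff // mul1r.
  by rewrite /q invf_div mulrCA divff // mulr1.
have lq : lam q * q = r by rewrite (lam_sim sq) /q mulrC mulfVK.
have qs w : w \in s -> ~ sim q w.
  move=> ws h; apply: (rs w ws); apply: sim_trans (sim_sym sq) _.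
  by apply: sim_trans h (sim_sym (simM w (s0 w ws))).
have gs' := good_basis_cons gs q0 qs; have [us' _ _] := gs'.
have ex : extends s (q :: s) by apply: extends_cons; case/andP: us'.
exists (q :: s), (\sum_(w <- s) c w * w + q); split=> //; rewrite er.
by apply: partial_mapD; [exact/ex/self|rewrite -lq; exact: partial_map_head].
Qed.

Lemma partial_map_family (I : finType) (s : seq S) (Q : I -> S) : good_basis s ->
  exists s' E, [/\ good_basis s', extends s s' & forall i, partial_map s' (Q i) (E i)].
Proof.
move=> gs; suff H (t : seq I) : exists s', [/\ good_basis s', extends s s' &
    forall i, i \in t -> exists e, partial_map s' (Q i) e].
  have [s' [gs' ss' h]] := H (enum I).
  have /choice[E hE] : forall i, exists e, partial_map s' (Q i) e.
    by move=> i; apply: h; rewrite mem_enum.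
  by exists s', E.
elim: t => [|i t [s1 [g1 e1 h1]]]; first by exists s; split=> //; move=> x y.
have [s2 [e [g2 e2 p2]]] := partial_map_forth (Q i) g1.
exists s2; split=> //; first by move=> x y /e1/e2.
move=> j; rewrite inE => /orP[/eqP ->|/h1 [f hf]]; first by exists e.
by exists f; exact: e2.
Qed.

Lemma good_basis1 : good_basis [:: 1].
Proof.
split=> //; first by move=> w; rewrite inE => /eqP ->; exact: oner_neq0.
by move=> w w'; rewrite !mem_seq1 => /eqP -> /eqP ->.
Qed.

Lemma partial_map1 : partial_map [:: 1] 1 1.
Proof. by have := @partial_map_head [::] 1 isT; rewrite lam1 mulr1. Qed.

(* Complete positivity: writing M = Q Q^T, the products of the entries of Q are mapped to
   themselves times a multiplier close to [lam], whose Hankel matrix is positive definite. *)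
Lemma partial_map_psd (d : nat) (s : seq S) (Q M N : 'I_d -> 'I_d -> S) (v : 'I_d -> S) :
  good_basis s -> (forall i j, partial_map s (M i j) (N i j)) ->
  (forall i j, M i j = \sum_k Q i k * Q j k) ->
  0 <= \sum_i \sum_j v i * v j * N i j.
Proof.
move=> gs MN MQ; have [_ ad mK _ _] := coefK.
(* [b] only serves to expand the entries of Q over K; products of its members enter the domain of
   the map through [s']. *)
have [b [E [gb _ bQ]]] := partial_map_family (fun p : 'I_d * 'I_d => Q p.1 p.2) good_basis1.
have /choice[q hq] : forall p : 'I_d * 'I_d, exists c : S -> S,
    (forall w, K (c w)) /\ Q p.1 p.2 = \sum_(w <- b) c w * w.
  by move=> p; have [c [Kc e _]] := bQ p; exists c.
have [ub b0 bd] := gb.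
have [s' [F [gs' ss' hF]]] :=
  partial_map_family (fun p : 'I_(size b) * 'I_(size b) => b`_p.1 * b`_p.2) gs.
pose m (x y : 'I_(size b)) := F (x, y) / (b`_x * b`_y) - lam (b`_x * b`_y).
have bn0 (x : 'I_(size b)) : b`_x != 0 by apply: b0; exact: mem_nth.
have nm x y : negl (m x y).
  case: (partial_map_leading gs' (hF (x, y))) => [[/= e _]|[_ //]].
  by move/eqP: e; rewrite mulf_eq0 (negbTE (bn0 x)) (negbTE (bn0 y)).
pose qq i k (x : 'I_(size b)) := q (i, k) b`_x.
have QE i k : Q i k = \sum_x qq i k x * b`_x.
  by have [_ /= ->] := hq (i, k); rewrite (big_nth 0) big_mkord.
have NE i j : N i j = \sum_k \sum_x \sum_y qq i k x * qq j k y * F (x, y).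
  apply: (partial_map_fun gs' (ss' _ _ (MN i j))).
  rewrite MQ; apply: partial_map_sum => k; rewrite !QE big_distrlr /=.
  apply: partial_map_sum => x; apply: partial_map_sum => y.
  rewrite (_ : qq i k x * b`_x * (qq j k y * b`_y) = qq i k x * qq j k y * (b`_x * b`_y));
    last by ring.
  apply: partial_mapZ; last exact: (hF (x, y)).
  by apply: mK; [have [h _] := hq (i, k)|have [h _] := hq (j, k)]; exact: h.
pose u k (x : 'I_(size b)) := (\sum_i v i * qq i k x) * b`_x.
have -> : \sum_i \sum_j v i * v j * N i j =
    \sum_k \sum_x \sum_y u k x * u k y * (lam (b`_x * b`_y) + m x y).
  transitivity (\sum_k \sum_x \sum_y
      (\sum_i \sum_j v i * v j * (qq i k x * qq j k y)) * F (x, y)).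
    under eq_bigr => i _.
      under eq_bigr => j _ do rewrite NE mulr_sumr.
      rewrite exchange_big /=; over.
    rewrite exchange_big /=; apply: eq_bigr => k _.
    under eq_bigr => i _.
      under eq_bigr => j _ do rewrite mulr_sumr.
      rewrite exchange_big /=; over.
    rewrite exchange_big /=; apply: eq_bigr => x _.
    under eq_bigr => i _.
      under eq_bigr => j _ do rewrite mulr_sumr.
      rewrite exchange_big /=; over.
    rewrite exchange_big /=; apply: eq_bigr => y _.
    rewrite mulr_suml; apply: eq_bigr => i _; rewrite mulr_suml; apply: eq_bigr => j _.
    by ring.
  apply: eq_bigr => k _; apply: eq_bigr => x _; apply: eq_bigr => y _.
  rewrite (_ : lam _ + m x y = F (x, y) / (b`_x * b`_y)); last by rewrite /m addrC subrK.
  rewrite (_ : \sum_i \sum_j _ =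
      (\sum_i v i * qq i k x) * (\sum_i v i * qq i k y)); last first.
    by rewrite big_distrlr /=; apply: eq_bigr => i _; apply: eq_bigr => j _; ring.
  by rewrite /u; field; rewrite !bn0.
have [kap [kap0 kapV kapP]] := lam_pd gb.
apply: sumr_ge0 => k _.
pose ms := \sum_x \sum_y `|m x y|.
pose uu := \sum_x u k x ^+ 2.
have uu0 : 0 <= uu by apply: sumr_ge0 => x _; exact: sqr_ge0.
have main : kap * uu <= \sum_x \sum_y u k x * u k y * lam (b`_x * b`_y).
  pose u' w := if insub (index w b) is Some x then u k x else 0.
  have u'E (x : 'I_(size b)) : u' b`_x = u k x.
    by rewrite /u' index_uniq // valK.
  have e1 : \sum_(w <- b) u' w ^+ 2 = uu.
    by rewrite (big_nth 0) big_mkord; apply: eq_bigr => x _; rewrite u'E.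
  have e2 : \sum_(w <- b) \sum_(w' <- b) u' w * u' w' * lam (w * w') =
      \sum_x \sum_y u k x * u k y * lam (b`_x * b`_y).
    rewrite (big_nth 0) big_mkord; apply: eq_bigr => x _.
    by rewrite (big_nth 0) big_mkord; apply: eq_bigr => y _; rewrite !u'E.
  by rewrite -e1 -e2; exact: kapP.
have err : `|\sum_x \sum_y u k x * u k y * m x y| <= ms * uu.
  rewrite /ms mulr_suml; apply: le_trans (ler_norm_sum _ _ _) _; apply: ler_sum => x _.
  rewrite mulr_suml; apply: le_trans (ler_norm_sum _ _ _) _; apply: ler_sum => y _.
  rewrite normrM mulrC ler_wpM2l //.
  have ux z : u k z ^+ 2 <= uu.
    by rewrite /uu (bigD1 z) //= lerDl sumr_ge0 // => t _; exact: sqr_ge0.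
  have h1 := ux x; have h2 := ux y.
  have := sqr_ge0 (u k x - u k y); have := sqr_ge0 (u k x + u k y).
  rewrite sqrrB sqrrD ler_norml; lra.
(* The deviations from [lam] are negligible while [kap] has a bounded inverse, so the definiteness
   of the kernel absorbs them. *)
have msk : ms <= kap.
  have nms : negl (ms / kap).
    apply: neglMl => //; apply: negl_sum => x _; apply: negl_sum => y _.
    by move=> j; rewrite normr_id; exact: nm.
  have := nms 0%N; rewrite expr0 mulr1 => h.
  have := le_trans (ler_norm _) h; rewrite ler_pdivrMr // mul1r //.
have -> : \sum_x \sum_y u k x * u k y * (lam (b`_x * b`_y) + m x y) =
    \sum_x \sum_y u k x * u k y * lam (b`_x * b`_y) + \sum_x \sum_y u k x * u k y * m x y.
  rewrite -big_split; apply: eq_bigr => x _; rewrite -big_split; apply: eq_bigr => y _ /=.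
  by ring.
have : ms * uu <= kap * uu by rewrite ler_wpM2r.
by move: err; rewrite ler_norml => /andP[e1 e2]; lra.
Qed.

End PartialMaps.

(** * The multiplier on the ultrapower *)

Section LogClass.
Variable R : realType.
Local Notation S := (hyper R).
Local Notation emb := (@emb R).

(** The logarithm of the absolute value to base [tau]: bounded elements are those below a natural
    number on this scale, and products become the sums on which the Hankel kernel is evaluated. *)
Definition ell (x : S) : S := cls (fun n => ln `|rp x n| / n%:R ^+ 2).

Lemma rp_neq0 (x : S) : x != 0 -> ev (fun n => rp x n != 0).
Proof.
move=> x0; have /ev_not : ~ ev (fun n => rp x n = 0).
  by move=> h; case/eqP: x0; apply/rpE; apply: ev_mono2 h (rp0 R) => n -> ->.
by apply: ev_mono => n /eqP.
Qed.

Lemma ev_pos : ev (fun n => 0 < n%:R :> R).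
Proof. exact/ev_oo/nbhs_infty_gtr. Qed.

Lemma ellM x y : x != 0 -> y != 0 -> ell (x * y) = ell x + ell y.
Proof.
move=> /rp_neq0 x0 /rp_neq0 y0.
rewrite -[RHS]rpK; apply/clsE.
apply: ev_mono2 (ev_and x0 (ev_and y0 (rpM x y)))
  (ev_and (rpD (ell x) (ell y)) (ev_and (clsK (fun n => ln `|rp x n| / n%:R ^+ 2))
     (clsK (fun n => ln `|rp y n| / n%:R ^+ 2)))).
move=> n [x0' [y0' ->]] [-> [-> ->]].
by rewrite normrM lnM ?posrE ?normr_gt0 // mulrDl.
Qed.

Lemma ell1 : ell 1 = 0.
Proof.
by apply/clsE; apply: ev_mono (rp1 R) => n ->; rewrite normr1 ln1 mul0r.
Qed.

Lemma ellV x : x != 0 -> ell x^-1 = - ell x.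
Proof.
move=> x0; apply/eqP; rewrite -subr_eq0 opprK -ellM ?invr_eq0 //.
by rewrite mulVf // ell1.
Qed.

Lemma ellN x : ell (- x) = ell x.
Proof. by apply/clsE; apply: ev_mono (rpN x) => n ->; rewrite normrN. Qed.

Lemma rp_tauX j : ev (fun n => rp (@tau R ^+ j) n = expR (j%:R * n%:R ^+ 2)).
Proof.
apply: ev_mono2 (rpX (tau R) j) (clsK (fun n => expR (n%:R ^+ 2) : R)) => n -> ->.
by rewrite expRM_natl.
Qed.

Lemma rp_ell x : ev (fun n => rp (ell x) n = ln `|rp x n| / n%:R ^+ 2).
Proof. exact: clsK. Qed.

Lemma ell_bdd x : x != 0 -> (bdd x <-> exists j : nat, ell x <= emb j%:R).
Proof.
move=> /rp_neq0 x0; split=> -[j /rp_le h]; exists j; apply/rp_le.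
  apply: ev_mono2 (ev_and h (ev_and x0 (rp_norm x)))
    (ev_and (rp_tauX j) (ev_and (rp_ell x) (ev_and (rp_emb (j%:R : R)) ev_pos))).
  move=> n [h1 [x1 e1]] [e2 [-> [-> n0]]]; rewrite e1 e2 in h1.
  rewrite ler_pdivrMr ?exprn_gt0 // -[leRHS]expRK ler_ln ?posrE ?normr_gt0 ?expR_gt0 //.
apply: ev_mono2 (ev_and h (ev_and x0 (rp_norm x)))
  (ev_and (rp_tauX j) (ev_and (rp_ell x) (ev_and (rp_emb (j%:R : R)) ev_pos))).
move=> n [h1 [x1 ->]] [-> [e1 [e2 n0]]]; rewrite e1 e2 in h1.
rewrite -[leLHS]lnK ?posrE ?normr_gt0 // ler_expR.
by rewrite -ler_pdivrMr ?exprn_gt0.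
Qed.

Lemma sim_ell x y : x != 0 -> y != 0 -> (sim x y <-> fin (ell x - ell y)).
Proof.
move=> x0 y0; have xy0 : x / y != 0 by rewrite mulf_neq0 // invr_eq0.
have yx0 : y / x != 0 by rewrite mulf_neq0 // invr_eq0.
have exy : ell (x / y) = ell x - ell y by rewrite ellM ?invr_eq0 // ellV.
have eyx : ell (y / x) = ell y - ell x by rewrite ellM ?invr_eq0 // ellV.
split.
  move=> [_ _ /(ell_bdd xy0)[j hj] /(ell_bdd yx0)[k hk]].
  rewrite exy in hj; rewrite eyx in hk.
  exists (j%:R + k%:R); rewrite rmorphD ler_norml.
  have j0 : 0 <= emb j%:R by rewrite -(rmorph0 emb) emb_le.
  have k0 : 0 <= emb k%:R by rewrite -(rmorph0 emb) emb_le.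
  lra.
move=> [r hr]; have [j jr] : exists j : nat, r <= j%:R.
  have [N _ HN] := @nbhs_infty_ger R r.
  by exists N; apply: (HN N) => /=.
have {hr jr} : `|ell x - ell y| <= emb j%:R by apply: (le_trans hr); rewrite emb_le.
rewrite ler_norml => /andP[h1 h2]; split=> //.
  by apply/(ell_bdd xy0); exists j; rewrite exy.
by apply/(ell_bdd yx0); exists j; rewrite eyx; lra.
Qed.

Variable beta : S -> S -> R.
Hypothesis betaC : forall x y, beta x y = beta y x.
Hypothesis betaD : forall x y z, beta (x + y) z = beta x z + beta y z.
Hypothesis beta_ge0 : forall x, 0 <= beta x x.
Hypothesis beta_fin : forall x, beta x x = 0 <-> fin x.
Hypothesis beta_base : forall i j : 'I_5, beta (base R i) (base R j) = (i == j)%:R.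

Local Notation e := (fun i : 'I_5 => base R i).

(** The multiplier sees x only through [beta], whose null vectors are the finite elements. *)
Lemma multiplier_congr n x y : fin (x - y) -> multiplier beta e n x = multiplier beta e n y.
Proof.
move=> /beta_fin xy; have rad z : beta x z = beta y z.
  have := sqn0_beta betaC betaD beta_ge0 z xy.
  by rewrite betaD (betaN betaD); lra.
have coE i : co beta e i x = co beta e i y by exact: rad.
have sqE z : sqn beta (x - z) = sqn beta (y - z).
  by rewrite !sqnB // /sqn !rad (betaC y x) rad.
have sqE0 : sqn beta x = sqn beta y by have := sqE 0; rewrite !subr0.
have offE : off_simplex beta e x = off_simplex beta e y.
  rewrite /off_simplex (eq_bigr (fun i => (`|co beta e i y| - co beta e i y) / 2)); last first.
    by move=> i _; rewrite coE.
  by congr (_ + `|_ - _|); apply: eq_bigr => i _; exact: coE.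
have vE : vertex beta e x = vertex beta e y by apply: eq_existsb => i; rewrite sqE.
rewrite /multiplier /perturbation offE vE sqE0; congr (_ + _).
by apply: eq_bigr => F _; apply: eq_bigr => k _; rewrite /face_log !coE.
Qed.

Definition Lam (x : S) : S := cls (fun n => multiplier beta e n x).

Definition gap : S := cls (fun n => expR (- n%:R) / 4).

Lemma rp_Lam x : ev (fun n => rp (Lam x) n = multiplier beta e n x).
Proof. exact: clsK. Qed.

Lemma rp_gap : ev (fun n => rp gap n = expR (- n%:R) / 4).
Proof. exact: clsK. Qed.

Lemma gap_gt0 : 0 < gap.
Proof.
apply/rp_lt; apply: ev_mono2 (rp0 R) rp_gap => n -> ->.
by rewrite divr_gt0 // expR_gt0.
Qed.

Lemma gapV_bdd : bdd gap^-1.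
Proof.
exists 5%N; apply/rp_le.
apply: ev_mono2 (ev_and (rp_norm gap^-1) (ev_and (rpV gap) rp_gap))
  (ev_and (rp_tauX 5) ev_pos).
move=> n [-> [-> ->]] [-> n0].
have n1 : 1 <= n%:R :> R by rewrite ler1n -(ltr_nat R).
have n2 : n%:R <= n%:R ^+ 2 :> R by rewrite expr2 ler_peMr //; lra.
rewrite invf_div -expRN opprK ger0_norm ?mulr_ge0 ?expR_ge0 //.
rewrite (_ : 5 * n%:R ^+ 2 = 4 * n%:R ^+ 2 + n%:R ^+ 2); last by ring.
rewrite expRD ler_pM ?expR_ge0 // ?ler_expR //.
by apply: le_trans (expR_ge1Dx _); lra.
Qed.

(** Definiteness for the single class x / 2, whose Hankel matrix is the number [Lam x]. *)
Lemma Lam_ge_gap x : gap <= Lam x.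
Proof.
pose y := emb (2^-1) * x.
have xy : x = y + y.
  rewrite /y -mulrDl -rmorphD (_ : 2^-1 + 2^-1 = 1 :> R) ?rmorph1 ?mul1r //; lra.
have sep (a b : 'I_1) : a != b -> sqn beta (y - y) != 0 by rewrite !ord1 eqxx.
have := @multiplier_positive_definite R S beta e betaC betaD beta_ge0 beta_base _ (fun=> y) sep.
move=> /ev_oo H; apply/rp_le; apply: ev_mono2 H (ev_and rp_gap (rp_Lam x)).
move=> n /(_ (fun=> 1)); rewrite !big_ord1 expr1n !mulr1 mul1r -xy => h [-> ->].
exact: h.
Qed.

Lemma Lam_gt0 x : 0 < Lam x.
Proof. exact: lt_le_trans gap_gt0 (Lam_ge_gap x). Qed.

Lemma Lam_bdd x : bdd (Lam x).
Proof.
have [j /ev_oo H] := @multiplier_growth R S beta e beta_ge0 x.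
exists j; apply/rp_le.
by apply: ev_mono2 (ev_and H (rp_Lam x)) (ev_and (rp_norm (Lam x)) (rp_tauX j)) =>
  n [h e1] [-> ->]; rewrite e1.
Qed.

Lemma LamV_bdd x : bdd (Lam x)^-1.
Proof.
apply: bdd_le gapV_bdd; rewrite !normfV !gtr0_norm ?gap_gt0 ?Lam_gt0 //.
by rewrite lef_pV2 ?posrE ?gap_gt0 ?Lam_gt0 // Lam_ge_gap.
Qed.

(** The normalization fixes 1 and with it all of K, as the constant matrices in a linear matrix
    inequality require. *)
Definition lam (x : S) : S := Lam (ell x) / Lam 0.

Lemma lam_gt0 x : 0 < lam x.
Proof. by rewrite divr_gt0 // Lam_gt0. Qed.

Lemma lam_neq0 x : lam x != 0.
Proof. by rewrite gt_eqF // lam_gt0. Qed.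

Lemma lam_bdd x : bdd (lam x).
Proof. by apply: bddM; [exact: Lam_bdd|exact: LamV_bdd]. Qed.

Lemma lamV_bdd x : bdd (lam x)^-1.
Proof. by rewrite invf_div; apply: bddM; [exact: Lam_bdd|exact: LamV_bdd]. Qed.

Lemma lam1 : lam 1 = 1.
Proof. by rewrite /lam ell1 divff // gt_eqF // Lam_gt0. Qed.

Lemma lam_sim x y : sim x y -> lam x = lam y.
Proof.
move=> [x0 y0 h1 h2]; have /(sim_ell x0 y0) xy : sim x y by [].
rewrite /lam; congr (_ / _); apply/clsE/evT => n; exact: multiplier_congr.
Qed.

Lemma rp_sum2 (I J : finType) (F : I -> J -> S) :
  ev (fun n => rp (\sum_i \sum_j F i j) n = \sum_i \sum_j rp (F i j) n).
Proof.
apply: ev_mono2 (rp_sum (index_enum I) (fun i => \sum_j F i j))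
  (ev_fin (fun i => rp_sum (index_enum J) (F i))) => n -> h.
by apply: eq_bigr => i _; rewrite h.
Qed.

Lemma Lam_pd (I : finType) (c : I -> S) (u : I -> S) :
  (forall a b, a != b -> ~ fin (c a - c b)) ->
  gap * \sum_a u a ^+ 2 <= \sum_a \sum_b u a * u b * Lam (c a + c b).
Proof.
move=> csep.
have sep a b : a != b -> sqn beta (c a - c b) != 0.
  by move=> /csep nf; apply/eqP => /beta_fin.
have /ev_oo H := @multiplier_positive_definite R S beta e betaC betaD beta_ge0 beta_base
  I c sep.
apply/rp_le.
have h1 := rpM gap (\sum_a u a ^+ 2).
have h2 := rp_sum (index_enum I) (fun a => u a ^+ 2).
have h3 := ev_fin (fun a => rpX (u a) 2).
have h4 := rp_sum2 (fun a b => u a * u b * Lam (c a + c b)).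
have h5 : ev (fun n => forall a b, rp (u a * u b * Lam (c a + c b)) n =
    rp (u a) n * rp (u b) n * multiplier beta e n (c a + c b)).
  apply: ev_fin => a; apply: ev_fin => b.
  apply: ev_mono2 (ev_and (rpM (u a * u b) (Lam (c a + c b))) (rpM (u a) (u b)))
    (rp_Lam (c a + c b)) => n [-> ->] -> //.
apply: ev_mono2 (ev_and H (ev_and h1 (ev_and h2 h3))) (ev_and rp_gap (ev_and h4 h5)).
move=> n [Hn [-> [-> e3]]] [-> [-> e5]].
rewrite (eq_bigr (fun a => rp (u a) n ^+ 2)); last by move=> a _; exact: e3.
apply: (le_trans (Hn (fun a => rp (u a) n))); rewrite le_eqVlt; apply/orP; left; apply/eqP.
by apply: eq_bigr => a _; apply: eq_bigr => b _; rewrite e5.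
Qed.

Lemma lam_pd s : good_basis s -> exists k : S,
  [/\ 0 < k, bdd k^-1 & forall u : S -> S,
     k * \sum_(b <- s) u b ^+ 2 <= \sum_(b <- s) \sum_(b' <- s) u b * u b' * lam (b * b')].
Proof.
move=> [us s0 sd]; exists (gap / Lam 0); split.
- by rewrite divr_gt0 ?gap_gt0 ?Lam_gt0.
- by rewrite invf_div; apply: bddM; [exact: Lam_bdd|exact: gapV_bdd].
move=> u.
have n0 (a : 'I_(size s)) : s`_a != 0 by apply: s0; exact: mem_nth.
have csep (a b : 'I_(size s)) : a != b -> ~ fin (ell s`_a - ell s`_b).
  move=> ab /(sim_ell (n0 a) (n0 b)) h; case/eqP: ab; apply/val_inj/eqP.
  have e : s`_a = s`_b := sd _ _ (mem_nth 0 (ltn_ord a)) (mem_nth 0 (ltn_ord b)) h.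
  by rewrite -(nth_uniq 0 (ltn_ord a) (ltn_ord b) us) e.
have := Lam_pd (fun a : 'I_(size s) => u s`_a) csep.
rewrite -(ler_pM2r (x := (Lam 0)^-1)) ?invr_gt0 ?Lam_gt0 // => h.
rewrite mulrAC (_ : \sum_(b <- s) u b ^+ 2 = \sum_(a < size s) u s`_a ^+ 2); last first.
  by rewrite (big_nth 0) big_mkord.
apply: (le_trans h); rewrite le_eqVlt; apply/orP; left; apply/eqP.
rewrite [RHS](big_nth 0) big_mkord mulr_suml; apply: eq_bigr => a _.
rewrite [RHS](big_nth 0) big_mkord mulr_suml; apply: eq_bigr => b _.
by rewrite /lam ellM // mulrA.
Qed.

Lemma horn_Lam_negative :
  \sum_(i : 'I_5) \sum_(j : 'I_5) emb (horn R i j) * Lam (base R i + base R j) <= - gap.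
Proof.
have /ev_oo H := @horn_multiplier_negative R S beta e betaC betaD beta_base.
apply/rp_le.
have h4 := rp_sum2 (fun i j : 'I_5 => emb (horn R i j) * Lam (base R i + base R j)).
have h5 : ev (fun n => forall i j : 'I_5, rp (emb (horn R i j) * Lam (base R i + base R j)) n =
    horn R i j * multiplier beta e n (base R i + base R j)).
  apply: ev_fin => i; apply: ev_fin => j.
  apply: ev_mono2 (ev_and (rpM (emb (horn R i j)) (Lam (base R i + base R j)))
    (rp_emb (horn R i j))) (rp_Lam (base R i + base R j)) => n [-> ->] -> //.
apply: ev_mono2 (ev_and H (ev_and h4 h5)) (ev_and (rpN gap) rp_gap).
move=> n [Hn [-> e5]] [-> ->].
under eq_bigr do under eq_bigr do rewrite e5.
by apply: (le_trans Hn); have := expR_gt0 (- n%:R : R); lra.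
Qed.

Definition scale_elt (i : nat) : S := cls (fun n => expR (n%:R ^+ 2 * n%:R ^+ i.+1)).

Lemma rp_scale_elt i : ev (fun n => rp (scale_elt i) n = expR (n%:R ^+ 2 * n%:R ^+ i.+1)).
Proof. exact: clsK. Qed.

Lemma scale_elt_gt0 i : 0 < scale_elt i.
Proof.
by apply/rp_lt; apply: ev_mono2 (rp0 R) (rp_scale_elt i) => n -> ->; exact: expR_gt0.
Qed.

Lemma ell_scale_elt i : ell (scale_elt i) = base R i.
Proof.
rewrite -[RHS]rpK; apply/clsE.
apply: ev_mono2 (ev_and (rp_scale_elt i) ev_pos)
  (ev_and (rpX (hyper_nat R) i.+1) (clsK (fun n => n%:R : R))).
move=> n [-> n0] [-> ->]; rewrite gtr0_norm ?expR_gt0 // expRK.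
by rewrite mulrAC divff ?mul1r // expf_neq0 // gt_eqF.
Qed.

End LogClass.

(** * Transfer of positive formulas *)

(** Cholesky factorization by induction: a positive corner leaves the Schur complement, a zero
    corner forces the rest of its row to vanish. *)
Lemma psd_gram (R : realType) (n : nat) (A : 'M[R]_n) :
  psd A -> exists Q : 'M[R]_n, A = Q *m Q^T.
Proof.
elim: n A => [|n IH] A [/symmetricmxP AT pos]; first by exists 0; apply/matrixP => -[].
pose a := (ulsubmx (A : 'M_(1 + n))) ord0 ord0.
pose b : 'rV[R]_n := ursubmx (A : 'M_(1 + n)).
pose D : 'M[R]_n := drsubmx (A : 'M_(1 + n)).
have AE : A = block_mx a%:M b b^T D.
  have dl : dlsubmx (A : 'M_(1 + n)) = b^T by rewrite /b trmx_ursub AT.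
  by rewrite -[LHS](submxK (A : 'M_(1 + n))) dl /a -mx11_scalar.
have DT : D^T = D by rewrite /D trmx_drsub AT.
pose q t (y : 'cV[R]_n) :=
  a * t ^+ 2 + 2 * t * (b *m y) ord0 ord0 + (y^T *m D *m y) ord0 ord0.
have q_ge0 t y : 0 <= q t y.
  have h : 0 <= ((col_mx t%:M y)^T *m block_mx a%:M b b^T D *m col_mx t%:M y) ord0 ord0.
    by rewrite -AE; exact: pos.
  apply: le_trans h _; rewrite le_eqVlt; apply/orP; left; apply/eqP.
  rewrite tr_col_mx mul_row_block mul_row_col !mulmxDl tr_scalar_mx.
  rewrite (_ : y^T *m b^T *m t%:M = (b *m y)^T *m t%:M); last by rewrite trmx_mul.
  rewrite -(mulmxA t%:M b y) [b *m y]mx11_scalar tr_scalar_mx -!scalar_mxM /q.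
  move: (y^T *m D *m y) => Y; rewrite !mxE eqxx !mulr1n; ring.
suff [Q QE] : exists Q : 'M[R]_(1 + n), block_mx a%:M b b^T D = Q *m Q^T.
  by exists Q; rewrite AE.
have a0 : 0 <= a.
  by have := q_ge0 1 0; rewrite /q !mulmx0 !mxE expr1n !mulr1 mulr0 !addr0.
have [az|an0] := eqVneq a 0.
  have by0 (y : 'cV[R]_n) : (b *m y) ord0 ord0 = 0.
    apply: contrapT => /eqP c0; set c := (b *m y) ord0 ord0 in c0.
    pose d := (y^T *m D *m y) ord0 ord0.
    (* This value of t makes the form equal to -1. *)
    have := q_ge0 (- (d + 1) / (2 * c)) y; rewrite /q az mul0r add0r -/c -/d.
    by rewrite (_ : 2 * (- (d + 1) / (2 * c)) * c = - (d + 1)); [lra|field].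
  have b0 : b = 0.
    apply/rowP => j; have := by0 (delta_mx j ord0); rewrite -colE !mxE.
    by move=> ->.
  have [|Q DQ] := IH D.
    split; first exact/symmetricmxP.
    by move=> y; have := q_ge0 0 y; rewrite /q expr0n /= !mulr0 mul0r !add0r.
  exists (block_mx 0 0 0 Q).
  rewrite tr_block_mx mulmx_block !trmx0 !mulmx0 !mul0mx !addr0 add0r -DQ az b0 trmx0.
  by congr block_mx; rewrite -scalemx1 scale0r.
have ap : 0 < a by rewrite lt_neqAle eq_sym an0.
pose r := Num.sqrt a.
have rr : r * r = a by rewrite -expr2 sqr_sqrtr.
have r0 : r != 0 by rewrite gt_eqF // sqrtr_gt0.
pose D' := D - a^-1 *: (b^T *m b).
have [|Q DQ] := IH D'.
  split; first by apply/symmetricmxP; rewrite /D' linearB linearZ /= trmx_mul trmxK DT.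
  (* The minimizer in t, at which the form of A is that of the Schur complement. *)
  move=> y; have := q_ge0 (- (b *m y) ord0 ord0 / a) y.
  have E : y^T *m D' *m y = y^T *m D *m y - a^-1 *: ((b *m y)^T *m (b *m y)).
    by rewrite /D' mulmxBr mulmxBl -scalemxAr -scalemxAl trmx_mul !mulmxA.
  have sq : ((b *m y)^T *m (b *m y)) ord0 ord0 = (b *m y) ord0 ord0 ^+ 2.
    have := mx11_scalar (b *m y); move: ((b *m y) ord0 ord0) => c ->.
    by rewrite tr_scalar_mx -scalar_mxM mxE eqxx mulr1n expr2.
  have -> : (y^T *m D' *m y) ord0 ord0 =
      (y^T *m D *m y) ord0 ord0 - a^-1 * (b *m y) ord0 ord0 ^+ 2.
    rewrite E -sq; move: (y^T *m D *m y) ((b *m y)^T *m (b *m y)) => X Y.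
    by rewrite !mxE.
  rewrite /q => h.
  by apply: le_trans h _; rewrite le_eqVlt; apply/orP; left; apply/eqP; field.
exists (block_mx r%:M 0 (r^-1 *: b^T) Q).
rewrite tr_block_mx mulmx_block tr_scalar_mx !trmx0 !mulmx0 !mul0mx !addr0.
congr block_mx.
- by rewrite -scalar_mxM rr.
- by rewrite linearZ /= trmxK mul_scalar_mx scalerA divff // scale1r.
- by rewrite mul_mx_scalar scalerA divff // scale1r.
- rewrite linearZ /= trmxK -scalemxAl -scalemxAr scalerA -invfM rr -DQ /D'.
  by rewrite addrC subrK.
Qed.

(** * Spectrahedral shadows as positive formulas *)

Section ShadowDefinable.

Lemma extend_row_mx (D : Type) (l m : nat) (d : D) (y : 'rV[D]_l) (x : 'rV[D]_m) :
  extend d (row_mx y x) = row_mx (extend d y) x :> 'rV[D]_(l.+1 + m).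
Proof.
apply/rowP => k; case: (unliftP ord0 k) => [k'|] ->; last first.
  rewrite extend0 (_ : ord0 = lshift m ord0 :> 'I_(l.+1 + m)); last exact/val_inj.
  by rewrite row_mxEl extend0.
rewrite extendS; case: (split_ordP k') => j ->.
  rewrite (_ : lift ord0 (lshift m j) = lshift m (lift ord0 j)); last exact/val_inj.
  by rewrite !row_mxEl extendS.
rewrite (_ : lift ord0 (rshift l j) = rshift l.+1 j); last exact/val_inj.
by rewrite !row_mxEr.
Qed.

Fixpoint exists_block (sg : signature) (m l : nat) :
    positive_formula sg (l + m) -> positive_formula sg m :=
  match l return positive_formula sg (l + m) -> positive_formula sg m with
  | 0 => id
  | l'.+1 => fun f => @exists_block sg m l' (PEx f)
  end.

Lemma holds_exists_block (sg : signature) (D : Type) (M : structure sg D) (m l : nat)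
    (f : positive_formula sg (l + m)) (x : 'rV[D]_m) :
  holds M (exists_block f) x <-> exists y : 'rV[D]_l, holds M f (row_mx y x).
Proof.
elim: l f => [|l IH] f /=.
  split=> [h|[y]]; last by rewrite row_thin_mx.
  by exists (\row_(j < 0) False_rect D (notF (ltn_ord j))); rewrite row_thin_mx.
apply: (iff_trans (IH (PEx f))) => /=; split=> [[y [d h]]|[y h]].
  by exists (extend d y); rewrite -extend_row_mx.
exists (\row_j y ord0 (lift ord0 j)), (y ord0 ord0).
rewrite extend_row_mx (_ : extend _ _ = y) //; apply/rowP => k.
by case: (unliftP ord0 k) => [k'|] ->; rewrite ?extend0 ?extendS ?mxE.
Qed.

Lemma spectrahedral_shadow_definable (R : realType) (m : nat) (K : set 'rV[R]_m) :
  spectrahedral_shadow K -> positively_definable (spec_structure R) K.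
Proof.
move=> [d [l [A0 [A [B [A0s As Bs ->]]]]]].
pose C (k : 'I_(l + m)) := match fintype.split k with inl j => B j | inr i => A i end.
pose K' : set 'rV[R]_(l + m) := [set z | psd (A0 + \sum_k z ord0 k *: C k)].
have hK' : spectrahedron K'.
  by exists d, A0, C; split=> // k; rewrite /C; case: (fintype.split k).
pose f : positive_formula (spec_signature R) (l + m) :=
  @PRel (spec_signature R) (l + m) (Spec hK') id.
exists (exists_block f); apply/seteqP.
have E (y : 'rV[R]_l) (x : 'rV[R]_m) : holds (spec_structure R) f (row_mx y x) <->
    psd (A0 + \sum_i x ord0 i *: A i + \sum_j y ord0 j *: B j).
  rewrite /= /K' /= (_ : \sum_k _ = \sum_j y ord0 j *: B j + \sum_i x ord0 i *: A i).
    by rewrite addrAC addrA.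
  rewrite big_split_ord /=; congr (_ + _); apply: eq_bigr => k _; rewrite mxE /C.
    by rewrite row_mxEl (unsplitK (inl k)).
  by rewrite row_mxEr (unsplitK (inr k)).
split=> x /=.
  by move=> [y h]; apply/holds_exists_block; exists y; apply/E.
by move=> /holds_exists_block [y /E h]; exists y.
Qed.

End ShadowDefinable.

(** * The theorem of Los and stability of definable sets *)

Section Transfer.
Variable R : realType.
Local Notation S := (hyper R).
Local Notation emb := (@emb R).

Definition rvec (m : nat) (x : 'rV[S]_m) (n : nat) : 'rV[R]_m := map_mx (fun s => rp s n) x.

Lemma rvecE m (x : 'rV[S]_m) n k : rvec x n ord0 k = rp (x ord0 k) n.
Proof. by rewrite mxE. Qed.

Lemma rvec_extend m (d : S) (x : 'rV[S]_m) n :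
  rvec (extend d x) n = extend (rp d n) (rvec x n).
Proof.
apply/rowP => k; case: (unliftP ord0 k) => [k'|] ->; rewrite [LHS]mxE.
  by rewrite !extendS mxE.
by rewrite !extend0.
Qed.

Lemma rvec_cls m (f : nat -> 'rV[R]_m) :
  ev (fun n => rvec (\row_k cls (fun n => f n ord0 k)) n = f n).
Proof.
have h := ev_fin (fun k : 'I_m => clsK (fun n => f n ord0 k)).
by apply: ev_mono h => n h; apply/rowP => k; rewrite !mxE.
Qed.

Definition hyper_structure : structure (spec_signature R) S :=
  fun s => [set x | ev (fun n => spec_structure R s (rvec x n))].

(** For an existential quantifier witnesses are chosen coordinate by coordinate, for a universal one
    counterexamples, with 0 where there are none; disjunction uses that the filter is an
    ultrafilter. *)
Lemma los m (f : positive_formula (spec_signature R) m) (x : 'rV[S]_m) :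
  holds hyper_structure f x <-> ev (fun n => holds (spec_structure R) f (rvec x n)).
Proof.
elim: m / f x => [m s args|m i j|m f IHf g IHg|m f IHf g IHg|m f IHf|m f IHf] x /=.
- rewrite /hyper_structure /=.
  have E n : rvec (\row_k x ord0 (args k)) n = \row_k rvec x n ord0 (args k).
    by apply/rowP => k; rewrite !mxE.
  by split; apply: ev_mono => n; rewrite E.
- by rewrite rpE; split; apply: ev_mono => n; rewrite !mxE.
- split=> [[/IHf p /IHg q]|h]; first exact: ev_and.
  by split; [apply/IHf|apply/IHg]; apply: ev_mono h => n [].
- by rewrite ev_or IHf IHg.
- split=> [[d /IHf h]|h].
    by apply: ev_mono h => n; rewrite rvec_extend; exists (rp d n).
  have /choice[r hr] : forall n, exists r,
      (exists d, holds (spec_structure R) f (extend d (rvec x n))) ->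
      holds (spec_structure R) f (extend r (rvec x n)).
    move=> n.
    have [[d hd]|no] := pselect (exists d, holds (spec_structure R) f (extend d (rvec x n))).
      by exists d.
    by exists 0 => /no.
  exists (cls r); apply/IHf; apply: ev_mono2 h (clsK r) => n /hr + e.
  by rewrite rvec_extend e.
- split=> [h|h d]; last first.
    by apply/IHf; apply: ev_mono h => n; rewrite rvec_extend.
  apply: contrapT => /ev_not nh.
  have /choice[r hr] : forall n, exists r,
      (~ forall d, holds (spec_structure R) f (extend d (rvec x n))) ->
      ~ holds (spec_structure R) f (extend r (rvec x n)).
    move=> n; have [all|/existsNP[d hd]] :=
      pselect (forall d, holds (spec_structure R) f (extend d (rvec x n))).
      by exists 0.
    by exists d.
  have /IHf h1 := h (cls r).
  have [n [/hr nr [h2 e]]] := ev_ex (ev_and nh (ev_and h1 (clsK r))).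
  by apply: nr; rewrite rvec_extend e in h2.
Qed.

Variables (K : set S) (lam : S -> S).
Hypothesis coefK : coef_ring K.
Hypothesis residueK : forall x, bdd x -> exists2 c, K c & negl (x - c).
Hypothesis lam_bdd : forall x, bdd (lam x).
Hypothesis lamV_bdd : forall x, bdd (lam x)^-1.
Hypothesis lam_neq0 : forall x, lam x != 0.
Hypothesis lam_sim : forall x y, sim x y -> lam x = lam y.
Hypothesis lam1 : lam 1 = 1.
Hypothesis lam_pd : forall s, good_basis s -> exists k : S,
  [/\ 0 < k, bdd k^-1 & forall u : S -> S,
     k * \sum_(b <- s) u b ^+ 2 <= \sum_(b <- s) \sum_(b' <- s) u b * u b' * lam (b * b')].

Local Notation pmap := (partial_map K lam).

Definition matched m (x y : 'rV[S]_m) : Prop :=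
  exists s, [/\ good_basis s, pmap s 1 1 & forall i, pmap s (x ord0 i) (y ord0 i)].

Lemma matched_exists m (x : 'rV[S]_m) : exists y, matched x y.
Proof.
have [s [E [gs ext h]]] := partial_map_family lam coefK residueK
  (fun i => x ord0 i) (good_basis1 R).
exists (\row_i E i), s; split=> //; last by move=> i; rewrite mxE.
by apply: ext; exact: partial_map1.
Qed.

Lemma matched_extend m (x y : 'rV[S]_m) d e s : good_basis s -> pmap s 1 1 ->
  (forall i, pmap s (x ord0 i) (y ord0 i)) -> pmap s d e ->
  matched (extend d x) (extend e y).
Proof.
move=> gs p1 p pd; exists s; split=> // i.
by case: (unliftP ord0 i) => [k|] ->; rewrite ?extendS ?extend0.
Qed.

Lemma matched_forth m (x y : 'rV[S]_m) d : matched x y ->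
  exists e, matched (extend d x) (extend e y).
Proof.
move=> [s [gs p1 p]].
have [s' [e [gs' ext pd]]] := partial_map_forth lam coefK residueK d gs.
by exists e; apply: (matched_extend (s := s')) => //; [exact: ext|move=> i; exact: ext].
Qed.

Lemma matched_back m (x y : 'rV[S]_m) e : matched x y ->
  exists d, matched (extend d x) (extend e y).
Proof.
move=> [s [gs p1 p]].
have [s' [d [gs' ext pd]]] :=
  partial_map_back coefK residueK lam_bdd lamV_bdd lam_neq0 lam_sim e gs.
by exists d; apply: (matched_extend (s := s')) => //; [exact: ext|move=> i; exact: ext].
Qed.

Lemma matched_eq m (x y : 'rV[S]_m) i j : matched x y ->
  x ord0 i = x ord0 j <-> y ord0 i = y ord0 j.
Proof.
move=> [s [gs p1 p]].
have h := partial_mapD coefK (p i) (partial_mapN coefK (p j)).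
have [h1 h2] := partial_map0 coefK lam_bdd lamV_bdd lam_neq0 lam_sim gs h.
split=> e; apply/eqP; rewrite -subr_eq0; apply/eqP; last by apply: h2; rewrite e subrr.
by apply: h1; rewrite e subrr.
Qed.

(** Gram factors chosen in each coordinate give the factorization over S that [partial_map_psd]
    takes. If the image failed to be positive semidefinite, negative directions chosen in each
    coordinate would form a vector over S contradicting its conclusion. *)
Lemma matched_spectrahedron m (X : set 'rV[R]_m) (x y : 'rV[S]_m) : spectrahedron X ->
  matched x y -> ev (fun n => X (rvec x n)) -> ev (fun n => X (rvec y n)).
Proof.
move=> [d [A0 [A [A0s As ->]]]] [s [gs p1 p]] hx.
pose P (z : 'rV[R]_m) := A0 + \sum_i z ord0 i *: A i.
have PE z i j : P z i j = A0 i j + \sum_k z ord0 k * A k i j.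
  rewrite mxE summxE; congr (_ + _); apply: eq_bigr => k _; by rewrite mxE.
pose PS (z : 'rV[S]_m) i j := emb (A0 i j) + \sum_k z ord0 k * emb (A k i j).
have rpPS z : ev (fun n => forall i j, rp (PS z i j) n = P (rvec z n) i j).
  apply: ev_fin => i; apply: ev_fin => j.
  have h1 := rpD (emb (A0 i j)) (\sum_k z ord0 k * emb (A k i j)).
  have h2 := rp_sum (index_enum 'I_m) (fun k => z ord0 k * emb (A k i j)).
  have h3 := ev_fin (fun k : 'I_m => rpM (z ord0 k) (emb (A k i j))).
  have h4 := ev_fin (fun k : 'I_m => rp_emb (A k i j)).
  apply: ev_mono2 (ev_and h1 (ev_and h2 (rp_emb (A0 i j)))) (ev_and h3 h4).
  move=> n [-> [-> ->]] [e3 e4]; rewrite PE; congr (_ + _).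
  by apply: eq_bigr => k _; rewrite e3 e4 mxE.
have /choice[Q hQ] : forall n, exists Q : 'M[R]_d,
    psd (P (rvec x n)) -> P (rvec x n) = Q *m Q^T.
  move=> n; have [/psd_gram[Q e]|no] := pselect (psd (P (rvec x n))); first by exists Q.
  by exists 0 => /no.
pose QS i k : S := cls (fun n => Q n i k).
have gram i j : PS x i j = \sum_k QS i k * QS j k.
  apply/rpE.
  have h2 := rp_sum (index_enum 'I_d) (fun k => QS i k * QS j k).
  have h3 := ev_fin (fun k : 'I_d => rpM (QS i k) (QS j k)).
  have h4 := ev_fin (fun k : 'I_d =>
    ev_and (clsK (fun n => Q n i k)) (clsK (fun n => Q n j k))).
  apply: ev_mono2 (ev_and hx (rpPS x)) (ev_and h2 (ev_and h3 h4)).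
  move=> n [/hQ e1 ->] [-> [e3 e4]]; rewrite e1 mxE; apply: eq_bigr => k _.
  by rewrite mxE e3; have [-> ->] := e4 k.
have Kemb r : K (emb r) by have [e _ _ _ _] := coefK; exact: e.
have pemb r : pmap s (emb r) (emb r).
  by have := partial_mapZ coefK (Kemb r) p1; rewrite !mulr1.
have pPS i j : pmap s (PS x i j) (PS y i j).
  apply: (partial_mapD coefK) => //; apply: (partial_map_sum coefK) => k.
  by rewrite ![_ * emb _]mulrC; apply: (partial_mapZ coefK).
have pos (v : 'I_d -> S) : 0 <= \sum_i \sum_j v i * v j * PS y i j.
  exact: (partial_map_psd coefK residueK lam_bdd lamV_bdd lam_neq0 lam_sim lam_pd
    v gs pPS gram).
apply: contrapT => /ev_not bad.
have sym n : P (rvec y n) \is symmetricmx.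
  apply/symmetricmxP; rewrite /P linearD linear_sum /=; congr (_ + _).
    exact/symmetricmxP.
  by apply: eq_bigr => k _; rewrite linearZ /=; congr (_ *: _); exact/symmetricmxP.
have /choice[w hw] : forall n, exists w : 'cV[R]_d, ~ psd (P (rvec y n)) ->
    (w^T *m P (rvec y n) *m w) ord0 ord0 < 0.
  move=> n; have [yes|] := pselect (psd (P (rvec y n))); first by exists 0.
  move=> /not_andP[/(_ (sym n)) //|/existsNP[w hw]]; exists w => _.
  by rewrite ltNge; apply/negP.
pose v i : S := cls (fun n => w n i ord0).
have := pos v; rewrite leNgt => /negP; apply; apply/rp_lt.
have h1 := rp_sum2 (fun i j => v i * v j * PS y i j).
have h2 : ev (fun n => forall i j, rp (v i * v j * PS y i j) n =
    rp (v i) n * rp (v j) n * rp (PS y i j) n).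
  apply: ev_fin => i; apply: ev_fin => j.
  by apply: ev_mono2 (rpM (v i * v j) (PS y i j)) (rpM (v i) (v j)) => n -> ->.
have h3 := ev_fin (fun i : 'I_d => clsK (fun n => w n i ord0)).
apply: ev_mono2 (ev_and bad (ev_and h1 h2)) (ev_and h3 (ev_and (rpPS y) (rp0 R))).
move=> n [/hw neg [-> e2]] [e3 [e4 ->]].
apply: le_lt_trans neg; rewrite le_eqVlt; apply/orP; left; apply/eqP.
rewrite mxE exchange_big /=; apply: eq_bigr => j _.
rewrite mxE mulr_suml; apply: eq_bigr => i _.
by rewrite e2 e4 /v !e3 mulrAC (_ : (w n)^T ord0 i = w n i ord0) // [LHS]mxE.
Qed.

(** Back and forth handles the two quantifiers. Spectrahedra pass in one direction only, hence
    positive formulas; equality passes in both, hence [Neq] among the relations. *)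
Lemma matched_holds m (f : positive_formula (spec_signature R) m) (x y : 'rV[S]_m) :
  matched x y -> holds hyper_structure f x -> holds hyper_structure f y.
Proof.
elim: m / f x y => [m s args|m i j|m f IHf g IHg|m f IHf g IHg|m f IHf|m f IHf] x y xy /=.
- have : matched (\row_k x ord0 (args k)) (\row_k y ord0 (args k)).
    have [b [gb p1 p]] := xy; exists b; split=> // i; rewrite !mxE; exact: p.
  case: s args => [m' X hX|] args /= mm; first exact: matched_spectrahedron.
  move=> /= hx.
  have E := matched_eq ord0 ord_max mm.
  have : (\row_k y ord0 (args k)) ord0 ord0 <> (\row_k y ord0 (args k)) ord0 ord_max.
    move=> /E /rpE e; have [n [h1 h2]] := ev_ex (ev_and hx e).
    by apply: h1; rewrite !rvecE.
  move=> /rpE /ev_not; apply: ev_mono => n h; apply: contra_not h.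
  by rewrite !rvecE.
- by move=> e; apply/(matched_eq i j xy).
- by move=> [/(IHf _ _ xy) p /(IHg _ _ xy) q].
- by move=> [/(IHf _ _ xy) p|/(IHg _ _ xy) q]; [left|right].
- move=> [d hd]; have [e de] := matched_forth d xy.
  by exists e; exact: IHf de hd.
- move=> h e; have [d de] := matched_back e xy.
  by apply: IHf de (h d).
Qed.

Lemma matched_definable m (X : set 'rV[R]_m) (x y : 'rV[S]_m) :
  positively_definable (spec_structure R) X -> matched x y ->
  ev (fun n => X (rvec x n)) -> ev (fun n => X (rvec y n)).
Proof. by move=> [f ->] xy /los h; apply/los; exact: matched_holds xy h. Qed.

End Transfer.

(** * The copositive cone *)

Lemma quadratic_formE (R : pzRingType) n (A : 'M[R]_n) (x : 'cV[R]_n) :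
  (x^T *m A *m x) ord0 ord0 = \sum_i \sum_j x i ord0 * A i j * x j ord0.
Proof.
rewrite mxE exchange_big /=; apply: eq_bigr => j _.
rewrite mxE mulr_suml; apply: eq_bigr => i _.
by rewrite (_ : x^T ord0 i = x i ord0) // [LHS]mxE.
Qed.

Lemma sym_coord_entry (R : realType) n (i j : 'I_n) : exists k,
  forall C : 'M[R]_n, C \is symmetricmx -> sym_coord C ord0 k = C i j.
Proof.
have upper (a b : 'I_n) : (a <= b)%N ->
    exists k, forall C : 'M[R]_n, sym_coord C ord0 k = C a b.
  move=> ab; have abT : (a, b) \in triangle n by rewrite inE.
  exists (cast_ord (card_triangle n) (enum_rank_in abT (a, b))) => C.
  by rewrite mxE cast_ordK enum_rankK_in.
have [/upper[k hk]|/ltnW/upper[k hk]] := leqP i j; first by exists k.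
by exists k => C /symmetricmxP CT; rewrite hk -[in LHS]CT mxE.
Qed.

Section HornBlock.
Variables (R : realType) (n : nat) (n5 : (5 <= n)%N).

Definition horn_block (s : nat -> R) : 'M[R]_n :=
  \matrix_(i, j) if (i < 5)%N && (j < 5)%N then horn R i j * s i * s j else 0.

Lemma horn_sym (i j : nat) : (i < 5)%N -> (j < 5)%N -> horn R i j = horn R j i.
Proof. by case: i j => [|[|[|[|[|i]]]]] [|[|[|[|[|j]]]]]. Qed.

Lemma horn_block_sym s : horn_block s \is symmetricmx.
Proof.
apply/symmetricmxP/matrixP => i j; rewrite !mxE andbC.
by case: ifP => // /andP[i5 j5]; rewrite (horn_sym i5 j5) mulrAC.
Qed.

Lemma sum_first_five (V : nmodType) (F : 'I_n -> V) :
  \sum_(i < n) (if (i < 5)%N then F i else 0) = \sum_(i < 5) F (widen_ord n5 i).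
Proof. by rewrite -big_mkcond big_ord_narrow. Qed.

Lemma horn_block_copositive s : (forall i, 0 <= s i) -> copositive (horn_block s).
Proof.
move=> s0; split; first exact: horn_block_sym.
move=> x x0; rewrite quadratic_formE.
pose y (i : 'I_5) := s i * x (widen_ord n5 i) ord0.
have := @horn_copositive R y (fun i => mulr_ge0 (s0 i) (x0 _)).
rewrite (_ : \sum_(i < n) _ = \sum_(i < n) if (i < 5)%N then
  \sum_(j < n) (if (j < 5)%N then horn R i j * (s i * x i ord0) * (s j * x j ord0) else 0) else 0).
  rewrite sum_first_five; congr (0 <= _); apply: eq_bigr => i _.
  by rewrite sum_first_five.
apply: eq_bigr => i _; case: ifP => i5; last first.
  by rewrite big1 // => j _; rewrite mxE i5 /= mulr0 mul0r.
apply: eq_bigr => j _; rewrite mxE i5 /=; case: ifP => j5; last by rewrite mulr0 mul0r.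
by ring.
Qed.

(** The test vector undoes the diagonal scaling of [horn_block]. *)
Lemma copositive_test (B : 'M[R]_n) (s : nat -> R) : (forall i, 0 < s i) -> copositive B ->
  0 <= \sum_(i < 5) \sum_(j < 5) B (widen_ord n5 i) (widen_ord n5 j) / (s i * s j).
Proof.
move=> s0 [_ pos].
pose x : 'cV[R]_n := \col_i if (i < 5)%N then (s i)^-1 else 0.
have := pos x; rewrite quadratic_formE => h; apply: le_trans (h _) _.
  by move=> i; rewrite mxE; case: ifP => // _; rewrite invr_ge0 ltW.
rewrite (_ : \sum_(i < n) _ = \sum_(i < n) if (i < 5)%N then
  \sum_(j < n) (if (j < 5)%N then B i j / (s i * s j) else 0) else 0).
  by rewrite sum_first_five; under eq_bigr do rewrite sum_first_five.
apply: eq_bigr => i _; case: ifP => i5; last first.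
  by rewrite big1 // => j _; rewrite mxE i5 !mul0r.
apply: eq_bigr => j _; rewrite !mxE i5; case: ifP => j5; last by rewrite mulr0.
by rewrite invfM mulrAC mulrC mulrA.
Qed.

(** The five scaling elements have independent logarithms [base R i], so the (i, j) entry of the
    Horn block is multiplied by the normalized [Lam] at [base R i + base R j], up to a negligible
    error. After rescaling, the image entries add up to the normalized Horn sum, which lies below
    zero by at least [gap] over [Lam 0]; the inverse of this margin is bounded, so the error cannot
    make up for it. *)
Lemma copositive_cone_not_definable :
  ~ positively_definable (spec_structure R) (copositive_cone R n).
Proof.
move=> defin.
have [beta [betaC betaD beta_ge0 beta_fin beta_base]] := hyper_form R.
have [K [coefK residueK]] := coefficient_field R.
pose L := Lam beta; pose lm := lam beta.
have lmbdd := lam_bdd betaC betaD beta_ge0 beta_base.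
have lmVbdd := lamV_bdd betaC betaD beta_ge0 beta_base.
have lmn0 := lam_neq0 betaC betaD beta_ge0 beta_base.
have lmsim := lam_sim betaC betaD beta_ge0 beta_fin.
have lm1 := lam1 betaC betaD beta_ge0 beta_base.
have lmpd := lam_pd betaC betaD beta_ge0 beta_fin beta_base.
pose sg (k i : nat) : R := expR (k%:R ^+ 2 * k%:R ^+ i.+1).
have sg0 k i : 0 < sg k i by exact: expR_gt0.
pose A k := horn_block (sg k).
pose X := \row_t cls (fun k => sym_coord (A k) ord0 t).
have [Y XY] := matched_exists coefK residueK lm1 X.
have evX : ev (fun k => copositive_cone R n (rvec X k)).
  apply: ev_mono (rvec_cls (fun k => sym_coord (A k))) => k ->.
  by exists (A k) => //; apply: horn_block_copositive => i; exact: ltW.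
have evY := matched_definable coefK residueK lmbdd lmVbdd lmn0 lmsim lmpd defin XY evX.
have /choice[t tE] : forall p : 'I_5 * 'I_5, exists t, forall C : 'M[R]_n,
    C \is symmetricmx -> sym_coord C ord0 t = C (widen_ord n5 p.1) (widen_ord n5 p.2).
  by move=> p; exact: sym_coord_entry.
pose S := hyper R.
pose se (i : 'I_5) : S := scale_elt R i.
have se0 i : se i != 0 by rewrite gt_eqF // scale_elt_gt0.
pose h (i j : 'I_5) : S := @emb R (horn R i j).
have hh i j : h i j = 1 \/ h i j = -1.
  by rewrite /h /horn; case: ifP => _; [right; rewrite rmorphN1|left; rewrite rmorph1].
have XE i j : X ord0 (t (i, j)) = h i j * (se i * se j).
  rewrite mxE -[RHS]rpK; apply/clsE.
  apply: ev_mono2 (ev_and (rpM (h i j) (se i * se j)) (rpM (se i) (se j)))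
    (ev_and (rp_emb (horn R i j)) (ev_and (rp_scale_elt R i) (rp_scale_elt R j))).
  move=> k [-> ->] [-> [-> ->]]; rewrite tE ?horn_block_sym // mxE /= !ltn_ord /=.
  by rewrite /sg mulrA.
pose eta i j := Y ord0 (t (i, j)) / (se i * se j).
have etaE i j : exists2 mu, negl mu & eta i j = h i j * (L (base R i + base R j) / L 0) + mu.
  have [s [gs _ /(_ (t (i, j))) pt]] := XY.
  have X0 : X ord0 (t (i, j)) != 0.
    rewrite XE !mulf_neq0 //; by case: (hh i j) => ->; rewrite ?oppr_eq0 oner_eq0.
  case: (partial_map_leading coefK lmbdd lmsim gs pt) => [[e _]|[_ nm]].
    by rewrite e eqxx in X0.
  have lX : lm (X ord0 (t (i, j))) = L (base R i + base R j) / L 0.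
    rewrite /lm /lam -/L; congr (L _ / _); rewrite XE.
    have -> : ell (h i j * (se i * se j)) = ell (se i * se j).
      by case: (hh i j) => ->; rewrite ?mulN1r ?ellN ?mul1r.
    by rewrite ellM // !ell_scale_elt.
  exists (h i j * (Y ord0 (t (i, j)) / X ord0 (t (i, j)) - lm (X ord0 (t (i, j))))).
    by apply: neglMr => //; exact: bdd_emb.
  rewrite lX /eta XE mulrBr addrC subrK.
  by case: (hh i j) => ->; rewrite ?mulN1r ?mul1r // invrN mulrN opprK.
have /choice[mu0 mu0E] : forall p : 'I_5 * 'I_5, exists mu, negl mu /\
    eta p.1 p.2 = h p.1 p.2 * (L (base R p.1 + base R p.2) / L 0) + mu.
  by move=> p; have [mu nmu e] := etaE p.1 p.2; exists mu.
have L0 : 0 < L 0 := Lam_gt0 betaC betaD beta_ge0 beta_base 0.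
have g0 := gap_gt0 R.
pose nu := \sum_(i < 5) \sum_(j < 5) mu0 (i, j).
have nnu : negl nu.
  by apply: negl_sum => i _; apply: negl_sum => j _; have [] := mu0E (i, j).
have sumE : \sum_(i < 5) \sum_(j < 5) eta i j =
    (\sum_(i < 5) \sum_(j < 5) h i j * L (base R i + base R j)) / L 0 + nu.
  rewrite mulr_suml -big_split /=; apply: eq_bigr => i _.
  rewrite mulr_suml -big_split /=; apply: eq_bigr => j _.
  by have [_ /= ->] := mu0E (i, j); rewrite mulrA.
have neg : \sum_(i < 5) \sum_(j < 5) eta i j < 0.
  rewrite sumE; have := horn_Lam_negative betaC betaD beta_base.
  rewrite -/L => hneg.
  have : (\sum_(i < 5) \sum_(j < 5) h i j * L (base R i + base R j)) / L 0 <=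
      - (gap R) / L 0.
    by rewrite ler_pM2r ?invr_gt0.
  have gL : 0 < gap R / L 0 by rewrite divr_gt0.
  have small : `|nu / (gap R / L 0)| <= @emb R 2^-1.
    apply: negl_small; last lra.
    apply: neglMl => //; rewrite invf_div; apply: bddM; last exact: gapV_bdd.
    exact: (Lam_bdd beta_ge0).
  rewrite normrM normfV (gtr0_norm gL) ler_pdivrMr // fmorphV rmorph_nat in small.
  have := le_trans (ler_norm nu) small; rewrite mulNr; lra.
have : 0 <= \sum_(i < 5) \sum_(j < 5) eta i j.
  apply/rp_le.
  have h1 := rp_sum2 eta.
  have h2 : ev (fun k => forall i j,
      rp (eta i j) k = rp (Y ord0 (t (i, j))) k / (sg k i * sg k j)).
    apply: ev_fin => i; apply: ev_fin => j.
    have q := rpM (Y ord0 (t (i, j))) (se i * se j)^-1.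
    apply: ev_mono2 (ev_and q (ev_and (rpV (se i * se j)) (rpM (se i) (se j))))
      (ev_and (rp_scale_elt R i) (rp_scale_elt R j)).
    by move=> k [-> [-> ->]] [-> ->].
  apply: ev_mono2 (ev_and evY (rp0 R)) (ev_and h1 h2) => k [[B Bcop BY] ->] [-> e2].
  have Bsym : B \is symmetricmx by case: Bcop.
  have := copositive_test (sg0 k) Bcop; congr (0 <= _).
  apply: eq_bigr => i _; apply: eq_bigr => j _; rewrite e2 -(tE (i, j)) // BY.
  by rewrite rvecE.
by rewrite leNgt neg.
Qed.

End HornBlock.

Theorem corollary3p18 (R : realType) (n : nat) (hn : (5 <= n)%N) :
  ~ spectrahedral_shadow (copositive_cone R n) /\
  ~ positively_definable (spec_structure R) (copositive_cone R n).
Proof.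
split; last exact: copositive_cone_not_definable.
by move=> /spectrahedral_shadow_definable; exact: copositive_cone_not_definable.
Qed.
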